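(* Let $d\in\{2,3\}$, let $W$ satisfy Assumption (W) (stated in the context), and fix $\beta>0$ and $\alpha>0$. Set $$\chi^{(\otimes)}_\alpha(\beta)=\inf_{\phi\in L^2(\mathbb{R}^d):\|\phi\|_2=1}\Big(J_\beta(\phi^2)+\langle W,\phi^2\rangle+4\pi\alpha\,\|\phi\|_4^4\Big).$$ (i) There exists a unique $L^2$-normalised minimiser $\phi_*\in L^2(\mathbb{R}^d)\cap L^4(\mathbb{R}^d)$ of the right-hand side. (ii) For any neighbourhood $\mathcal{N}\subset L^2(\mathbb{R}^d)\cap L^4(\mathbb{R}^d)$ of $\phi_*$, $$\inf_{\phi\in L^2(\mathbb{R}^d):\ \|\phi\|_2=1,\ \phi\notin\mathcal{N}}\Big(J_\beta(\phi^2)+\langle W,\phi^2\rangle+4\pi\alpha\,\|\phi\|_4^4\Big)>\chi^{(\otimes)}_\alpha(\beta).$$ Here ''neighbourhood'' refers to any of the three following topologies: weakly in $L^2$, weakly in $L^4$, and weakly in the sense of probability measures, if $\phi$ is identified with the measure $\phi(x)^2\,dx$.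
   Context: $(B_t)_{t\ge0}$ is a Brownian motion in $\mathbb{R}^d$ with generator $\Delta$ and a fixed initial distribution $\mathfrak m$ with $\operatorname{supp}(\mathfrak m)\subset\{W<\infty\}$; $\mathbb{E}$ is the corresponding expectation. Assumption (W): $W:\mathbb{R}^d\to[0,\infty]$ is continuous in $\{W<\infty\}$ with $\lim_{R\to\infty}\inf_{|x|>R}W(x)=\infty$, and $\{W<\infty\}$ is either equal to $\mathbb{R}^d$ or is a bounded connected open set. For a probability measure $\mu$ on $\mathbb{R}^d$, $J_\beta(\mu)=\sup_{f\in\mathcal{C}_{\rm b}(\mathbb{R}^d)}\big(\langle\mu,f\rangle-\frac1\beta\log\mathbb{E}[e^{\int_0^\beta f(B_s)\,ds}]\big)\in[0,\infty]$, where $\mathcal{C}_{\rm b}(\mathbb{R}^d)$ is the set of bounded continuous functions on $\mathbb{R}^d$ and $\langle\mu,f\rangle=\int f\,d\mu$; for $L^2$-normalised $\phi$, $J_\beta(\phi^2)$ means $J_\beta(\mu)$ with $\mu(dx)=\phi^2(x)\,dx$. Also $\langle W,\phi^2\rangle=\int_{\mathbb{R}^d} W(x)\phi^2(x)\,dx$, and $\|\phi\|_4^4=\int_{\mathbb{R}^d}|\phi(x)|^4\,dx$, which is $\infty$ if $\phi\notin L^4(\mathbb{R}^d)$.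
   Formalization: Since -φ_* has the same energy as φ_*, uniqueness and the weak L²/L⁴ parts of (ii) are stated up to sign: φ_* ≥ 0, every minimiser ψ satisfies |ψ| = φ_* a.e., and for weak L² and weak L⁴ neighbourhoods ''φ ∉ N'' is replaced by ''|φ| ∉ N''. *)

(* Defs.v *)
From HB Require Import structures.
From mathcomp Require Import all_boot all_order all_algebra.
From mathcomp Require Import all_classical all_reals all_analysis.

Set Implicit Arguments.
Unset Strict Implicit.
Unset Printing Implicit Defensive.
Import Order.TTheory GRing.Theory Num.Theory.
Import numFieldNormedType.Exports.

Local Open Scope classical_set_scope.
Local Open Scope ring_scope.

(* R^d is 'rV[R]_d, with the product sigma-algebra of the d coordinates, as the
   library does for n.-tuple T. It is the Borel sigma-algebra of the topology
   of 'rV[R]_d. *)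
Definition rV_display : measure_display -> measure_display.
Proof. exact. Qed.

Section measurable_rV.
Context {R : realType} (n : nat).

Let coors : 'I_n -> 'rV[R]_n -> R := fun i v => v ord0 i.

Let rV_set0 : g_sigma_preimage coors set0.
Proof. exact: sigma_algebra0. Qed.

Let rV_setC A : g_sigma_preimage coors A -> g_sigma_preimage coors (~` A).
Proof. exact: sigma_algebraC. Qed.

Let rV_bigcup (F : _^nat) : (forall i, g_sigma_preimage coors (F i)) ->
  g_sigma_preimage coors (\bigcup_i (F i)).
Proof. exact: sigma_algebra_bigcup. Qed.

HB.instance Definition _ := @isMeasurable.Build
  (rV_display default_measure_display) 'rV[R]_n
  (g_sigma_preimage coors) rV_set0 rV_setC rV_bigcup.

End measurable_rV.

Section rV_measurable_functions.
Context {R : realType} {disp : measure_display} {T : measurableType disp}.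

Lemma measurable_coord n (i : 'I_n) :
  measurable_fun [set: 'rV[R]_n] (fun v : 'rV[R]_n => v ord0 i).
Proof.
move=> _ Y mY; rewrite setTI; apply: sub_sigma_algebra => /=.
rewrite -bigcup_seq/=; exists i => /=; first by rewrite mem_index_enum.
by exists Y => //; rewrite setTI.
Qed.

Lemma measurable_fun_coordP n (f : T -> 'rV[R]_n) :
  measurable_fun [set: T] f <->
  forall i, measurable_fun [set: T] (fun x => f x ord0 i).
Proof.
split=> [mf i|mf].
  by apply: (measurableT_comp (measurable_coord i)).
apply: measurability => [//|_ [A + <-]] /=.
rewrite setTI -bigcup_seq/= => -[i _ [B mB <-]].
rewrite setTI -comp_preimage.
by have := mf i measurableT B mB; rewrite setTI.
Qed.

End rV_measurable_functions.

Section lebesgue_rV.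
Context {R : realType}.

Definition rV_cons n (p : measurableTypeR R * 'rV[R]_n) : 'rV[R]_n.+1 :=
  \row_i oapp (p.2 ord0) p.1 (unlift ord0 i).

Definition rV_uncons n (v : 'rV[R]_n.+1) : measurableTypeR R * 'rV[R]_n :=
  (v ord0 ord0, \row_i v ord0 (lift ord0 i)).

Lemma rV_consK n : cancel (@rV_cons n) (@rV_uncons n).
Proof.
move=> [x v]; rewrite /rV_uncons /rV_cons mxE unlift_none/=; congr pair.
by apply/rowP => i; rewrite !mxE liftK.
Qed.

Lemma measurable_rV_cons n : measurable_fun [set: _] (@rV_cons n).
Proof.
apply/measurable_fun_coordP => i.
case: (unliftP ord0 i) => [j|] ij.
  rewrite (_ : (fun _ => _) = (fun v : 'rV[R]_n => v ord0 j) \o snd).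
    by apply: measurableT_comp; [exact: measurable_coord|exact: measurable_snd].
  by apply/funext => p /=; rewrite mxE ij liftK.
rewrite (_ : (fun _ => _) = fst); first exact: measurable_fst.
by apply/funext => p /=; rewrite mxE ij unlift_none.
Qed.

Lemma measurable_rV_uncons n : measurable_fun [set: _] (@rV_uncons n).
Proof.
apply/measurable_fun_pairP; split; first exact: (measurable_coord ord0).
apply/measurable_fun_coordP => i /=.
rewrite (_ : (fun _ => _) = (fun v : 'rV[R]_n.+1 => v ord0 (lift ord0 i))).
  exact: measurable_coord.
by apply/funext => v; rewrite mxE.
Qed.

Section push.
Variables (n : nat) (mu : {sigma_finite_measure set 'rV[R]_n -> \bar R}).

Definition lebesgue_cons : set 'rV[R]_n.+1 -> \bar R :=
  pushforward (@lebesgue_measure R \x mu)%E (@rV_cons n).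

Let lebesgue_cons0 : lebesgue_cons set0 = 0%E.
Proof. by rewrite /lebesgue_cons /pushforward preimage_set0 measure0. Qed.

Let lebesgue_cons_ge0 A : (0 <= lebesgue_cons A)%E.
Proof. exact: (measure_ge0 (@lebesgue_measure R \x mu)%E). Qed.

Let measurable_preimage_cons A : measurable A ->
  measurable (@rV_cons n @^-1` A).
Proof.
by move=> mA; rewrite -[X in measurable X]setTI; exact: measurable_rV_cons.
Qed.

Let lebesgue_cons_sigma_additive : semi_sigma_additive lebesgue_cons.
Proof.
move=> F mF tF mUF; rewrite /lebesgue_cons /pushforward preimage_bigcup.
apply: measure_semi_sigma_additive.
- by move=> k; exact: measurable_preimage_cons.
- apply/trivIsetP => /= i j _ _ ij; rewrite -preimage_setI.
  by move/trivIsetP : tF => /(_ _ _ _ _ ij) ->//; rewrite preimage_set0.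
- by rewrite -preimage_bigcup; exact: measurable_preimage_cons.
Qed.

HB.instance Definition _ := isMeasure.Build _ _ _ lebesgue_cons
  lebesgue_cons0 lebesgue_cons_ge0 lebesgue_cons_sigma_additive.

Let lebesgue_cons_sigma_finite : sigma_finite setT lebesgue_cons.
Proof.
have /sigma_finiteP[F [TF ndF Foo]] := sigma_finiteT (@lebesgue_measure R).
have /sigma_finiteP[G [TG ndG Goo]] := sigma_finiteT mu.
exists (fun k => @rV_uncons n @^-1` (F k `*` G k)).
  apply/seteqP; split=> // v _.
  have : [set: measurableTypeR R] (rV_uncons v).1 by [].
  have : [set: 'rV[R]_n] (rV_uncons v).2 by [].
  rewrite TF TG => -[k _ Gk] [l _ Fl]; exists (maxn l k) => //; split.
    by move: Fl; exact/subsetPset/ndF/leq_maxl.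
  by move: Gk; exact/subsetPset/ndG/leq_maxr.
move=> k; have [mF Fk] := Foo k; have [mG Gk] := Goo k; split.
  rewrite -[X in measurable X]setTI.
  by apply: measurable_rV_uncons => //; exact: measurableX.
rewrite /lebesgue_cons /pushforward -comp_preimage.
rewrite (_ : _ \o _ = id) ?preimage_id; last exact/funext/rV_consK.
by rewrite product_measure1E// lte_mul_pinfty// ge0_fin_numE.
Qed.

HB.instance Definition _ := Measure_isSigmaFinite.Build _ _ _ lebesgue_cons
  lebesgue_cons_sigma_finite.

End push.

(* Lebesgue measure on R^n. *)
Fixpoint lebesgue_rV n : {sigma_finite_measure set 'rV[R]_n -> \bar R} :=
  match n with
  | 0 => \d_(0 : 'rV[R]_0)
  | n'.+1 => lebesgue_cons (lebesgue_rV n')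
  end.

Lemma lebesgue_rV_box n (A : 'I_n -> set (measurableTypeR R)) :
  (forall i, measurable (A i)) ->
  lebesgue_rV n [set v | forall i, A i (v ord0 i)] =
  (\prod_(i < n) lebesgue_measure (A i))%E.
Proof.
elim: n A => [|n IH] A mA.
  by rewrite big_ord0 /= diracE mem_set// => -[].
rewrite big_ord_recl -IH //= /lebesgue_cons /pushforward.
rewrite -product_measure1E; [|exact: mA|]; last first.
  rewrite (_ : (fun _ => _) =
      \bigcap_i ((fun v : 'rV[R]_n => v ord0 i) @^-1` A (lift ord0 i))).
    apply: fin_bigcap_measurable => // i _.
    by rewrite -[X in measurable X]setTI; exact: (measurable_coord i measurableT (mA (lift ord0 i))).
  by apply/seteqP; split=> v /= h i => [_|]; exact: h.
congr product_measure1; apply/seteqP; split=> -[x v] /=.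
  move=> h; split=> [|i].
    by have := h ord0; rewrite mxE unlift_none.
  by have := h (lift ord0 i); rewrite mxE liftK.
move=> [h1 h2] i; rewrite mxE.
by case: (unliftP ord0 i) => [j ->|->] /=; [exact: h2|exact: h1].
Qed.

End lebesgue_rV.

Section trapped_brownian_motion.
Context {R : realType} {d : nat}.
Local Notation Rd := 'rV[R]_d.
Local Notation leb := (lebesgue_rV (R := R) d).

(* The norm of 'rV[R]_d in the library is the sup norm. *)
Definition euclidean_norm (x : Rd) : R := Num.sqrt (\sum_i x ord0 i ^+ 2).

Definition trap_assumption (W : Rd -> \bar R) : Prop :=
  let dom := [set x | W x < +oo]%E in
  [/\ forall x, (0 <= W x)%E,
      {within dom, continuous W},
      ereal_inf (W @` [set x | r < euclidean_norm x])
        @[r --> +oo] --> +oo%E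
    & dom = setT \/ [/\ bounded_set dom, connected dom & open dom]].

Definition measure_support (m : set Rd -> \bar R) : set Rd :=
  [set x | forall U : set Rd, open U -> U x -> (0 < m U)%E].

Section brownian.
Context {disp : measure_display} {Omega : measurableType disp}.
Variables (P : probability Omega R) (m : probability Rd R).
Variable B : R -> Omega -> Rd.

(* The sigma-algebra generated by the B u with 0 <= u <= s. *)
Definition past (s : R) : set (set Omega) :=
  <<s [set E | exists u (A : set Rd),
         [/\ 0 <= u, u <= s, measurable A & E = B u @^-1` A]] >>.

(* Only the times t >= 0 matter. The generator is the Laplacian (and not half
   of it), so the d coordinates of an increment over a time span t are
   independent centred normal variables of variance 2 t; the second argument
   of normal_prob is the standard deviation. *)
Definition brownian_motion : Prop :=
  [/\ forall t, 0 <= t -> measurable_fun [set: Omega] (B t),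
      forall A : set Rd, measurable A -> P (B 0 @^-1` A) = m A,
      forall s t (E : set Omega) (A : 'I_d -> set (measurableTypeR R)),
        0 <= s -> s < t -> past s E -> (forall i, measurable (A i)) ->
        P (E `&` [set w | forall i, A i ((B t w - B s w) ord0 i)]) =
        (P E * \prod_(i < d) normal_prob 0 (Num.sqrt (2 * (t - s))) (A i))%E
    & forall w, {within `[0, +oo[, continuous (fun t => B t w)}].

Definition bounded_continuous : set (Rd -> R) :=
  [set f | continuous f /\ bounded_fun f].

(* The integral of f (B s) over [0, beta]. *)
Definition path_integral (beta : R) (f : Rd -> R) (w : Omega) : R :=
  \int[lebesgue_measure]_(s in `[0, beta]) f (B s w).

(* mu is meant to be a probability measure; for bounded f both terms of the
   difference are then finite. *)
Definition rate_J (beta : R) (mu : set Rd -> \bar R) : \bar R :=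
  ereal_sup [set (\int[mu]_x (f x)%:E
      - beta^-1%:E * lne 'E_P[fun w => expR (path_integral beta f w)])%E
    | f in bounded_continuous].

(* phi(x)^2 dx *)
Definition square_measure (phi : Rd -> R) : set Rd -> \bar R :=
  fun A => (\int[leb]_(x in A) (phi x ^+ 2)%:E)%E.

(* Since W >= 0 and J_beta >= 0 (take f = 0), no +oo - oo occurs. The energy
   depends on phi only through its modulus, so a minimiser can be unique only up
   to a (measurable) choice of sign, i.e. as a nonnegative function. *)
Definition energy (W : Rd -> \bar R) (alpha beta : R) (phi : Rd -> R) :
    \bar R :=
  (rate_J beta (square_measure phi)
   + \int[leb]_x (W x * (phi x ^+ 2)%:E)
   + (4 * pi * alpha)%:E * \int[leb]_x (`|phi x| ^+ 4)%:E)%E.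

Definition L2_normalised : set (Rd -> R) :=
  [set phi | phi \in Lfun leb 2%:E /\ 'N[leb]_2%:E[EFin \o phi]%E = 1%E].

Definition chi_tensor (W : Rd -> \bar R) (alpha beta : R) : \bar R :=
  ereal_inf [set energy W alpha beta phi | phi in L2_normalised].

End brownian.

Definition L2_cap_L4 : set (Rd -> R) :=
  [set phi | phi \in Lfun leb 2%:E /\ phi \in Lfun leb 4%:E].

(* The pairings of phi with all g in the dual L^q of L^p. *)
Definition dual_pairing (p : \bar R) (phi : Rd -> R) :
    {ptws [set g | g \in Lfun leb (hoelder_conjugate p)] -> R} :=
  fun g => \int[leb]_x (phi x * \val g x).

Definition measure_pairing (phi : Rd -> R) : {ptws bounded_continuous -> R} :=
  fun f => fine (\int[square_measure phi]_x (\val f x)%:E)%E.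

(* The neighbourhoods of phi in L^2 `&` L^4, whose elements are represented by
   functions, for the topology induced by the weak topology of L^p ... *)
Definition nbhs_weak_Lp (p : \bar R) (phi : Rd -> R) : set_system (Rd -> R) :=
  within L2_cap_L4 (@nbhs _ (initial_topology (@dual_pairing p)) phi).

(* ... and by the weak topology of measures, through phi |-> phi(x)^2 dx. *)
Definition nbhs_weak_measure (phi : Rd -> R) : set_system (Rd -> R) :=
  within L2_cap_L4 (@nbhs _ (initial_topology measure_pairing) phi).

End trapped_brownian_motion.

(* Main.v *)
Require Import Defs.
From HB Require Import structures.
From mathcomp Require Import all_boot all_order all_algebra.
From mathcomp Require Import all_classical all_reals all_analysis.
From mathcomp Require Import measurable_realfun ring lra.

Set Implicit Arguments.
Unset Strict Implicit.
Unset Printing Implicit Defensive.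
Import Order.TTheory GRing.Theory Num.Theory.
Import numFieldNormedType.Exports.

Local Open Scope classical_set_scope.
Local Open Scope ring_scope.

(** Written in terms of [rho = phi ^ 2], the energy is a supremum of affine
    functionals plus the linear term [<W, rho>] plus the strictly convex
    [kappa * int rho ^ 2].  The midpoint identity for squares therefore makes
    almost-minimisers a Cauchy family in L^2; as [W] has sublevel sets of finite
    measure and [<W, rho>] is bounded along them, they are also Cauchy in L^1.
    The limit is a minimiser by Fatou's lemma, and every almost-minimiser is
    close to it in L^1 and L^2, which gives uniqueness and part (ii), because
    [||phi| - phi_*| ^ 2 <= |phi ^ 2 - phi_* ^ 2|].

    The infimum is finite: condition the Brownian motion to stay, up to time
    [beta], in a small cube around a point of the support of its initial law.
    By Jensen's inequality the averaged occupation law of the conditioned motion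
    has finite rate, and for [d <= 3] it has a square integrable density. *)

(** The rate enters only through its dual formula, so compactness of minimising sequences cannot be
    read off from regularity of densities of finite rate. Convexity supplies strong convergence
    instead, after which lower semicontinuity is elementary: for each fixed bounded [f] the affine
    term is Lipschitz in L^1, and the supremum over [f] is taken after the limit. Convexity lives in
    [rho], where the sign of [phi] is lost; hence uniqueness up to sign, and weak L^p neighbourhoods
    tested on [|phi|]. The initial law may be singular, so the occupation density must come from
    times [t > 0], where the law of [B t] has density at most [(4 pi t)^(-d/2)]. Cutting time at
    [beta 4^-k] leaves a mass at most [beta 4^-k] and a density of order [2^k] (worst case [d = 3]).
    The mass above height [2^k] is then of order [4^-k], and [2^k 4^-k] is summable; this is where
    the dimension enters. Staying in a cube is derived directly from Gaussian increments and path
    continuity, by fourth-power tail bounds and dyadic chaining over short time steps. *)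

Lemma eseries_geometric (R : realType) (a x : R) : `|x| < 1 ->
  (\sum_(n <oo) (a * x ^+ n)%:E = (a / (1 - x))%:E)%E.
Proof.
move=> x1; apply/cvg_lim => //.
rewrite (_ : (fun n => _) = EFin \o series (geometric a x)).
  by apply: cvg_EFin; [exact: nearW|exact: cvg_geometric_series].
by apply/funext => n; rewrite /series /= sumEFin.
Qed.

(** * Fatou's lemma and limits of L^1 Cauchy sequences *)

Section almost_everywhere_limits.
Context d (T : measurableType d) (R : realType) (mu : {measure set T -> \bar R}).

Lemma cvg_le_limn_einf (u : (\bar R)^nat) l : u @ \oo --> l -> (l <= limn_einf u)%E.
Proof. by move=> /cvg_limn_einf_sup[-> _]. Qed.

(** Fatou in the form applied below: the lower limit dominates [h] almost everywhere only, and the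
    integrals are controlled through an eventual bound [c] that converges. *)
Lemma fatou_ae_le (g : nat -> T -> \bar R) (h : T -> \bar R) (c : nat -> \bar R) l :
  (forall n, measurable_fun setT (g n)) -> (forall n x, 0 <= g n x)%E ->
  measurable_fun setT h -> (forall x, 0 <= h x)%E ->
  {ae mu, forall x, h x <= limn_einf (g ^~ x)}%E ->
  (\forall n \near \oo, \int[mu]_x g n x <= c n)%E -> c @ \oo --> l ->
  (\int[mu]_x h x <= l)%E.
Proof.
move=> mg g0 mh h0 gh gc cl.
have me : measurable_fun setT (fun x => limn_einf (g^~ x)).
  rewrite (_ : (fun _ => _) = (fun x => - limn_esup (fun n => - g n x))%E).
    by apply: measurableT_comp => //; apply: measurable_fun_limn_esup => n;
      exact: measurableT_comp.
  by apply/funext => x.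
have : (\int[mu]_x h x <= \int[mu]_x limn_einf (g^~ x))%E.
  apply: ae_ge0_le_integral => //.
  - move=> x _; rewrite limn_einf_lim; apply: lime_ge; first exact: is_cvg_einfs.
    by apply: nearW => n; apply: le_ereal_inf_tmp => _ [m _ <-]; exact: g0.
  - by apply: filterS gh => x gx _.
move=> /le_trans; apply.
apply: (le_trans (fatou _ _ _ _)) => //.
rewrite limn_einf_lim; apply: lime_le; first exact: is_cvg_einfs.
apply: nearW => n; rewrite -(cvg_lim _ cl)//; apply: lime_ge; first by apply/cvg_ex; exists l.
near=> m; apply: (@le_trans _ _ (\int[mu]_x g m x)%E); last by near: m.
by apply: ereal_inf_lbound; exists m => //=; near: m; exists n.
Unshelve. all: by end_near. Qed.

(** By monotone convergence the sum of the absolute increments is integrable, hence finite almost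
    everywhere; at such points the telescoping series converges absolutely. *)
Lemma summable_increments_cvg (u : nat -> T -> R) :
  (forall n, measurable_fun setT (u n)) ->
  (\sum_(n <oo) \int[mu]_x (`|u n.+1 x - u n x|)%:E < +oo)%E ->
  {ae mu, forall x, cvgn (u ^~ x)}.
Proof.
move=> mu_ sfin.
have mi n : measurable_fun setT (fun x => (`|u n.+1 x - u n x|)%:E).
  by apply/measurable_EFinP; apply: measurableT_comp => //; exact: measurable_funB.
rewrite -integral_nneseries// in sfin.
have iS : mu.-integrable setT (fun x => \sum_(n <oo) (`|u n.+1 x - u n x|)%:E)%E.
  apply/integrableP; split; first exact: ge0_emeasurable_sum.
  by under eq_integral do rewrite gee0_abs ?nneseries_ge0//.
have := integrable_ae measurableT iS; apply: filterS => x /(_ I) Sfin.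
pose v n := u n.+1 x - u n x.
have cv : cvgn (series v).
  apply: normed_cvg; apply: nondecreasing_is_cvgn.
    by apply: nondecreasing_series => n _ _; exact: normr_ge0.
  exists (fine (\sum_(n <oo) (`|u n.+1 x - u n x|)%:E)%E) => _ [n _ <-].
  rewrite -lee_fin fineK// /series/= -sumEFin.
  exact: (nneseries_lim_ge n).
rewrite (_ : u^~ x = (fun n => u 0%N x + series v n)).
  by apply: is_cvgD => //; exact: is_cvg_cst.
apply/funext => n; rewrite /v.
have := @telescopeK _ (u^~ x); rewrite /telescope /= => /(congr1 (fun h => h n)) /=.
by move=> ->; rewrite addrC subrK.
Qed.

(** The rate [2^-n] makes consecutive increments summable, so the whole sequence converges almost
    everywhere. The limit is represented by [fine] of the upper limit, which is measurable and
    nonnegative at every point; its L^1 distance to [u n] comes from Fatou with [n] fixed. *)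
Lemma L1_cauchy_limit (u : nat -> T -> R) :
  (forall n, measurable_fun setT (u n)) -> (forall n x, 0 <= u n x) ->
  (forall n m, (n <= m)%N -> \int[mu]_x (`|u n x - u m x|)%:E <= ((2^-1) ^+ n)%:E)%E ->
  exists v : T -> R, [/\ measurable_fun setT v, (forall x, 0 <= v x),
    {ae mu, forall x, u ^~ x @ \oo --> v x} &
    (forall n, \int[mu]_x (`|u n x - v x|)%:E <= ((2^-1) ^+ n)%:E)%E].
Proof.
move=> mu_ u0 cu.
have aec : {ae mu, forall x, cvgn (u ^~ x)}.
  apply: summable_increments_cvg => //.
  apply: (@le_lt_trans _ _ (\sum_(n <oo) ((2^-1) ^+ n)%:E)%E).
    apply: lee_nneseries => [n _ _|n _]; first exact: integral_ge0.
    under eq_integral do rewrite distrC.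
    exact: cu.
  under eq_eseriesr do rewrite -[_ ^+ _]mul1r.
  by rewrite eseries_geometric ?ltry// ger0_norm; lra.
pose w x := limn_esup (fun n => (u n x)%:E).
have mw : measurable_fun setT w.
  by apply: measurable_fun_limn_esup => n; exact/measurable_EFinP.
have w0 x : (0 <= w x)%E.
  rewrite /w limn_esup_lim; apply: lime_ge; first exact: is_cvg_esups.
  apply: nearW => n; apply: (@le_trans _ _ (u n x)%:E); first by rewrite lee_fin.
  by apply: ereal_sup_ubound; exists n => //=.
have cw : {ae mu, forall x, u ^~ x @ \oo --> fine (w x)}.
  apply: filterS aec => x /cvg_ex[l ul].
  have ul' : (fun n => (u n x)%:E) @ \oo --> l%:E by apply: cvg_EFin; [exact: nearW|].
  by rewrite /w (cvg_limn_einf_sup ul').2.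
have mv : measurable_fun setT (fine \o w) by exact: measurableT_comp.
exists (fine \o w); split=> //; first by move=> x; exact: fine_ge0.
move=> n; apply: (@fatou_ae_le (fun m x => (`|u n x - u m x|)%:E) _ (fun=> ((2^-1) ^+ n)%:E))
  => //.
- by move=> m; apply/measurable_EFinP; apply: measurableT_comp => //; exact: measurable_funB.
- by apply/measurable_EFinP; apply: measurableT_comp => //; exact: measurable_funB.
- apply: filterS cw => x ux; apply: cvg_le_limn_einf; apply: cvg_EFin; first exact: nearW.
  by apply: cvg_norm; apply: cvgB => //; exact: cvg_cst.
- by exists n => // m /= nm; exact: cu.
- exact: cvg_cst.
Qed.

End almost_everywhere_limits.

(** * Borel sets and Lebesgue measure on R^d *)

Section image_measure.
Context d1 d2 (X : measurableType d1) (Y : measurableType d2) (R : realType).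

Definition image_measure (m : {measure set X -> \bar R}) (f : X -> Y)
    (mf : measurable_fun [set: X] f) : {measure set Y -> \bar R} :=
  measure_function_pushforward__canonical__measure_function_Measure m mf.

Definition image_probability (m : probability X R) (f : X -> Y)
    (mf : measurable_fun [set: X] f) : probability Y R :=
  distribution m (HB.pack_for {mfun X >-> Y} f (isMeasurableFun.Build _ _ _ _ _ mf)).

End image_measure.

Section euclidean_sigma_algebra.
Context {R : realType} (n : nat).
Local Notation Rn := 'rV[R]_n.
Implicit Type A : 'I_n -> set (measurableTypeR R).

Definition box A : set Rn := [set v | forall i, A i (v ord0 i)].

Lemma measurable_box A : (forall i, measurable (A i)) -> measurable (box A).
Proof.
move=> mA; rewrite (_ : box A =
    \bigcap_(i : 'I_n) ((fun v : Rn => v ord0 i) @^-1` A i)).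
  apply: fin_bigcap_measurable => // i _.
  by rewrite -[X in measurable X]setTI; exact: (measurable_coord i measurableT (mA i)).
by apply/seteqP; split=> v /= h i => [_|]; exact: h.
Qed.

Definition cube (x : Rn) (r : R) : set Rn := [set v | forall i, `|v ord0 i - x ord0 i| <= r].

Lemma cubeE x r : cube x r = box (fun i => `[x ord0 i - r, x ord0 i + r]%classic).
Proof.
apply/seteqP; split => v /= h i; have := h i; rewrite /= in_itv/=.
  by rewrite ler_distl.
by rewrite ler_distl.
Qed.

Lemma measurable_cube x r : measurable (cube x r).
Proof. by rewrite cubeE; apply: measurable_box => i; exact: measurable_itv. Qed.

Lemma bigcup_cube : \bigcup_k cube 0 k%:R = [set: Rn].
Proof.
apply/seteqP; split => // v _.
exists (Num.truncn (\sum_i `|v ord0 i|)).+1 => // i; rewrite mxE subr0.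
apply: (@le_trans _ _ (\sum_i `|v ord0 i|)); last exact/ltW/truncnS_gt.
by rewrite (bigD1 i)//= lerDl sumr_ge0.
Qed.

(** Boxes are stable under intersection and generate the sigma-algebra, because a coordinate
    preimage is a box with a single nontrivial side; the cubes around 0 exhaust the space with
    finite mass. *)
Lemma rV_measure_unique (m1 m2 : {measure set Rn -> \bar R}) :
  (forall A, (forall i, measurable (A i)) -> m1 (box A) = m2 (box A)) ->
  (forall k : nat, m1 (cube 0 k%:R) < +oo)%E ->
  forall E, measurable E -> m1 E = m2 E.
Proof.
move=> m12 m1fin E mE.
pose G : set (set Rn) := [set B | exists2 A, (forall i, measurable (A i)) & B = box A].
apply: (@measure_unique _ _ _ G (fun k => cube 0 k%:R)) => //.
- apply/seteqP; split; last first.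
    apply: smallest_sub; first exact: sigma_algebra_measurable.
    by move=> _ [A mA ->]; exact: measurable_box.
  apply: smallest_sub; first exact: smallest_sigma_algebra.
  move=> B; rewrite /= -bigcup_seq/= => -[i _ [C mC <-]].
  apply: sub_sigma_algebra; exists (fun j => if j == i then C else setT).
    by move=> j; case: ifP.
  apply/seteqP; split => v /=.
    by move=> [_ Cv] j; case: eqP => // ->.
  by move=> /(_ i); rewrite eqxx.
- move=> _ _ [A mA ->] [C mC ->]; exists (fun i => A i `&` C i).
    by move=> i; exact: measurableI.
  apply/seteqP; split => v /=.
    by move=> [Av Cv] i; split.
  by move=> h; split => i; case: (h i).
- by move=> k; exists (fun i => `[(0 : Rn) ord0 i - k%:R, (0 : Rn) ord0 i + k%:R]%classic);
    [move=> i; exact: measurable_itv|exact: cubeE].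
- exact: bigcup_cube.
- by move=> _ [A mA ->]; exact: m12.
Qed.

Lemma open_cube (U : set Rn) (x : Rn) : open U -> U x ->
  exists2 e : R, 0 < e & cube x e `<=` U.
Proof.
move=> oU Ux; have /nbhs_ballP[e /= e0 eU] : nbhs x U by exact: open_nbhs_nbhs.
exists (e / 2); first by rewrite divr_gt0.
move=> v xv; apply: eU; split => // i j.
rewrite (ord1 i) /ball/= distrC (le_lt_trans (xv j))//.
by rewrite ltr_pdivrMr// ltr_pMr// ltr1n.
Qed.

Lemma cube_nbhs (x : Rn) (e : R) : 0 < e -> nbhs x (cube x e).
Proof.
move=> e0; apply/nbhs_ballP; exists e => //= v [_ xv] i.
by have := xv ord0 i; rewrite /ball/= distrC => /ltW.
Qed.

(** Rational centres and radii [1/(k+1)] keep the union countable. This makes open sets measurable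
    for the product sigma-algebra, and later yields the Lindelof argument for the support of a
    probability. *)
Lemma open_bigcup_cube (U : set Rn) : open U ->
  U = \bigcup_(p in [set p : 'rV[rat]_n * nat |
         cube (map_mx ratr p.1) (p.2.+1%:R^-1) `<=` U])
       cube (map_mx ratr p.1) (p.2.+1%:R^-1).
Proof.
move=> oU; apply/seteqP; split; last by move=> x [p pU /pU].
move=> x Ux; have [e e0 eU] := open_cube oU Ux.
have [k ke] : exists k : nat, (k.+1%:R : R)^-1 < e / 2.
  exists (Num.truncn (e / 2)^-1); rewrite invf_plt ?posrE ?divr_gt0//.
  exact: truncnS_gt.
have k0 : 0 < (k.+1%:R : R)^-1 by rewrite invr_gt0.
have /choice[q qP] i : exists q : rat, `|x ord0 i - ratr q| <= k.+1%:R^-1.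
  have [|q] := @rat_in_itvoo R (x ord0 i - k.+1%:R^-1) (x ord0 i).
    by rewrite ltrBlDr ltrDl.
  rewrite in_itv/= => /andP[h1 h2]; exists q; move: k0 h1 h2.
  move: (_^-1) => t t0 h1 h2; rewrite ler_distl; apply/andP; split; lra.
exists (\row_i q i, k) => /=.
  move=> v vq; apply: eU => i; have := vq i; have := qP i; rewrite !mxE.
  move=> h1 h2; rewrite (_ : _ - _ = (v ord0 i - ratr (q i)) - (x ord0 i - ratr (q i)));
    last by ring.
  move: ke h1 h2; move: (_^-1) => t ke h1 h2.
  apply: (le_trans (ler_normB _ _)); lra.
by move=> i; rewrite !mxE.
Qed.

Lemma open_measurable_rV (U : set Rn) : open U -> measurable U.
Proof.
move=> /open_bigcup_cube ->; rewrite bigcup_mkcond.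
apply: countable_bigcupT_measurable; first exact: countableP.
by move=> p; case: ifP => // _; exact: measurable_cube.
Qed.

Lemma continuous_measurable_rV (f : Rn -> R) : continuous f -> measurable_fun setT f.
Proof.
move=> cf; apply: (measurability _ (RGenOpens.measurableE R)) => _ [_ [a [b ->]] <-].
rewrite setTI; apply: open_measurable_rV.
by apply: open_comp; [move=> y _; exact: cf|exact: interval_open].
Qed.

Lemma lebesgue_rV_cube_fin x r : (lebesgue_rV n (cube x r) < +oo)%E.
Proof.
rewrite cubeE lebesgue_rV_box; last by move=> i; exact: measurable_itv.
rewrite ltey_eq; apply/orP; left.
apply: (big_ind (fun u : \bar R => u \is a fin_num)) => //.
  by move=> u v fu fv; exact: fin_numM.
by move=> i _; rewrite lebesgue_measure_itv/=; case: ifP.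
Qed.

Lemma measurable_translation (x : Rn) : measurable_fun setT (fun v : Rn => v + x).
Proof.
apply/measurable_fun_coordP => i.
under eq_fun do rewrite mxE.
by apply: measurable_funD => //; exact: measurable_coord.
Qed.

End euclidean_sigma_algebra.

Section lebesgue_translation.
Context {R : realType}.

Lemma lebesgue_measure_translation (a : R) (A : set (measurableTypeR R)) : measurable A ->
  lebesgue_measure ((fun y : measurableTypeR R => (y + a : measurableTypeR R)) @^-1` A) =
    lebesgue_measure A.
Proof.
move=> mA; have mT : measurable_fun setT (fun y : measurableTypeR R => (y + a : measurableTypeR
  R)).
  by apply: measurable_funD.
have := @lebesgue_measure_unique R (image_measure lebesgue_measure mT).
move=> /(_ _ A mA) ->// _ [[b c]] _ <-.
rewrite /image_measure/= /pushforward/=.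
rewrite (_ : _ @^-1` _ = `]b - a, c - a]%classic); last first.
  by apply/seteqP; split => y /=; rewrite !in_itv/= => /andP[h1 h2]; apply/andP; split; lra.
by rewrite !lebesgue_measure_itv/= !lte_fin ltrD2r -EFinB -EFinB opprB addrA subrK.
Qed.

Lemma lebesgue_rV_translation n (x : 'rV[R]_n) E : measurable E ->
  lebesgue_rV n ((fun v => v + x) @^-1` E) = lebesgue_rV n E.
Proof.
move=> mE; apply/esym.
apply: (@rV_measure_unique _ _ (lebesgue_rV n) (image_measure (lebesgue_rV n)
  (measurable_translation x))) => //; last first.
  by move=> k; exact: lebesgue_rV_cube_fin.
move=> A mA; rewrite /image_measure/= /pushforward.
rewrite (_ : _ @^-1` _ = box (fun i => (fun y : measurableTypeR R => (y + x ord0 i :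
  measurableTypeR R)) @^-1` A i)); last first.
  by apply/seteqP; split => v /= h i; have := h i; rewrite mxE.
rewrite !lebesgue_rV_box//.
  by apply: eq_bigr => i _; rewrite lebesgue_measure_translation.
move=> i; rewrite -[X in measurable X]setTI.
by apply: (_ : measurable_fun setT _) => //; apply: measurable_funD.
Qed.

(** The product law is built one coordinate at a time through [rV_cons]; the bound [c ^ n] on the
    fibres is integrated by Fubini against [p], which is itself dominated by [c] times Lebesgue
    measure. With [p] normal, this gives a law for Brownian increments together with a uniform bound
    on its density. *)
Lemma product_probability_le (p : probability (measurableTypeR R) R) (c : R) :
  0 <= c ->
  (forall A, measurable A -> p A <= c%:E * lebesgue_measure A)%E ->
  forall n, exists g : probability 'rV[R]_n R,
   (forall A, (forall i, measurable (A i)) -> g (box A) = \prod_(i < n) p (A i))%E /\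
   (forall E, measurable E -> g E <= (c ^+ n)%:E * lebesgue_rV n E)%E.
Proof.
move=> c0 pc; elim => [|n [g [gbox gle]]].
  exists (dirac (0 : 'rV[R]_0) : probability _ R); split => [A mA|E mE].
    by rewrite big_ord0 /= diracE mem_set// => -[].
  by rewrite expr0 mul1e.
exists (image_probability (p \x g)%E (@measurable_rV_cons R n)); split => [A mA|E mE].
  rewrite big_ord_recl -gbox// /image_probability/= /distribution /pushforward/=.
  rewrite -product_measure1E; [|exact: mA|exact: measurable_box].
  congr product_measure1; apply/seteqP; split=> -[x v] /=.
    move=> h; split=> [|i]; first by have := h ord0; rewrite mxE unlift_none.
    by have := h (lift ord0 i); rewrite mxE liftK.
  move=> [h1 h2] i; rewrite mxE.
  by case: (unliftP ord0 i) => [j ->|->] /=; [exact: h2|exact: h1].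
rewrite /image_probability/= /distribution /lebesgue_cons /pushforward/=.
have mE' : measurable (@rV_cons R n @^-1` E).
  by rewrite -[X in measurable X]setTI; exact: measurable_rV_cons.
move: (_ @^-1` _) mE' => F mF; rewrite /product_measure1.
pose h x := (lebesgue_rV n \o xsection F) x.
have mh : measurable_fun setT h by exact: measurable_fun_xsection.
have cn0 : 0 <= c ^+ n by rewrite exprn_ge0.
apply: (@le_trans _ _ (\int[p]_x ((c ^+ n)%:E * h x))%E).
  apply: ge0_le_integral => //.
  - exact: measurable_fun_xsection.
  - exact: emeasurable_funM.
  - by move=> x _; apply: gle; exact: measurable_xsection.
rewrite ge0_integralZl_EFin// exprS mulrC EFinM -muleA lee_wpmul2l ?lee_fin//.
apply: (@le_trans _ _ (\int[mscale (NngNum c0) lebesgue_measure]_x h x)%E).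
  by apply: ge0_le_measure_integral => // S mS; exact: pc.
by rewrite ge0_integral_mscale.
Qed.

End lebesgue_translation.

(** * Minimisation of the convex functional *)

Section convex_functional.
Context d (T : measurableType d) (R : realType) (mu : {measure set T -> \bar R}).
Variables (W : T -> \bar R) (I : Type) (f : I -> T -> R) (c : I -> \bar R).
Variable k : R.
Hypothesis k0 : 0 < k.
Hypothesis W0 : forall x, (0 <= W x)%E.
Hypothesis mW : measurable_fun setT W.
Hypothesis mf : forall i, measurable_fun setT (f i).
Hypothesis bf : forall i, exists M : R, forall x, `|f i x| <= M.

Definition density : set (T -> R) := [set r : T -> R | [/\ measurable_fun setT r,
  forall x, 0 <= r x & (\int[mu]_x (r x)%:E = 1)%E]].

(** Index set and constants stay abstract: what matters is that each term is affine in [r] and,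
    [f i] being bounded, continuous in L^1. With [test] and [log_laplace] in place of [f] and [c]
    this becomes the rate of [r dx]. *)
Definition dual_rate (r : T -> R) : \bar R :=
  ereal_sup [set (\int[mu]_x (f i x * r x)%:E - c i)%E | i in setT].

Definition functional (r : T -> R) : \bar R :=
  (dual_rate r + \int[mu]_x (W x * (r x)%:E)
   + k%:E * \int[mu]_x (r x ^+ 2)%:E)%E.

Hypothesis J0 : forall r, density r -> (0 <= dual_rate r)%E.

Definition midpoint (r s : T -> R) x := 2^-1 * r x + 2^-1 * s x.

Lemma density_integrable r : density r -> mu.-integrable setT (EFin \o r).
Proof.
move=> [mr r0 r1]; apply/integrableP; split; first exact/measurable_EFinP.
under eq_integral do rewrite /= ger0_norm//.
by rewrite r1 ltry.
Qed.

Lemma pairing_integrable i r : mu.-integrable setT (EFin \o r) ->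
  mu.-integrable setT (fun x => (f i x * r x)%:E).
Proof.
move=> ir; have [M fM] := bf i.
have /measurable_EFinP mr := measurable_int mu ir.
have := integrableZl measurableT M ir.
apply: le_integrable => //.
  by apply/measurable_EFinP; exact: measurable_funM.
move=> x _ /=; rewrite lee_fin !normrM ler_wpM2r// (le_trans (fM x))//.
exact: ler_norm.
Qed.

(** One-sided, since exchanging [r] and [s] gives the other side. This is the L^1 continuity behind
    the lower semicontinuity of [dual_rate]. *)
Lemma pairing_lipschitz i (M : R) r s : (forall x, `|f i x| <= M) ->
  mu.-integrable setT (EFin \o r) -> mu.-integrable setT (EFin \o s) ->
  (\int[mu]_x (f i x * r x)%:E <=
   \int[mu]_x (f i x * s x)%:E + M%:E * \int[mu]_x (`|r x - s x|)%:E)%E.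
Proof.
move=> fM ir is_; have irs : mu.-integrable setT (fun x => (`|r x - s x|)%:E).
  by apply: (@integrable_norm _ _ _ mu setT (fun x => r x - s x));
    exact: (integrableB measurableT ir is_).
rewrite -integralZl// -integralD//; [|exact: pairing_integrable|exact: integrableZl].
apply: le_integral => //; first exact: pairing_integrable.
  by apply: integrableD => //; [exact: pairing_integrable|exact: integrableZl].
move=> x _; rewrite -EFinM -EFinD lee_fin -lerBlDl -mulrBr.
by rewrite (le_trans (ler_norm _))// normrM ler_wpM2r.
Qed.

Lemma density_midpoint r s : density r -> density s -> density (midpoint r s).
Proof.
move=> dr ds; have [mr r0 r1] := dr; have [ms s0 s1] := ds; split.
- by apply: measurable_funD; exact: measurable_funM.
- by move=> x; rewrite addr_ge0// mulr_ge0.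
- under eq_integral do rewrite EFinD.
  rewrite ge0_integralD//; last 4 first.
  + by move=> x _; rewrite lee_fin mulr_ge0.
  + by apply/measurable_EFinP; exact: measurable_funM.
  + by move=> x _; rewrite lee_fin mulr_ge0.
  + by apply/measurable_EFinP; exact: measurable_funM.
  under eq_integral do rewrite EFinM.
  rewrite ge0_integralZl_EFin//; [|by move=> x _; rewrite lee_fin|exact/measurable_EFinP].
  under [X in (_ + X)%E]eq_integral do rewrite EFinM.
  rewrite ge0_integralZl_EFin//; [|by move=> x _; rewrite lee_fin|exact/measurable_EFinP].
  by rewrite r1 s1 !mule1 -EFinD; congr EFin; lra.
Qed.

Lemma dual_rate_midpoint r s : density r -> density s ->
  (dual_rate (midpoint r s) <= 2^-1%:E * dual_rate r + 2^-1%:E * dual_rate s)%E.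
Proof.
move=> dr ds; apply: ge_ereal_sup => _ [i _ <-].
have ir := density_integrable dr; have is_ := density_integrable ds.
have pr := pairing_integrable i ir; have ps := pairing_integrable i is_.
have fr := integrable_fin_num measurableT pr.
have fs := integrable_fin_num measurableT ps.
have lr : (\int[mu]_x (f i x * r x)%:E - c i <= dual_rate r)%E.
  by apply: ereal_sup_ubound; exists i.
have ls : (\int[mu]_x (f i x * s x)%:E - c i <= dual_rate s)%E.
  by apply: ereal_sup_ubound; exists i.
apply: (@le_trans _ _ (2^-1%:E * (\int[mu]_x (f i x * r x)%:E - c i) +
   2^-1%:E * (\int[mu]_x (f i x * s x)%:E - c i))%E); last first.
  by apply: leeD; apply: lee_wpmul2l; rewrite ?lee_fin.
rewrite (_ : \int[mu]_x _ = 2^-1%:E * (\int[mu]_x (f i x * r x)%:E) +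
   2^-1%:E * (\int[mu]_x (f i x * s x)%:E))%E; last first.
  rewrite -!integralZl// -integralD//; [|exact: integrableZl|exact: integrableZl].
  by apply: eq_integral => x _; rewrite -!EFinM -EFinD; congr EFin; rewrite /midpoint; ring.
rewrite -(fineK fr) -(fineK fs).
(* For [c i = +oo] the left side is [-oo]; for [c i = -oo] both sides are [+oo]. *)
case: (c i) => [t| |] /=.
- by rewrite -!EFinB -!EFinM -!EFinD lee_fin; lra.
- by rewrite !addeNy leNye.
- by rewrite !addey// !gt0_muley.
Qed.

Lemma midpoint_linear r s : density r -> density s ->
  (\int[mu]_x (W x * (midpoint r s x)%:E) =
   2^-1%:E * \int[mu]_x (W x * (r x)%:E) + 2^-1%:E * \int[mu]_x (W x * (s x)%:E))%E.
Proof.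
move=> [mr r0 _] [ms s0 _].
have W0' u : (forall x, 0 <= u x) -> forall x, setT x -> (0 <= W x * (u x)%:E)%E.
  by move=> u0 x _; rewrite mule_ge0// lee_fin.
have mW' (u : T -> R) : measurable_fun setT u ->
    measurable_fun setT (fun x => (W x * (u x)%:E)%E).
  by move=> mu_; apply: emeasurable_funM => //; exact/measurable_EFinP.
rewrite -!ge0_integralZl_EFin//; try by [apply: W0' | apply: mW'].
rewrite -ge0_integralD//.
- apply: eq_integral => x _.
  rewrite /midpoint EFinD ge0_muleDr ?lee_fin ?mulr_ge0//.
  by rewrite !EFinM muleCA [X in (_ + X)%E]muleCA.
- by move=> x _; rewrite mule_ge0// W0'.
- by apply: emeasurable_funM => //; exact: mW'.
- by move=> x _; rewrite mule_ge0// W0'.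
- by apply: emeasurable_funM => //; exact: mW'.
Qed.

(** The parallelogram identity, arranged as an equality of sums of nonnegative terms so that it
    remains valid when some integrals are infinite. *)
Lemma midpoint_square r s : density r -> density s ->
  (\int[mu]_x (midpoint r s x ^+ 2)%:E + 4^-1%:E * \int[mu]_x ((r x - s x) ^+ 2)%:E =
   2^-1%:E * \int[mu]_x (r x ^+ 2)%:E + 2^-1%:E * \int[mu]_x (s x ^+ 2)%:E)%E.
Proof.
move=> dr ds; have [mm _ _] := density_midpoint dr ds.
move: dr ds => [mr r0 _] [ms s0 _].
have sq0 (u : T -> R) : forall x, setT x -> (0 <= (u x ^+ 2)%:E)%E.
  by move=> x _; rewrite lee_fin sqr_ge0.
have msq (u : T -> R) : measurable_fun setT u ->
    measurable_fun setT (fun x => (u x ^+ 2)%:E).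
  by move=> mu_; apply/measurable_EFinP; exact: measurable_funX.
have mrs := measurable_funB mr ms.
rewrite -!ge0_integralZl_EFin//; try by [apply: sq0 | apply: msq].
have sqk0 (a : R) (u : T -> R) : 0 <= a -> forall x, setT x -> (0 <= a%:E * (u x ^+ 2)%:E)%E.
  by move=> a0 x _; rewrite mule_ge0// lee_fin// sqr_ge0.
have msqk (a : R) (u : T -> R) : measurable_fun setT u ->
    measurable_fun setT (fun x => a%:E * (u x ^+ 2)%:E)%E.
  by move=> mu_; apply: emeasurable_funM => //; exact: msq.
rewrite -!ge0_integralD//; try by [apply: sq0 | apply: msq | apply: sqk0 | apply: msqk].
apply: eq_integral => x _; rewrite -!EFinM -!EFinD; congr EFin.
by rewrite /midpoint; field.
Qed.

Lemma functional_ge0 r : density r -> (0 <= functional r)%E.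
Proof.
move=> dr; have [mr r0 _] := dr.
apply: adde_ge0; first apply: adde_ge0; first exact: J0.
  by apply: integral_ge0 => x _; rewrite mule_ge0// lee_fin.
apply: mule_ge0; first by rewrite lee_fin ltW.
by apply: integral_ge0 => x _; rewrite lee_fin sqr_ge0.
Qed.

(** Rate and potential are merely convex; the gain [k / 4] times the squared L^2 distance is the
    defect term of [midpoint_square] multiplied by [k]. *)
Lemma functional_midpoint r s : density r -> density s ->
  (functional (midpoint r s) + (k / 4)%:E * \int[mu]_x ((r x - s x) ^+ 2)%:E <=
   2^-1%:E * functional r + 2^-1%:E * functional s)%E.
Proof.
move=> dr ds; have dm := density_midpoint dr ds.
have I0 u : density u -> (0 <= \int[mu]_x (W x * (u x)%:E))%E.
  by move=> [_ u0 _]; apply: integral_ge0 => x _; rewrite mule_ge0// lee_fin.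
have S0 (u : T -> R) : (0 <= \int[mu]_x (u x ^+ 2)%:E)%E.
  by apply: integral_ge0 => x _; rewrite lee_fin sqr_ge0.
have k0' : (0 <= k%:E)%E by rewrite lee_fin ltW.
rewrite /functional -addeA.
rewrite (_ : _ + (k / 4)%:E * _ = k%:E * (\int[mu]_x (midpoint r s x ^+ 2)%:E +
  4^-1%:E * \int[mu]_x ((r x - s x) ^+ 2)%:E))%E; last first.
  rewrite [RHS]ge0_muleDr; [by rewrite (EFinM k) muleA|exact: S0|].
  by rewrite mule_ge0//; exact: (S0 (fun x => r x - s x)).
rewrite midpoint_square// midpoint_linear//.
move: (dual_rate_midpoint dr ds) (J0 dr) (J0 ds) (I0 _ dr) (I0 _ ds) (S0 r) (S0 s).
move: (dual_rate _) (dual_rate _) (dual_rate _) => Jm Jr Js.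
move: (\int[mu]_x _)%E (\int[mu]_x _)%E (\int[mu]_x _)%E (\int[mu]_x _)%E => Ir Is Sr Ss.
move=> hJ Jr0 Js0 Ir0 Is0 Sr0 Ss0.
rewrite !ge0_muleDr ?adde_ge0 ?mule_ge0// ![(k%:E * (2^-1%:E * _))%E]muleCA.
by rewrite [leRHS]addeACA leeD// addeACA leeD.
Qed.

Hypothesis Wfin : forall t : R, (mu [set x | W x <= t%:E] < +oo)%E.

(* Pointwise, [|r - s| <= eta + (r - s)^2 / (4 eta)] where [W <= t], and
   [|r - s| <= W (r + s) / t] elsewhere. *)
Lemma density_distance_le r s (eta t : R) : density r -> density s ->
  0 < eta -> 0 < t ->
  (\int[mu]_x (`|r x - s x|)%:E <=
   eta%:E * mu [set x | W x <= t%:E] +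
   ((4 * eta)^-1)%:E * \int[mu]_x ((r x - s x) ^+ 2)%:E +
   (t^-1)%:E * (\int[mu]_x (W x * (r x)%:E) + \int[mu]_x (W x * (s x)%:E)))%E.
Proof.
move=> [mr r0 _] [ms s0 _] eta0 t0.
have mrs := measurable_funB mr ms.
have mS : measurable [set x | (W x <= t%:E)%E].
  by rewrite -[X in measurable X]setTI; exact: emeasurable_fun_infty_c.
have mi : measurable_fun setT (fun x => (\1_[set x | (W x <= t%:E)%E] x)%:E : \bar R).
  by apply/measurable_EFinP; exact: measurable_indic.
have m2 : measurable_fun setT (fun x => ((r x - s x) ^+ 2)%:E).
  by apply/measurable_EFinP; exact: (measurable_funX 2 mrs).
have mWr : measurable_fun setT (fun x => (W x * (r x)%:E)%E).
  by apply: emeasurable_funM => //; exact/measurable_EFinP.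
have mWs : measurable_fun setT (fun x => (W x * (s x)%:E)%E).
  by apply: emeasurable_funM => //; exact/measurable_EFinP.
have W0' (u : T -> R) : (forall x, 0 <= u x) -> forall x, setT x -> (0 <= W x * (u x)%:E)%E.
  by move=> u0 x _; rewrite mule_ge0// lee_fin.
have e0 : 0 <= (4 * eta)^-1 by rewrite invr_ge0; lra.
have t0' : 0 <= t^-1 by rewrite invr_ge0 ltW.
have -> : (mu [set x | W x <= t%:E] = \int[mu]_x (\1_[set x | (W x <= t%:E)%E] x)%:E)%E.
  by rewrite integral_indic// setIT.
rewrite -ge0_integralD//; [|exact: W0'|exact: W0'].
rewrite -ge0_integralZl_EFin//; last exact: ltW.
rewrite -ge0_integralZl_EFin//; last by move=> x _; rewrite lee_fin sqr_ge0.
rewrite -ge0_integralZl_EFin//; [|by move=> x _; rewrite adde_ge0// W0'|exact: emeasurable_funD].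
have p1 x : (0 <= eta%:E * (\1_[set x | (W x <= t%:E)%E] x)%:E)%E.
  by rewrite mule_ge0// lee_fin// ltW.
have p2 x : (0 <= ((4 * eta)^-1)%:E * ((r x - s x) ^+ 2)%:E)%E.
  by rewrite mule_ge0// lee_fin// sqr_ge0.
have p3 x : (0 <= (t^-1)%:E * (W x * (r x)%:E + W x * (s x)%:E))%E.
  by rewrite mule_ge0// adde_ge0// W0'.
have q1 : measurable_fun setT (fun x => eta%:E * (\1_[set x | (W x <= t%:E)%E] x)%:E)%E.
  exact: emeasurable_funM.
have q2 : measurable_fun setT (fun x => ((4 * eta)^-1)%:E * ((r x - s x) ^+ 2)%:E)%E.
  exact: emeasurable_funM.
have q3 : measurable_fun setT (fun x => (t^-1)%:E * (W x * (r x)%:E + W x * (s x)%:E))%E.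
  by apply: emeasurable_funM => //; exact: emeasurable_funD.
rewrite -ge0_integralD// -ge0_integralD//; last 2 first.
- by move=> x _; rewrite adde_ge0.
- exact: emeasurable_funD.
apply: ge0_le_integral => //.
- by apply/measurable_EFinP; exact: measurableT_comp.
- by apply: emeasurable_funD => //; exact: emeasurable_funD.
move=> x _; have [Wt|Wt] := leP (W x) t%:E.
  rewrite -[leLHS]adde0; apply: leeD => //.
  rewrite indicE mem_set// mule1 -EFinM -EFinD lee_fin.
  (* With [a = |r x - s x|], expanding [(a - 2 eta)^2 >= 0] and dividing by [4 eta] gives
     [a <= eta + a^2 / (4 eta)]. *)
  have := sqr_ge0 (`|r x - s x| - 2 * eta); rewrite -(real_normK (num_real (r x - s x))).
  move: `|r x - s x| => a h.
  rewrite -(ler_pM2l (_ : 0 < 4 * eta)) ?mulrDr ?mulrA ?divff; [nra|lra|lra].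
rewrite -[leLHS]add0e; apply: leeD; first by rewrite adde_ge0.
rewrite -ge0_muleDr ?lee_fin// -EFinD.
apply: (@le_trans _ _ ((t^-1)%:E * (t%:E * (r x + s x)%:E))%E).
  rewrite -!EFinM lee_fin mulKf ?gt_eqF//.
  by rewrite ler_norml; have := r0 x; have := s0 x; lra.
by rewrite lee_wpmul2l// lee_wpmul2r ?lee_fin ?addr_ge0// ltW.
Qed.

Definition min_value : \bar R := ereal_inf [set functional r | r in density].

Hypothesis finite_value : exists2 r, density r & (functional r < +oo)%E.

Lemma min_value_fin : min_value \is a fin_num.
Proof.
have [r dr fr] := finite_value; rewrite ge0_fin_numE.
  by apply: le_lt_trans fr; apply: ereal_inf_lbound; exists r.
by apply: le_ereal_inf_tmp => _ [s ds <-]; exact: functional_ge0.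
Qed.

Lemma potential_le_functional r : density r ->
  (\int[mu]_x (W x * (r x)%:E) <= functional r)%E.
Proof.
move=> dr; rewrite /functional -addeA addeCA leeDl// adde_ge0 ?J0//.
apply: mule_ge0; first by rewrite lee_fin ltW.
by apply: integral_ge0 => x _; rewrite lee_fin sqr_ge0.
Qed.

(** The midpoint is again a density, so its value is at least [min_value], while the average of the
    two endpoint values exceeds [min_value] by at most [del]; the convexity gain is squeezed between
    them. *)
Lemma square_distance_le r s (del : R) : density r -> density s ->
  (functional r <= min_value + del%:E)%E -> (functional s <= min_value + del%:E)%E ->
  (\int[mu]_x ((r x - s x) ^+ 2)%:E <= (4 * del / k)%:E)%E.
Proof.
move=> dr ds fr fs; have dm := density_midpoint dr ds.
have := functional_midpoint dr ds.
have lm : (min_value <= functional (midpoint r s))%E.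
  by apply: ereal_inf_lbound; exists (midpoint r s).
move: fr fs lm (functional_ge0 dr) (functional_ge0 ds) (functional_ge0 dm).
rewrite -(fineK min_value_fin) -EFinD.
case: (functional r) => // a; case: (functional s) => // b;
  case: (functional (midpoint r s)) => [e| |]//.
  rewrite !lee_fin => ha hb he a0 b0 e0 h.
  have k4 : 0 < k / 4 by rewrite divr_gt0.
  rewrite -(@lee_pmul2l _ (k / 4)%:E)//.
  move: h; case: (\int[mu]_x _)%E => [z| |].
  - rewrite -!EFinM -!EFinD !lee_fin => h.
    rewrite (_ : k / 4 * (4 * del / k) = del); last by field; rewrite gt_eqF.
    lra.
  - by rewrite gt0_muley ?lte_fin// addey// -!EFinM -EFinD leye_eq.
  - by move=> _; rewrite gt0_muleNy ?lte_fin// leNye.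
move=> _ _ _ _ _ _; rewrite addye.
  by rewrite -!EFinM -EFinD leye_eq.
rewrite gt_eqF//; apply: (@lt_le_trans _ _ 0%E) => //.
apply: mule_ge0; first by rewrite lee_fin divr_ge0// ltW.
by apply: integral_ge0 => x _; rewrite lee_fin sqr_ge0.
Qed.

Lemma almost_minimisers_close (eps : R) : 0 < eps ->
  exists del : R, [/\ 0 < del, del <= eps &
   forall r s, density r -> density s ->
    (functional r <= min_value + del%:E)%E -> (functional s <= min_value + del%:E)%E ->
    (\int[mu]_x (`|r x - s x|)%:E <= eps%:E)%E /\
    (\int[mu]_x ((r x - s x) ^+ 2)%:E <= eps%:E)%E].
Proof.
move=> eps0; pose M := fine min_value + eps.
have M0 : 0 < M.
  rewrite ltr_pwDr// fine_ge0//.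
  by apply: le_ereal_inf_tmp => _ [s ds <-]; exact: functional_ge0.
(* The three terms of [density_distance_le] get [eps / 3] each. [M] bounds both potential terms, so
   this [t] gives [2 M / t = eps / 3]; then [eta] absorbs the measure [m] of the sublevel set, with
   [m + 1] to avoid dividing by 0; finally [del] makes [del / (eta k) <= eps / 3] and, for the L^2
   estimate, [4 del / k <= eps]. *)
pose t := 6 * M / eps.
have t0 : 0 < t by rewrite divr_gt0// mulr_gt0.
pose m := fine (mu [set x | W x <= t%:E]%E).
have m0 : 0 <= m by exact: fine_ge0.
pose eta := eps / (3 * (m + 1)).
have eta0 : 0 < eta by rewrite divr_gt0// mulr_gt0//; lra.
pose del := Num.min eps (Num.min (k * eps / 4) (eps * eta * k / 3)).
have del0 : 0 < del by rewrite !lt_min; apply/and3P; split;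
  rewrite ?divr_gt0 ?(mulr_gt0 k0 eps0)// (mulr_gt0 (mulr_gt0 eps0 eta0) k0).
have [d1 d2 d3] : [/\ del <= eps, del <= k * eps / 4 & del <= eps * eta * k / 3].
  by rewrite /del !ge_min !lexx ?orbT.
exists del; split => // r s dr ds fr fs.
have D2 := square_distance_le dr ds fr fs.
have WM u : density u -> (functional u <= min_value + del%:E)%E ->
    (\int[mu]_x (W x * (u x)%:E) <= M%:E)%E.
  move=> du fu; apply: (le_trans (potential_le_functional du)); apply: (le_trans fu).
  by rewrite -(fineK min_value_fin) -EFinD lee_fin /M; lra.
split; last first.
  apply: (le_trans D2); rewrite lee_fin ler_pdivrMr//; lra.
apply: (le_trans (density_distance_le dr ds eta0 t0)).
have -> : (eps%:E = (eps / 3)%:E + (eps / 3)%:E + (eps / 3)%:E)%E.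
  by rewrite -!EFinD; congr EFin; field.
apply: leeD; first apply: leeD.
- rewrite -(@fineK _ (mu _)) ?ge0_fin_numE// -/m -EFinM lee_fin /eta.
  rewrite -mulrA ler_pM2l// invfM -mulrA ler_piMr// mulrC ler_pdivrMr; lra.
- apply: (@le_trans _ _ (((4 * eta)^-1)%:E * (4 * del / k)%:E)%E).
    by rewrite lee_wpmul2l// lee_fin invr_ge0; lra.
  rewrite -EFinM lee_fin ler_pdivrMl; last by lra.
  by rewrite ler_pdivrMr//; lra.
- apply: (@le_trans _ _ ((t^-1)%:E * (M%:E + M%:E))%E).
    apply: lee_wpmul2l; first by rewrite lee_fin invr_ge0 ltW.
    by apply: leeD; exact: WM.
  rewrite -EFinD -EFinM lee_fin /t invf_div.
  rewrite (_ : eps / (6 * M) * (M + M) = eps / 3)//.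
  by field; rewrite gt_eqF.
Qed.

(** Stability is a consequence of existence: a minimiser is itself an almost-minimiser for every
    [del], so it can serve as the second argument of [almost_minimisers_close]. *)
Theorem minimiser_exists : exists v : T -> R, [/\ density v,
  functional v = min_value &
  forall eps : R, 0 < eps -> exists2 del : R, 0 < del &
   forall r, density r -> (functional r <= min_value + del%:E)%E ->
    (\int[mu]_x (`|r x - v x|)%:E <= eps%:E)%E /\
    (\int[mu]_x ((r x - v x) ^+ 2)%:E <= eps%:E)%E].
Proof.
suff [v dv vmin] : exists2 v, density v & functional v = min_value.
  exists v; split => // eps eps0; have [del [del0 _ close]] := almost_minimisers_close eps0.
  exists del => // r dr fr; apply: close => //.
  by rewrite vmin leeDl// lee_fin ltW.
have half_gt0 n : 0 < (2^-1 : R) ^+ n by rewrite exprn_gt0.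
have /choice[dl dlP] := fun n => almost_minimisers_close (half_gt0 n).
(* The running minimum of the thresholds: every later term of the minimising sequence then also
   meets the threshold [dl n], which is what makes the sequence Cauchy with rate [2^-n]. *)
pose e := fix e n := if n is m.+1 then Num.min (e m) (dl n) else dl 0%N.
have e0 n : 0 < e n.
  by elim: n => [|n ih] /=; [case: (dlP 0%N)|rewrite lt_min ih; case: (dlP n.+1)].
have edl n : e n <= dl n by case: n => [|n] //=; rewrite ge_min lexx orbT.
have e_decr n m : (n <= m)%N -> e m <= e n.
  elim: m => [|m ih]; first by rewrite leqn0 => /eqP ->.
  rewrite leq_eqVlt => /predU1P[->//|/ih]; apply: le_trans.
  by rewrite /= ge_min lexx.
have /choice[u uP] n : exists u, density u /\ (functional u <= min_value + (e n)%:E)%E.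
  have [_ [s ds <-] sm] := lb_ereal_inf_adherent (e0 n) min_value_fin.
  by exists s; split => //; exact: ltW.
have ucauchy n m : (n <= m)%N ->
    (\int[mu]_x (`|u n x - u m x|)%:E <= ((2^-1) ^+ n)%:E)%E.
  move=> nm; have [_ _ close] := dlP n.
  have [dun fun_] := uP n; have [dum fum] := uP m.
  apply: (close _ _ dun dum _ _).1.
    by apply: (le_trans fun_); rewrite leeD2l// lee_fin.
  by apply: (le_trans fum); rewrite leeD2l// lee_fin (le_trans (e_decr _ _ nm)).
have fu n : (functional (u n) <= min_value + ((2^-1) ^+ n)%:E)%E.
  have [_ h] := uP n; apply: (le_trans h); rewrite leeD2l// lee_fin.
  by apply: (le_trans (edl n)); case: (dlP n).
have du n : density (u n) by have [] := uP n.
have mu_u n : measurable_fun setT (u n) by have [] := du n.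
have u0 n x : 0 <= u n x by have [] := du n.
have [v [mv v0 uv uvL1]] := L1_cauchy_limit mu_u u0 ucauchy.
have uvL1' n : (\int[mu]_x (`|v x - u n x|)%:E <= ((2^-1) ^+ n)%:E)%E.
  by under eq_integral do rewrite distrC.
have half_cvg : (fun n => (2^-1 : R) ^+ n) @ \oo --> 0.
  by apply: cvg_expr; rewrite ger0_norm; lra.
have v1 : (\int[mu]_x (v x)%:E = 1)%E.
  have v_le1 : (\int[mu]_x (v x)%:E <= 1)%E.
    apply: (@fatou_ae_le _ _ _ _ (fun n x => (u n x)%:E) _ (fun=> 1%E)).
    - by move=> n; exact/measurable_EFinP.
    - by move=> n x; rewrite lee_fin.
    - exact/measurable_EFinP.
    - by move=> x; rewrite lee_fin.
    - apply: filterS uv => x ux; apply: cvg_le_limn_einf.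
      by apply: cvg_EFin => //; exact: nearW.
    - by apply: nearW => n; have [_ _ ->] := du n.
    - exact: cvg_cst.
  (* Fatou only excludes a gain of mass; that none is lost follows from
     [1 = int u_n <= int v + int |u_n - v|]. *)
  apply/eqP; rewrite eq_le v_le1/=; apply/lee_addgt0Pr => eps eps0.
  have [n _ /(_ n (leqnn n))/= hn] : \forall n \near \oo, (2^-1 : R) ^+ n < eps.
    exact: (cvgr_lt 0).
  apply: (@le_trans _ _ (\int[mu]_x (v x)%:E + \int[mu]_x (`|u n x - v x|)%:E)%E); last first.
    by rewrite leeD2l// (le_trans (uvL1 n))// lee_fin ltW.
  have [_ _ <-] := du n; rewrite -ge0_integralD//; last 3 first.
  - by move=> x _; rewrite lee_fin.
  - exact/measurable_EFinP.
  - by apply/measurable_EFinP/measurableT_comp => //; exact: measurable_funB.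
  apply: ge0_le_integral => //.
  - by move=> x _; rewrite lee_fin.
  - exact/measurable_EFinP.
  - apply/measurable_EFinP/measurable_funD => //.
    by apply: measurableT_comp => //; exact: measurable_funB.
  - by move=> x _; rewrite -EFinD lee_fin -lerBlDl ler_norm.
have dv : density v by split.
exists v => //; apply/eqP; rewrite eq_le; apply/andP; split; last first.
  by apply: ereal_inf_lbound; exists v.
(* Potential and square are put under one integral so that a single use of Fatou handles both. *)
pose V (r : T -> R) := (\int[mu]_x (W x * (r x)%:E + k%:E * (r x ^+ 2)%:E))%E.
have mWr (r : T -> R) : measurable_fun setT r ->
    measurable_fun setT (fun x => W x * (r x)%:E)%E.
  by move=> mr; apply: emeasurable_funM => //; exact/measurable_EFinP.
have mr2 (r : T -> R) : measurable_fun setT r ->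
    measurable_fun setT (fun x => k%:E * (r x ^+ 2)%:E)%E.
  move=> mr; apply: emeasurable_funM => //.
  by apply/measurable_EFinP; exact: (measurable_funX 2 mr).
have Wr0 (r : T -> R) x : (forall x, 0 <= r x) -> (0 <= W x * (r x)%:E)%E.
  by move=> r0; rewrite mule_ge0// lee_fin.
have kr0 (r : T -> R) x : (0 <= k%:E * (r x ^+ 2)%:E)%E.
  by apply: mule_ge0; rewrite lee_fin ?sqr_ge0// ltW.
have functionalE r : density r -> functional r = (dual_rate r + V r)%E.
  move=> [mr r0 _]; rewrite /functional -addeA; congr (_ + _)%E.
  rewrite /V ge0_integralD//; last 3 first.
  - by move=> x _; exact: Wr0.
  - exact: mWr.
  - exact: mr2.
  congr (_ + _)%E; rewrite ge0_integralZl_EFin//; last exact: ltW.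
  - by move=> x _; rewrite lee_fin sqr_ge0.
  - by apply/measurable_EFinP; exact: (measurable_funX 2 mr).
have fatouV b l : (\forall n \near \oo, (V (u n) <= b n)%E) -> b @ \oo --> l -> (V v <= l)%E.
  move=> Vb bl.
  apply: (@fatou_ae_le _ _ _ _ (fun n x => W x * (u n x)%:E + k%:E * (u n x ^+ 2)%:E)%E _ b) =>
    //.
  - by move=> n; apply: emeasurable_funD; [exact: mWr|exact: mr2].
  - by move=> n x; rewrite adde_ge0// Wr0.
  - by apply: emeasurable_funD; [exact: mWr|exact: mr2].
  - by move=> x; rewrite adde_ge0// Wr0.
  - apply: filterS uv => x ux.
    have [Wx|Wx] := boolP (W x \is a fin_num).
      apply: cvg_le_limn_einf; rewrite -(fineK Wx) -!EFinM -EFinD.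
      rewrite [X in X @ _](_ : _ = (fun n => (fine (W x) * u n x + k * u n x ^+ 2)%:E));
        last first.
        by apply/funext => n; rewrite -!EFinM -EFinD.
      apply: cvg_EFin; first exact: nearW.
      by apply: cvgD; apply: cvgM; [exact: cvg_cst|exact: ux|exact: cvg_cst|exact: cvgM].
    have Wy : W x = +oo%E by apply/eqP; rewrite -leye_eq leNgt -ge0_fin_numE.
    (* Where [W] is infinite, [v x = 0] makes the left side 0 by the convention [+oo * 0 = 0], and
       [v x > 0] forces [u n x > 0] eventually, so that the terms are eventually [+oo]. *)
    rewrite Wy; have [vx0|vx0] := eqVneq (v x) 0.
      rewrite vx0 expr0n/= !mule0 adde0 limn_einf_lim; apply: lime_ge; first exact: is_cvg_einfs.
      apply: nearW => n; apply: le_ereal_inf_tmp => _ [m _ <-].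
      by rewrite adde_ge0// mule_ge0// lee_fin.
    have vgt0 : 0 < v x by rewrite lt_def vx0 v0.
    apply: (@le_trans _ _ +oo%E); first exact: leey.
    apply: cvg_le_limn_einf; apply: cvg_near_cst.
    have [N _ uN] := cvgr_gt _ ux _ vgt0; exists N => // n /uN/= un0.
    by rewrite gt0_mulye ?lte_fin// -EFinM addye.
have [c0 minE] : exists c0, min_value = c0%:E.
  by exists (fine min_value); rewrite fineK// min_value_fin.
have V0 r : density r -> (0 <= V r)%E.
  by move=> [_ r0 _]; apply: integral_ge0 => x _; rewrite adde_ge0// Wr0.
have Vv_le : (V v <= min_value)%E.
  apply: (fatouV (fun n => (c0 + (2^-1) ^+ n)%:E)).
    apply: nearW => n; rewrite EFinD -minE; apply: le_trans (fu n).
    by rewrite functionalE// leeDr// J0.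
  rewrite minE; apply: cvg_EFin; first exact: nearW.
  by rewrite -[X in _ --> X]addr0; apply: cvgD => //; exact: cvg_cst.
have Vfin : V v \is a fin_num.
  by rewrite ge0_fin_numE ?V0// (le_lt_trans Vv_le)// minE ltry.
(* The supremum is opened before passing to the limit: for one fixed [i] it remains to bound [V v]
   by [min_value] minus the affine term at [v]. *)
rewrite functionalE// -leeBrDr//; apply: ge_ereal_sup => _ [i _ <-].
have ile r : density r -> (\int[mu]_x (f i x * r x)%:E - c i <= dual_rate r)%E.
  by move=> dr; apply: ereal_sup_ubound; exists i.
have pfin r : density r -> (\int[mu]_x (f i x * r x)%:E)%E \is a fin_num.
  by move=> dr; apply: integrable_fin_num => //; exact/pairing_integrable/density_integrable.
have Jfin n : (dual_rate (u n) < +oo)%E.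
  apply: (@le_lt_trans _ _ (functional (u n))); first by rewrite functionalE// leeDl// V0.
  by apply: (le_lt_trans (fu n)); rewrite minE -EFinD ltry.
(* The value [c i = +oo] makes the term [-oo]; [c i = -oo] would make the rate of [u 0] infinite,
   against the finiteness of its functional. *)
case: (c i) (ile) => [t| |] {}ile; last 2 first.
- by rewrite -(fineK (pfin _ dv)) addeNy leNye.
- by have := le_lt_trans (ile _ (du 0%N)) (Jfin 0%N); rewrite -(fineK (pfin _ (du 0%N))).
have [M fM] := bf i; pose M0 : R := `|M|.
have fM0 x : `|f i x| <= M0 by rewrite (le_trans (fM x))// ler_norm.
rewrite leeBrDr// -leeBrDl; last by rewrite -(fineK (pfin _ dv)) -EFinB.
pose a := fine (\int[mu]_x (f i x * v x)%:E)%E.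
have aE : (\int[mu]_x (f i x * v x)%:E)%E = a%:E by rewrite fineK ?pfin.
rewrite aE minE -!EFinB.
(* Almost-minimality of [u n] bounds [V (u n)] by [c0 + 2^-n] minus the affine term at [u n];
   replacing that term by its value at [v] costs [M0 2^-n]. *)
apply: (fatouV (fun n => (c0 - (a - t) + (1 + M0) * (2^-1) ^+ n)%:E)); last first.
  apply: cvg_EFin; first exact: nearW.
  rewrite -[X in _ --> X]addr0; apply: cvgD; first exact: cvg_cst.
  by rewrite -(mulr0 (1 + M0)); apply: cvgM => //; exact: cvg_cst.
apply: nearW => n.
have := fu n; rewrite functionalE// minE -EFinD.
have h1 := ile _ (du n); have h2 := J0 (du n); have h3 := Jfin n.
have h4 := V0 _ (du n).
have h5 : (a%:E <= \int[mu]_x (f i x * u n x)%:E + (M0 * (2^-1) ^+ n)%:E)%E.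
  rewrite -aE.
  have := pairing_lipschitz fM0 (density_integrable dv) (density_integrable (du n)).
  move=> /le_trans; apply; rewrite leeD2l// EFinM.
  apply: lee_wpmul2l.
    by rewrite lee_fin /M0.
  exact: (uvL1' n).
move: h1 h5; rewrite -(fineK (pfin _ (du n))).
move: (dual_rate (u n)) (V (u n)) h2 h3 h4 => [j| |]// [w| |]// _ _ _.
rewrite -!EFinB -!EFinD !lee_fin; lra.
Qed.

End convex_functional.

(** * Brownian motion stays in a small cube with positive probability *)

Section gaussian_estimates.
Context {R : realType}.
Implicit Types (s a : R) (A : set (measurableTypeR R)).

Lemma normal_prob_le s A : s != 0 -> measurable A ->
  (normal_prob 0 s A <= (normal_peak s)%:E * lebesgue_measure A)%E.
Proof.
move=> s0 mA; rewrite -integral_cst//; apply: ge0_le_integral => //.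
- by move=> x _; rewrite lee_fin normal_pdf_ge0.
- by apply/measurable_EFinP/measurable_funTS; exact: measurable_normal_pdf.
- by move=> x _; rewrite lee_fin normal_pdf_ub.
Qed.

Lemma normal_peak_sqrt2 s : 0 < s ->
  normal_peak s = Num.sqrt 2 * normal_peak (Num.sqrt 2 * s).
Proof.
move=> s0; rewrite /normal_peak.
have -> : (Num.sqrt 2 * s) ^+ 2 * pi *+ 2 = 2 * (s ^+ 2 * pi *+ 2).
  by rewrite exprMn sqr_sqrtr// -mulrA mulrnAr.
rewrite (sqrtrM (s ^+ 2 * pi *+ 2)) ?ler0n// invfM mulrA divff ?mul1r// gt_eqF// sqrtr_gt0.
Qed.

Lemma normal_pdf_sqrt2 s x : 0 < s ->
  normal_pdf 0 s x = Num.sqrt 2 * expR (- (x ^+ 2 / (4 * s ^+ 2))) *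
                     normal_pdf 0 (Num.sqrt 2 * s) x.
Proof.
move=> s0; have s20 : 0 < Num.sqrt 2 * s by rewrite mulr_gt0// sqrtr_gt0.
rewrite !normal_pdfE ?gt_eqF// normal_peak_sqrt2// /normal_fun.
rewrite mulrACA -expRD [RHS]mulrAC -[LHS]mulrAC; congr (_ * expR _ * _).
rewrite exprMn sqr_sqrtr// subr0; field.
by rewrite gt_eqF.
Qed.

(* Doubling the variance costs a factor [sqrt 2] and leaves a Gaussian weight. *)
Lemma normal_prob_tail s a : 0 < s -> 0 < a ->
  (normal_prob 0 s [set x | (a < `|x|)%R] <= (64 * s ^+ 4 / a ^+ 4)%:E)%E.
Proof.
move=> s0 a0; have s20 : 0 < Num.sqrt 2 * s by rewrite mulr_gt0// sqrtr_gt0.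
have mS : measurable ([set x | (a < `|x|)%R] : set (measurableTypeR R)).
  rewrite (_ : mkset _ = `]-oo, (- a)[%classic `|` `]a, +oo[%classic).
    by apply: measurableU; exact: measurable_itv.
  apply/seteqP; split => x /=; rewrite !in_itv/= andbT ltr_normr.
    by move=> /orP[|]; rewrite 1?ltrNr; [right|left].
  by rewrite ltrNr => -[->|->]; rewrite ?orbT.
pose y := a ^+ 2 / (4 * s ^+ 2).
have y0 : 0 < y by rewrite divr_gt0 ?mulr_gt0 ?exprn_gt0.
have sqrt2_le : Num.sqrt 2 <= 2 :> R.
  have h := sqr_sqrtr (ler0n R 2); have := sqrtr_ge0 (2 : R); nra.
(* From [1 + y^2 / 2 <= expR y]. On the tail the Gaussian weight is at most [expR (- y)], and with
   [sqrt 2 <= 2] the total factor is [4 / y^2 = 64 s^4 / a^4]. *)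
have expy : expR (- y) <= 2 / y ^+ 2.
  rewrite expRN -[leRHS]invrK lef_pV2 ?posrE ?expR_gt0 ?invr_gt0 ?divr_gt0 ?exprn_gt0//.
  have := expR_ge1Dxn 1 (ltW y0); apply: le_trans.
  by rewrite invf_div (_ : 2`! = 2%N)//; move: (y ^+ 2) => z; lra.
pose c := 2 * (2 / y ^+ 2).
have c0 : 0 <= c by rewrite mulr_ge0// divr_ge0// sqr_ge0.
have -> : 64 * s ^+ 4 / a ^+ 4 = c.
  by rewrite /c /y; field; rewrite ?gt_eqF.
pose S : set (measurableTypeR R) := [set x : R | a < `|x|].
rewrite /normal_prob -/S.
apply: (@le_trans _ _ (\int[lebesgue_measure]_(x in S) (c%:E * (normal_pdf 0 (Num.sqrt 2 * s)
  x)%:E))%E).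
  apply: ge0_le_integral => //.
  - by move=> x _; rewrite lee_fin normal_pdf_ge0.
  - by apply/measurable_EFinP/measurable_funTS; exact: measurable_normal_pdf.
  - apply: emeasurable_funM => //.
    by apply/measurable_EFinP/measurable_funTS; exact: measurable_normal_pdf.
  move=> x /= ax; rewrite -EFinM lee_fin normal_pdf_sqrt2// ler_wpM2r ?normal_pdf_ge0//.
  rewrite ler_pM ?sqrtr_ge0 ?expR_ge0//; apply: le_trans expy.
  rewrite ler_expR lerN2 /y ler_pM2r ?invr_gt0 ?mulr_gt0 ?exprn_gt0//.
  by rewrite -(real_normK (num_real x)) lerXn2r ?nnegrE ?ltW// (lt_trans a0).
rewrite ge0_integralZl_EFin//; last 2 first.
- by move=> x _; rewrite lee_fin normal_pdf_ge0.
- by apply/measurable_EFinP/measurable_funTS; exact: measurable_normal_pdf.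
rewrite -[leRHS]mule1 lee_wpmul2l ?lee_fin//.
exact: (@probability_le1 _ _ _ (normal_prob 0 (Num.sqrt 2 * s))).
Qed.

Lemma normal_probN s A : s != 0 -> measurable A ->
  normal_prob 0 s [set x | A (- x)] = normal_prob 0 s A.
Proof.
move=> s0 mA; rewrite /normal_prob.
have mN : measurable_fun setT (-%R : measurableTypeR R -> measurableTypeR R).
  exact: oppr_measurable.
rewrite [RHS](_ : _ = \int[image_measure lebesgue_measure mN]_(x in A) (normal_pdf 0 s
  x)%:E)%E; last first.
  by apply: eq_measure_integral => C mC _; rewrite -[LHS]lebesgue_measureN.
apply/esym; apply: etrans (ge0_integral_pushforward mN lebesgue_measure mA _ _) _.
- by apply/measurable_EFinP/measurable_funTS; exact: measurable_normal_pdf.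
- by move=> x _; rewrite lee_fin normal_pdf_ge0.
- apply: eq_integral => x _ /=; rewrite !normal_pdfE// /normal_fun.
  by rewrite !subr0 sqrrN.
Qed.

(** Indexing by a boolean turns a sign pattern of a vector into a finite function to [bool], with
    boolean negation reversing a direction; both half lines are closed, so together they cover the
    line. *)
Definition half_line (b : bool) : set (measurableTypeR R) :=
  [set x | if b then (0 <= x)%R else (x <= 0)%R].

Lemma measurable_half_line b : measurable (half_line b).
Proof.
case: b.
  rewrite (_ : half_line _ = `[0, +oo[%classic); first exact: measurable_itv.
  by apply/seteqP; split => x /=; rewrite in_itv/= andbT.
rewrite (_ : half_line _ = `]-oo, 0]%classic); first exact: measurable_itv.
by apply/seteqP; split => x /=; rewrite in_itv.
Qed.

Lemma normal_prob_half (b : bool) s : s != 0 ->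
  (2^-1%:E <= normal_prob 0 s (half_line b))%E.
Proof.
move=> s0; pose A := half_line true; pose A' := half_line false.
have mA : measurable A by exact: measurable_half_line.
have mA' : measurable A' by exact: measurable_half_line.
have AA' : normal_prob 0 s A' = normal_prob 0 s A.
  rewrite -(normal_probN s0 mA); congr normal_prob.
  by apply/seteqP; split => x; rewrite /A /A' /half_line /= oppr_ge0.
have h : (1 <= normal_prob 0 s A + normal_prob 0 s A)%E.
  rewrite -[in X in (_ <= _ + X)%E]AA' -(@probability_setT _ _ _ (normal_prob 0 s)).
  rewrite (_ : setT = A `|` A'); first exact: measureU2.
  by apply/seteqP; split => x //= _; have [|/ltW] := leP 0 x; [left|right].
have {}h : (2^-1%:E <= normal_prob 0 s A)%E.
  move: h; rewrite -(@fineK _ (normal_prob 0 s A)); last exact: fin_num_measure.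
  rewrite -EFinD !lee_fin; lra.
by case: b; rewrite -/A -/A' ?AA'.
Qed.

End gaussian_estimates.

(** * Events determined by the past of the path *)

Section past_events.
Context {R : realType} {d : nat} {disp : measure_display} {Omega : measurableType disp}.
Variable B : R -> Omega -> 'rV[R]_d.

Lemma past_incl s t : s <= t -> past B s `<=` past B t.
Proof.
move=> st; apply: sub_smallest2r; first exact: smallest_sigma_algebra.
by move=> _ [u [A [u0 us mA ->]]]; exists u, A; split => //; exact: le_trans st.
Qed.

Lemma past_setI s E F : past B s E -> past B s F -> past B s (E `&` F).
Proof. exact: (@measurableI _ (g_sigma_algebraType _)). Qed.

Lemma past_setC s E : past B s E -> past B s (~` E).
Proof. exact: (@measurableC _ (g_sigma_algebraType _)). Qed.

Lemma past_bigcup s (F : (set Omega)^nat) : (forall k, past B s (F k)) ->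
  past B s (\bigcup_k F k).
Proof. exact: (@bigcupT_measurable _ (g_sigma_algebraType _)). Qed.

Lemma past_fin_bigcup s (I : finType) (F : I -> set Omega) :
  (forall k, past B s (F k)) -> past B s (\bigcup_k F k).
Proof.
move=> pF; apply: (@fin_bigcup_measurable _ (g_sigma_algebraType _)) => //.
by move=> i _; exact: pF.
Qed.

Lemma past_fin_bigcap s (I : finType) (F : I -> set Omega) :
  (forall k, past B s (F k)) -> past B s (\bigcap_k F k).
Proof.
move=> pF; apply: (@fin_bigcap_measurable _ (g_sigma_algebraType _)) => //.
by move=> i _; exact: pF.
Qed.

Lemma past_preimage s t (A : set 'rV[R]_d) : 0 <= t -> t <= s -> measurable A ->
  past B s (B t @^-1` A).
Proof. by move=> t0 ts mA; apply: sub_sigma_algebra; exists t, A. Qed.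

(** The past up to [u] is treated as a measurable space of its own, on which all [B v] with
    [0 <= v <= u] are measurable; differences of coordinates are then measurable too. *)
Lemma past_increment (s t u : R) (i : 'I_d) (A : set (measurableTypeR R)) :
  0 <= s -> s <= u -> 0 <= t -> t <= u -> measurable A ->
  past B u [set w | A ((B t w - B s w) ord0 i)].
Proof.
move=> s0 su t0 tu mA.
pose T' := g_sigma_algebraType [set E | exists u' (A : set 'rV[R]_d),
  [/\ 0 <= u', u' <= u, measurable A & E = B u' @^-1` A]].
have mB v : 0 <= v -> v <= u -> measurable_fun [set: T'] (B v).
  move=> v0 vu _ C mC; rewrite setTI; apply: sub_sigma_algebra.
  by exists v, C.
have m : measurable_fun [set: T'] (fun w => (B t w - B s w) ord0 i).
  rewrite (_ : (fun _ => _) = (fun w => B t w ord0 i - B s w ord0 i)); last first.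
    by apply/funext => w; rewrite !mxE.
  apply: measurable_funB.
    exact: (measurableT_comp (measurable_coord i) (mB _ t0 tu)).
  exact: (measurableT_comp (measurable_coord i) (mB _ s0 su)).
by have := m measurableT A mA; rewrite setTI.
Qed.

Hypothesis mB : forall t, 0 <= t -> measurable_fun [set: Omega] (B t).

Lemma past_measurable s E : past B s E -> measurable E.
Proof.
apply: smallest_sub; first exact: sigma_algebra_measurable.
by move=> _ [u [A [u0 us mA ->]]]; rewrite -[X in measurable X]setTI; exact: mB.
Qed.

End past_events.

Lemma measure_fin_bigcup_le d (T : measurableType d) (R : realType)
    (mu : {measure set T -> \bar R}) (I : finType) (A : set T) (F : I -> set T) :
  measurable A -> (forall i, measurable (F i)) -> A `<=` \bigcup_i F i ->
  (mu A <= \sum_i mu (F i))%E.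
Proof.
move=> mA mF AF.
have AF' : A `<=` \big[setU/set0]_(i <- index_enum I) F i.
  rewrite -bigcup_seq => x /AF[i _ Fi]; exists i => //=.
  by rewrite mem_index_enum.
have mU s : measurable (\big[setU/set0]_(i <- s) F i) by exact: bigsetU_measurable.
apply: (@le_trans _ _ (mu (\big[setU/set0]_(i <- index_enum I) F i))).
  by apply: le_measure; rewrite ?inE.
elim: (index_enum I) => [|i s ih]; first by rewrite !big_nil measure0.
rewrite !big_cons; apply: (le_trans (measureU2 _ _ _)) => //.
by rewrite leeD2l.
Qed.

(** * Dyadic chaining along a single continuous path *)

Section chaining.
Context {R : realType}.
Implicit Types (s del c u : R) (X : R -> R).

Definition dyadic s del (n j : nat) : R := s + j%:R * (del / 2 ^+ n).

(** A dyadic point of generation [n + 1] is a point of generation [n] or one fine step to the right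
    of such a point, so each generation adds at most [c (9/10)^n]. The bound is the partial sum of
    this geometric series, with [10 = 1 / (1 - 9/10)]. *)
Lemma dyadic_chain X s del c : 0 <= c ->
  (forall n j, (j < 2 ^ n)%N ->
     `|X (dyadic s del n j.+1) - X (dyadic s del n j)| <= c * (9 / 10) ^+ n) ->
  forall n j, (j <= 2 ^ n)%N ->
    `|X (dyadic s del n j) - X s| <= 10 * c * (1 - (9 / 10) ^+ n.+1).
Proof.
move=> c0 h; have t0 n : dyadic s del n 0 = s by rewrite /dyadic mul0r addr0.
have b0 n : 0 <= 10 * c * (1 - (9 / 10) ^+ n.+1).
  rewrite mulr_ge0 ?mulr_ge0// subr_ge0 exprn_ile1//; lra.
elim=> [j|n ih j].
  rewrite expn0; case: j => [_|[_|]//]; first by rewrite t0 subrr normr0.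
  have := h 0%N 0%N isT; rewrite t0 expr0 mulr1 expr1 => /le_trans; apply; lra.
have dyE k : dyadic s del n.+1 k.*2 = dyadic s del n k.
  rewrite /dyadic; congr (_ + _); rewrite -mul2n natrM exprS; field.
  by rewrite expf_neq0.
have mono : 10 * c * (1 - (9 / 10) ^+ n.+1) + c * (9 / 10) ^+ n.+1 =
            10 * c * (1 - (9 / 10) ^+ n.+2) by rewrite [in RHS]exprS; field.
have r0 : 0 <= c * (9 / 10) ^+ n.+1 by rewrite mulr_ge0// exprn_ge0//; lra.
rewrite -mono -(odd_double_half j); case: (odd j) => /= jn; last first.
  rewrite add0n dyE (le_trans (ih _ _)) ?lerDl//.
  by move: jn; rewrite add0n -mul2n expnS leq_pmul2l.
have jn' : (j./2.*2 < 2 ^ n.+1)%N by rewrite add1n in jn.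
have jn2 : (j./2 <= 2 ^ n)%N by move: jn'; rewrite -mul2n expnS ltn_pmul2l// => /ltnW.
rewrite add1n; have := h _ _ jn'; have := ih _ jn2; rewrite dyE => h1 h2.
rewrite (_ : _ - X s = (X (dyadic s del n j./2) - X s) +
  (X (dyadic s del n.+1 j./2.*2.+1) - X (dyadic s del n j./2))); last by ring.
by rewrite (le_trans (ler_normD _ _))// lerD.
Qed.

(** The chain bound is uniform in the generation, and [u] is the limit of the last dyadic points not
    beyond it; continuity of [X] carries the bound over. *)
Lemma chaining_oscillation X s del c : 0 <= c -> 0 < del -> continuous X ->
  (forall n j, (j < 2 ^ n)%N ->
     `|X (dyadic s del n j.+1) - X (dyadic s del n j)| <= c * (9 / 10) ^+ n) ->
  forall u, s <= u -> u <= s + del -> `|X u - X s| <= 10 * c.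
Proof.
move=> c0 del0 cX h u su us.
pose j n := Num.truncn ((u - s) / (del / 2 ^+ n)).
have p2 n : 0 < del / 2 ^+ n by rewrite divr_gt0// exprn_gt0.
have q0 n : 0 <= (u - s) / (del / 2 ^+ n) by rewrite divr_ge0 ?subr_ge0// ltW.
have jle n : (j n)%:R * (del / 2 ^+ n) <= u - s.
  by rewrite -ler_pdivlMr// truncn_le.
have jlt n : u - s < (j n).+1%:R * (del / 2 ^+ n).
  by rewrite -ltr_pdivrMr// truncnS_gt.
have jn n : (j n <= 2 ^ n)%N.
  rewrite -(@ler_nat R) -(ler_pM2r (p2 n)) (le_trans (jle n))// natrX mulrCA divff ?expf_neq0//.
  lra.
have tu : (fun n => dyadic s del n (j n)) @ \oo --> u.
  apply: (@squeeze_cvgr _ _ _ _ (fun n => u - del * (2^-1) ^+ n) (fun=> u)).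
  - apply: nearW => n; rewrite /dyadic; have := jle n; have := jlt n.
    rewrite -natr1 mulrDl mul1r exprVn => h1 h2; apply/andP; split; lra.
  - rewrite -[X in _ --> X]subr0; apply: cvgB; first exact: cvg_cst.
    rewrite -(mulr0 del); apply: cvgM; first exact: cvg_cst.
    by apply: cvg_expr; rewrite ger0_norm; lra.
  - exact: cvg_cst.
have Xu : (fun n => `|X (dyadic s del n (j n)) - X s|) @ \oo --> `|X u - X s|.
  apply: cvg_norm; apply: cvgB; last exact: cvg_cst.
  exact: (cvg_comp _ _ tu (cX u)).
rewrite -(cvg_lim _ Xu)//; apply: limr_le; first by apply/cvg_ex; eexists; exact: Xu.
apply: nearW => n; have := dyadic_chain c0 h (jn n); move=> /le_trans; apply.
rewrite ler_piMr ?mulr_ge0// gerBl exprn_ge0//; lra.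
Qed.

End chaining.

Section brownian_paths.
Context {R : realType} {d : nat} {disp : measure_display} {Omega : measurableType disp}.
Variables (P : probability Omega R) (m : probability 'rV[R]_d R).
Variable B : R -> Omega -> 'rV[R]_d.
Hypothesis hB : brownian_motion P m B.
Implicit Types (s t u del c : R) (w : Omega).

Let mB t : 0 <= t -> measurable_fun [set: Omega] (B t).
Proof. by case: hB => h _ _ _; exact: h. Qed.

(** Freezing the path at negative times gives a function continuous on the whole line, as chaining
    and joint measurability require. *)
Lemma path_continuous w : continuous (fun t => B (Num.max t 0) w).
Proof.
case: hB => _ _ _ /(_ w) cB t.
have m0 : `[0, +oo[%classic (Num.max t 0) by rewrite /= in_itv/= andbT le_max lexx orbT.
have {}cB := (subspace_continuousP _ _).1 cB _ m0.
apply: (@cvg_comp _ _ _ (fun t => Num.max t 0) (B^~ w) (nbhs t) _ _ _ cB).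
have cm : Num.max t0 0 @[t0 --> t] --> Num.max t 0.
  rewrite (_ : (fun t0 => _) = (fun t0 => (t0 + `|t0|) / 2)); last first.
    by apply/funext => x; rewrite maxr_absE subr0 addr0.
  rewrite maxr_absE subr0 addr0; apply: cvgM; last exact: cvg_cst.
  by apply: cvgD => //; apply: cvg_norm.
move=> U UA; have h := cm _ UA.
change (nbhs t [set x | `[0, +oo[%classic (Num.max x 0) -> U (Num.max x 0)]) in h.
change (nbhs t [set x | U (Num.max x 0)]).
apply: filterS h => x; apply => /=.
by rewrite in_itv/= andbT le_max lexx orbT.
Qed.

Lemma coord_path_continuous w i : continuous (fun t => B (Num.max t 0) w ord0 i).
Proof.
move=> t; apply: (@cvg_comp _ _ _ (fun t => B (Num.max t 0) w) (fun v : 'rV[R]_d => v ord0 i)).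
  exact: path_continuous.
exact: coord_continuous.
Qed.

Lemma increment_coord s t E i (A : set (measurableTypeR R)) :
  0 <= s -> s < t -> past B s E -> measurable A ->
  P (E `&` [set w | A ((B t w - B s w) ord0 i)]) =
  (P E * normal_prob 0 (Num.sqrt (2 * (t - s))) A)%E.
Proof.
move=> s0 st pE mA; case: hB => _ _ /(_ s t E (fun j => if j == i then A else setT)) h _.
rewrite -(mule1 (normal_prob 0 _ A)) (_ : 1%E = \prod_(j < d | j != i)
   normal_prob 0 (Num.sqrt (2 * (t - s))) setT)%E; last first.
  by rewrite big1// => j _; exact: probability_setT.
rewrite [X in (_ = P E * X)%E](_ : _ = \prod_(j < d) normal_prob 0 (Num.sqrt (2 * (t - s))) (if
  j == i then A else setT))%E; last first.
  rewrite [RHS](bigD1 i)//= eqxx; congr (_ * _)%E; apply: eq_bigr => j ji.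
  by rewrite (negbTE ji).
rewrite -h//; last by move=> j; case: ifP.
congr (P (_ `&` _)); apply/seteqP; split => w /=.
  by move=> Aw j; case: eqP => // ->.
by move=> /(_ i); rewrite eqxx.
Qed.

(* A dyadic increment of generation [n] exceeds [c (9/10)^n] with probability
   [O(4^-n (9/10)^(-4n))]; summed over the [2^n] steps this is still geometric
   because [(9/10)^4 > 1/2]. *)
Definition rough_step s del c n (p : 'I_(2 ^ n) * 'I_d) : set Omega :=
  [set w | [set x | c * (9 / 10) ^+ n < `|x|]
    ((B (dyadic s del n p.1.+1) w - B (dyadic s del n p.1) w) ord0 p.2)].

Definition rough s del c : set Omega :=
  \bigcup_n \bigcup_p @rough_step s del c n p.

Lemma dyadic_ge s del n j : 0 <= del -> s <= dyadic s del n j.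
Proof. by move=> del0; rewrite lerDl mulr_ge0// divr_ge0// exprn_ge0. Qed.

Lemma dyadic_le s del n j : 0 <= del -> (j <= 2 ^ n)%N -> dyadic s del n j <= s + del.
Proof.
move=> del0 jn; rewrite lerD2l mulrCA ler_piMr// ler_pdivrMr ?exprn_gt0// mul1r.
by rewrite -natrX ler_nat.
Qed.

Lemma measurable_abs_gt (a : R) : measurable ([set x | a < `|x|] : set (measurableTypeR R)).
Proof.
rewrite -[X in measurable X]setTI.
have -> : [set x : R | a < `|x|] = (fun x => `|x|) @^-1` `]a, +oo[%classic.
  by apply/seteqP; split => x /=; rewrite in_itv/= andbT.
by apply: (_ : measurable_fun setT (fun x : R => `|x|)) => //; exact: measurableT_comp.
Qed.

Lemma past_rough_step s del c n p : 0 <= s -> 0 <= del ->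
  past B (s + del) (@rough_step s del c n p).
Proof.
move=> s0 del0; apply: past_increment.
- by rewrite (le_trans s0)// dyadic_ge.
- by rewrite dyadic_le// ltnW.
- by rewrite (le_trans s0)// dyadic_ge.
- by rewrite dyadic_le.
- exact: measurable_abs_gt.
Qed.

Lemma past_rough s del c : 0 <= s -> 0 <= del -> past B (s + del) (rough s del c).
Proof.
move=> s0 del0; apply: past_bigcup => n.
by apply: past_fin_bigcup => p; exact: past_rough_step.
Qed.

(** A union bound over generations, steps and coordinates; the factor [P E] comes out because every
    increment starts at or after [s] and is therefore independent of [E]. *)
Lemma rough_prob s del c E : 0 <= s -> 0 < del -> 0 < c -> past B s E ->
  (P (E `&` rough s del c) <= P E * (1280 * d%:R * del ^+ 2 / c ^+ 4)%:E)%E.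
Proof.
move=> s0 del0 c0 pE; have mE := past_measurable mB pE.
have mrs n p : measurable (@rough_step s del c n p).
  by apply: (past_measurable mB); apply: past_rough_step => //; exact: ltW.
have mrn n : measurable (\bigcup_p @rough_step s del c n p).
  by apply: fin_bigcup_measurable.
pose K := 256 * d%:R * del ^+ 2 / c ^+ 4.
have K0 : 0 <= K.
  apply: divr_ge0; last exact: exprn_ge0 (ltW c0).
  by apply: mulr_ge0 (sqr_ge0 _); apply: mulr_ge0; exact: ler0n.
have sub : E `&` rough s del c `<=` \bigcup_n (E `&` \bigcup_p @rough_step s del c n p).
  by move=> w [Ew [n _ wn]]; exists n.
have mEr : measurable (E `&` rough s del c).
  by apply: measurableI => //; apply: bigcup_measurable.
have mErn n : measurable (E `&` \bigcup_p @rough_step s del c n p) by exact: measurableI.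
apply: (le_trans (measure_sigma_subadditive P mErn mEr sub)).
have fPE := fin_num_measure P E mE.
have step n : (P (E `&` \bigcup_p @rough_step s del c n p) <= P E * (K * (4 / 5) ^+ n)%:E)%E.
  have sub' : E `&` \bigcup_p @rough_step s del c n p `<=` \bigcup_p (E `&` @rough_step s del c
    n p).
    by move=> w [Ew [p _ wp]]; exists p.
  have mEp p : measurable (E `&` @rough_step s del c n p) by exact: measurableI.
  apply: (le_trans (measure_fin_bigcup_le P (mErn n) mEp sub')).
  pose b := 64 * (2 * (del / 2 ^+ n)) ^+ 2 / (c * (9 / 10) ^+ n) ^+ 4.
  have p2 : 0 < del / 2 ^+ n by rewrite divr_gt0// exprn_gt0.
  have r0 : 0 < c * (9 / 10) ^+ n by rewrite mulr_gt0// exprn_gt0//; lra.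
  apply: (@le_trans _ _ (\sum_(p : 'I_(2 ^ n) * 'I_d) (P E * b%:E)%E)).
    apply: lee_sum => -[j i] _.
    have E1 : dyadic s del n j.+1 - dyadic s del n j = del / 2 ^+ n.
      by rewrite /dyadic -natr1; ring.
    have sj : s <= dyadic s del n j by rewrite dyadic_ge// ltW.
    have jj : dyadic s del n j < dyadic s del n j.+1 by rewrite -subr_gt0 E1.
    have := increment_coord i (le_trans s0 sj) jj (past_incl sj pE)
      (measurable_abs_gt (c * (9 / 10) ^+ n)).
    rewrite E1 => h; apply: (@le_trans _ _ (P E * normal_prob 0 (Num.sqrt (2 * (del / 2 ^+ n)))
      [set x | (c * (9 / 10) ^+ n < `|x|)%R])%E).
      by rewrite -h; exact: lexx.
    apply: lee_wpmul2l => //.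
    rewrite /b.
    have -> : (2 * (del / 2 ^+ n)) ^+ 2 = Num.sqrt (2 * (del / 2 ^+ n)) ^+ 4 :> R.
      by rewrite (exprM _ 2 2) sqr_sqrtr// mulr_ge0// ltW.
    by apply: normal_prob_tail => //; rewrite sqrtr_gt0 mulr_gt0.
  rewrite -(fineK fPE) -EFinM sumEFin -EFinM lee_fin sumr_const card_prod !card_ord.
  rewrite -[leLHS]mulr_natr -mulrA ler_wpM2l ?fine_ge0// natrM natrX /b /K.
  have -> : 64 * (2 * (del / 2 ^+ n)) ^+ 2 / (c * (9 / 10) ^+ n) ^+ 4 * (2 ^+ n * d%:R) =
     256 * d%:R * del ^+ 2 / c ^+ 4 * (10000 / 13122) ^+ n.
    (* Generation [n] has [2^n] steps per coordinate, each with probability of order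
       [4^-n (10/9)^(4n)]: the ratio is [10000/13122 < 4/5]. Summing [(4/5)^n] gives the factor 5 in
       [1280 = 5 * 256]. *)
    rewrite (_ : 10000 / 13122 = (2 * (9 / 10) ^+ 4)^-1); last by field.
    have -> : (2 * (9 / 10) ^+ 4)^-1 ^+ n = (2 ^+ n * ((9 / 10) ^+ n) ^+ 4)^-1 :> R.
      by rewrite exprVn exprMn exprAC.
    have r1 : (9 / 10) ^+ n != 0 :> R by rewrite expf_neq0//; apply/eqP; lra.
    have u0 : 2 ^+ n != 0 :> R by rewrite expf_neq0.
    move: (2 ^+ n) ((9 / 10) ^+ n) u0 r1 => u r u0 r1.
    by field; rewrite r1 u0 gt_eqF.
  rewrite ler_wpM2l// lerXn2r ?nnegrE; lra.
apply: (@le_trans _ _ (\sum_(n <oo) (P E * (K * (4 / 5) ^+ n)%:E))%E).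
  by apply: lee_nneseries => [n _ _|n _]; [exact: measure_ge0|exact: step].
under eq_eseriesr => n _ do rewrite -(fineK fPE) -EFinM mulrA.
rewrite eseries_geometric; last by rewrite ger0_norm; lra.
rewrite [leRHS](_ : _ = (fine (P E) * K / (1 - 4 / 5))%:E)//.
have [p ->] : exists p, P E = p%:E by exists (fine (P E)); rewrite fineK.
rewrite /= -EFinM /K; congr EFin.
by field; rewrite gt_eqF.
Qed.

(* With probability at least [2^-d] every coordinate of the increment points
   towards [x0], and then [B (s + del)] is back in the half-size cube if the
   path is not rough; the sign pattern is fixed by a pigeonhole argument. *)
Lemma stay_step (x0 : 'rV[R]_d) eps del s E : 0 < eps -> 0 < del ->
  1280 * d%:R * del ^+ 2 / (eps / 20) ^+ 4 < (2^-1) ^+ d ->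
  0 <= s -> past B s E -> (0 < P E)%E ->
  (forall w, E w -> cube x0 (eps / 2) (B s w)) ->
  exists F, [/\ past B (s + del) F, (0 < P F)%E, F `<=` E,
    forall w, F w -> cube x0 (eps / 2) (B (s + del) w) &
    forall w, F w -> forall u, s <= u -> u <= s + del -> cube x0 eps (B u w)].
Proof.
(* This [c] gives oscillation at most [10 c = eps / 2], so a path that is not rough and starts in
   the half-size cube remains in the cube of size [eps] throughout the step. *)
move=> eps0 del0 small s0 pE PE0 EB; pose c := eps / 20.
have c0 : 0 < c by rewrite divr_gt0.
have ssd : s <= s + del by rewrite lerDl ltW.
have sd0 : 0 <= s + del by rewrite addr_ge0// ltW.
have mE := past_measurable mB pE.
pose Q (f : {ffun 'I_d -> bool}) := E `&` B s @^-1` box (fun i => [set x | half_line (f i) (x -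
  x0 ord0 i)]).
have pQ f : past B s (Q f).
  apply: past_setI => //; apply: past_preimage => //; apply: measurable_box => i.
  rewrite -[X in measurable X]setTI.
  have mx : measurable_fun setT (fun x : measurableTypeR R => (x - x0 ord0 i : measurableTypeR
    R)).
    exact: measurable_funB.
  by apply: mx => //; exact: measurable_half_line.
have mQ f : measurable (Q f) by exact: past_measurable (pQ f).
have [f Qf0] : exists f, (0 < P (Q f))%E.
  apply: contrapT => /forallNP Q0; move: PE0; apply/negP; rewrite -leNgt.
  have EQ : E `<=` \bigcup_f Q f.
    move=> w Ew; exists [ffun i => 0 <= B s w ord0 i - x0 ord0 i] => //; split => // i.
    by rewrite /= ffunE; case: leP => // /ltW.
  apply: (le_trans (measure_fin_bigcup_le P mE mQ EQ)).
  by rewrite big1// => f _; apply/eqP; rewrite eq_le measure_ge0 andbT leNgt; apply/negP/Q0.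
pose S i := [set w | half_line (~~ f i) ((B (s + del) w - B s w) ord0 i)].
have pS i : past B (s + del) (S i) by apply: past_increment => //; exact: measurable_half_line.
pose F := Q f `&` \bigcap_i S i `&` ~` rough s del c.
have pQS : past B (s + del) (Q f `&` \bigcap_i S i).
  by apply: past_setI; [exact: past_incl (pQ f)|exact: past_fin_bigcap].
have pF : past B (s + del) F.
  by apply: past_setI => //; apply: past_setC; apply: past_rough => //; exact: ltW.
have mF := past_measurable mB pF.
have mQS := past_measurable mB pQS.
have pR := past_rough c s0 (ltW del0).
have mR := past_measurable mB pR.
have osc w : F w -> forall i u, s <= u -> u <= s + del ->
    `|B u w ord0 i - B s w ord0 i| <= eps / 2.
  move=> [_ nR] i u su us.
  have := @chaining_oscillation _ (fun t => B (Num.max t 0) w ord0 i) s del c (ltW c0) del0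
    (@coord_path_continuous w i).
  rewrite (_ : 10 * c = eps / 2); last by rewrite /c; field.
  move=> /(_ _ u su us); rewrite !max_l ?(le_trans s0)//; apply => n j jn.
  have tge k : 0 <= dyadic s del n k by rewrite (le_trans s0)// dyadic_ge// ltW.
  rewrite !max_l// leNgt; apply/negP => bad.
  apply: nR; exists n => //; exists (Ordinal jn, i) => //.
  by rewrite /rough_step /= !mxE.
exists F; split => //.
(* If [P F = 0], almost all of [Q f] with correctly directed increments is rough; comparing
   [P (Q f) 2^-d] with the roughness bound contradicts [small]. *)
- rewrite lt_neqAle measure_ge0 andbT eq_sym; apply/negP => /eqP PF0.
  have h1 : (P (Q f) * ((2^-1) ^+ d)%:E <= P (Q f `&` \bigcap_i S i))%E.
    have -> : Q f `&` \bigcap_i S i = Q f `&` [set w | forall i, half_line (~~ f i) ((B (s +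
      del) w - B s w) ord0 i)].
      by congr (_ `&` _); apply/seteqP; split => w h i; [exact: (h i Logic.I)|move=> _; exact: h].
    have sltd : s < s + del by rewrite ltrDl.
    case: hB => _ _ /(_ s (s + del) (Q f) (fun i => half_line (~~ f i)) s0 sltd (pQ f)) h _.
    have {}h := h (fun i => measurable_half_line _).
    apply: (@le_trans _ _ (P (Q f) * \prod_(i < d) normal_prob 0 (Num.sqrt (2 * (s + del - s)))
      (half_line (~~ f i)))%E); last first.
      by rewrite -h; exact: lexx.
    apply: lee_wpmul2l => //.
    have -> : ((2^-1 : R) ^+ d)%:E = (\prod_(i < d) (2^-1)%:E)%E.
      by rewrite prodEFin prodr_const card_ord.
    suff : (0 <= \prod_(i < d) (2^-1 : R)%:E <= \prod_(i < d) normal_prob 0 (Num.sqrt (2 * (s +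
      del - s))) (half_line (~~ f i)))%E by case/andP.
    apply: (big_ind2 (fun a b : \bar R => (0 <= a <= b)%E)) => //.
    + by rewrite lee01 lexx.
    + move=> a1 b1 a2 b2 /andP[a10 ab1] /andP[a20 ab2].
      by rewrite mule_ge0//= lee_pmul.
    + move=> i _; rewrite lee_fin invr_ge0 ler0n /=; apply: normal_prob_half.
      by rewrite addrAC subrr add0r gt_eqF// sqrtr_gt0 mulr_gt0.
  have h2 : (P (Q f `&` \bigcap_i S i) <= P F + P (Q f `&` rough s del c))%E.
    apply: (@le_trans _ _ (P (F `|` (Q f `&` rough s del c)))).
      apply: le_measure; rewrite ?inE//.
        by apply: measurableU => //; exact: measurableI.
      move=> w [Qw Sw]; have [Rw|Rw] := pselect (rough s del c w); [by right|by left].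
    by apply: measureU2 => //; exact: measurableI.
  have h3 := rough_prob s0 del0 c0 (pQ f).
  have := le_trans h1 h2; rewrite PF0 add0e => /le_trans/(_ h3).
  have fQ := fin_num_measure P _ (mQ f).
  rewrite -(fineK fQ) -!EFinM lee_fin ler_pM2l; first by rewrite leNgt small.
  by rewrite -lte_fin fineK.
- by move=> w [[[]]].
(* The offset from [x0] and the displacement are both at most [eps / 2] in size and have opposite
   directions, so their sum is still at most [eps / 2]. *)
- move=> w Fw i; have := osc w Fw i (s + del) ssd (lexx _).
  case: Fw => [[[Ew Qw] Sw] _]; have := EB w Ew i; have := Qw i; have := Sw i Logic.I.
  rewrite /S /half_line /= !mxE; move: (B (s + del) w ord0 i) (B s w ord0 i) (x0 ord0 i) => a b x.
  by rewrite !ler_norml; case: (f i) => /= h1 h2 /andP[h3 h4] /andP[h5 h6]; apply/andP; split;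
    lra.
- move=> w Fw u su us i; have := osc w Fw i u su us.
  case: Fw => [[[Ew Qw] Sw] _]; have := EB w Ew i.
  by rewrite !ler_norml => /andP[h3 h4] /andP[h5 h6]; apply/andP; split; lra.
Qed.

(** The time interval is cut into [N] equal steps; each step keeps a positive probability and ends
    in the half-size cube, ready for the next one. The support condition starts the induction at
    time 0. *)
Theorem stay_in_cube (x0 : 'rV[R]_d) eps (beta : R) : 0 < eps -> 0 < beta ->
  measure_support m x0 ->
  exists F, [/\ measurable F, (0 < P F)%E &
    forall w, F w -> forall u, 0 <= u -> u <= beta -> cube x0 eps (B u w)].
Proof.
move=> eps0 beta0 mx0.
pose Y := 1280 * d%:R * beta ^+ 2 / (eps / 20) ^+ 4.
have Y0 : 0 <= Y.
  apply: divr_ge0; last by rewrite exprn_ge0// divr_ge0// ltW.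
  by apply: mulr_ge0 (sqr_ge0 _); apply: mulr_ge0; exact: ler0n.
(* Rescaling [beta] to [beta / N] divides the roughness constant by [N^2]; as [N > Y 2^d], already
   [Y / N < 2^-d]. *)
pose N := (Num.truncn (Y * 2 ^+ d)).+1.
have N1 : 1 <= N%:R :> R by rewrite ler1n.
pose del := beta / N%:R.
have del0 : 0 < del by rewrite divr_gt0.
have small : 1280 * d%:R * del ^+ 2 / (eps / 20) ^+ 4 < (2^-1) ^+ d.
  have -> : 1280 * d%:R * del ^+ 2 / (eps / 20) ^+ 4 = Y / N%:R ^+ 2.
    by rewrite /Y /del exprMn exprVn; ring.
  apply: (@le_lt_trans _ _ (Y / N%:R)).
    by rewrite ler_wpM2l// lef_pV2 ?posrE ?exprn_gt0// ler_eXnr.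
  rewrite exprVn ltr_pdivrMr// mulrC ltr_pdivlMr ?exprn_gt0//.
  exact: truncnS_gt.
suff /(_ N)[F [pF PF _ FB]] : forall k : nat, exists F, [/\ past B (k%:R * del) F, (0 < P F)%E,
    forall w, F w -> cube x0 (eps / 2) (B (k%:R * del) w) &
    forall w, F w -> forall u, 0 <= u -> u <= k%:R * del -> cube x0 eps (B u w)].
  exists F; split => //; first exact: past_measurable pF.
  move=> w Fw u u0 ub; apply: FB => //.
  by rewrite /del mulrCA divff ?mulr1// gt_eqF.
elim=> [|k [E [pE PE EB EB']]].
  exists (B 0 @^-1` cube x0 (eps / 2)); rewrite mul0r; split => //.
  - by apply: past_preimage => //; exact: measurable_cube.
  - case: hB => _ h0 _ _; rewrite (h0 _ (measurable_cube _ _)).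
    have eps2 : 0 < eps / 2 by rewrite divr_gt0.
    have := mx0 _ (open_interior (cube x0 (eps / 2))) (cube_nbhs x0 eps2).
    move=> /lt_le_trans; apply; apply: le_measure; rewrite ?inE.
    + by apply: open_measurable_rV; exact: open_interior.
    + exact: measurable_cube.
    + exact: interior_subset.
  - move=> w wB u u0 u0'; have -> : u = 0 by apply/eqP; rewrite eq_le u0 u0'.
    by move=> i; apply: (le_trans (wB i)); lra.
have kd0 : 0 <= k%:R * del by rewrite mulr_ge0// ltW.
have [F [pF PF FE FB FB']] := stay_step eps0 del0 small kd0 pE PE EB.
exists F; rewrite -natr1 mulrDl mul1r; split => //.
move=> w Fw u u0 uk; have [uk'|uk'] := leP u (k%:R * del).
  by apply: EB' => //; exact: FE.
by apply: FB' => //; exact: ltW.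
Qed.

End brownian_paths.

(** * The occupation density *)

Lemma indic_integrable d (T : measurableType d) (R : realType)
    (mu : {measure set T -> \bar R}) (A : set T) :
  measurable A -> (mu A < +oo)%E -> mu.-integrable setT (fun x => (\1_A x)%:E).
Proof.
move=> mA Afin; apply/integrableP; split.
  by apply/measurable_EFinP; exact: measurable_indic.
under eq_integral do rewrite gee0_abs ?lee_fin//.
by rewrite integral_indic// setIT.
Qed.

Lemma bounded_integrable d (T : measurableType d) (R : realType)
    (nu : {finite_measure set T -> \bar R}) (g : T -> R) (K : R) :
  measurable_fun setT g -> (forall x, `|g x| <= K) -> nu.-integrable setT (fun x => (g x)%:E).
Proof.
move=> mg gK; apply: measurable_bounded_integrable => //.
  by rewrite ltey_eq fin_num_measure.
exists K; split; first exact: num_real.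
by move=> y Ky x _ /=; rewrite (le_trans (gK _))// ltW.
Qed.

Section density_measure.
Context d (T : measurableType d) (R : realType) (mu : {measure set T -> \bar R}).
Variable r : T -> R.
Hypothesis r0 : forall x, 0 <= r x.
Hypothesis ir : mu.-integrable setT (EFin \o r).

(** For [r = phi ^ 2] and Lebesgue measure this has the body of [square_measure], but it is equipped
    here with the structure of a finite measure, which opens integrals against that bare set
    function to measure theory. *)
Definition density_measure : set T -> \bar R := fun A => (\int[mu]_(x in A) (r x)%:E)%E.

Let density_measure0 : density_measure set0 = 0%E.
Proof. by rewrite /density_measure integral_set0. Qed.

Let density_measure_ge0 A : (0 <= density_measure A)%E.
Proof. by apply: integral_ge0 => x _; rewrite lee_fin. Qed.

Let density_measure_sigma_additive : semi_sigma_additive density_measure.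
Proof.
move=> F mF tF mUF; rewrite /density_measure ge0_integral_bigcup//.
- apply: is_cvg_ereal_nneg_natsum_cond => n _ _.
  by apply: integral_ge0 => x _; rewrite lee_fin.
- exact: measurable_funS (measurable_int mu ir).
- by move=> x _; rewrite lee_fin.
Qed.

HB.instance Definition _ := isMeasure.Build _ _ _ density_measure
  density_measure0 density_measure_ge0 density_measure_sigma_additive.

Let density_measure_fin : fin_num_fun density_measure.
Proof.
move=> A mA; rewrite ge0_fin_numE// /density_measure.
apply: (@le_lt_trans _ _ (\int[mu]_x (r x)%:E)%E).
  have mr := measurable_int mu ir.
  by apply: ge0_subset_integral => // x _; rewrite lee_fin.
by have /integrable_lty := ir; apply.
Qed.

HB.instance Definition _ := @Measure_isFinite.Build _ _ _ density_measure density_measure_fin.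

Definition density_finite_measure : {finite_measure set T -> \bar R} := density_measure.

End density_measure.

Section density_integration.
Context d (T : measurableType d) (R : realType).
Variables (nu : {finite_measure set T -> \bar R}) (mu : {sigma_finite_measure set T -> \bar R}).

Lemma density_dominates (r : T -> R) : (forall A, measurable A -> nu A = \int[mu]_(x in A) (r
  x)%:E)%E ->
  measurable_fun setT r -> nu `<< mu.
Proof.
move=> nuE mr; apply/null_content_dominatesP => A mA muA; rewrite nuE//.
by apply: null_set_integral => //; apply/measurable_EFinP; exact: measurable_funTS.
Qed.

(** [r] and the Radon-Nikodym derivative have equal integrals over every measurable set, so they
    agree almost everywhere, and the change of variables for the derivative applies to [r]. *)
Lemma integral_density (r : T -> R) (g : T -> \bar R) :
  (forall A, measurable A -> nu A = \int[mu]_(x in A) (r x)%:E)%E ->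
  measurable_fun setT r -> nu.-integrable setT g ->
  (\int[nu]_x g x = \int[mu]_x (g x * (r x)%:E))%E.
Proof.
move=> nuE mr ig; have numu := density_dominates nuE mr.
rewrite -(Radon_Nikodym_change_of_variables numu)//.
have mg := measurable_int nu ig.
have mRN : measurable_fun setT (charge.Radon_Nikodym (charge_of_finite_measure nu) mu).
  by apply: measurable_int; apply: Radon_Nikodym_integrable.
apply: ae_eq_integral => //.
- exact: emeasurable_funM.
- by apply: emeasurable_funM => //; exact/measurable_EFinP.
apply: ae_eqe_mul2l; apply: integral_ae_eq => //.
- exact: Radon_Nikodym_integrable.
- exact/measurable_EFinP.
- by move=> E _ mE; rewrite -nuE// -Radon_Nikodym_integral.
Qed.

Lemma density_exists : nu `<< mu -> exists r : T -> R,
  [/\ measurable_fun setT r, (forall x, 0 <= r x) &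
      (forall A, measurable A -> nu A = \int[mu]_(x in A) (r x)%:E)%E].
Proof.
move=> numu; pose f := Radon_Nikodym_SigmaFinite.f nu mu.
have ffin x : f x \is a fin_num by exact: Radon_Nikodym_SigmaFinite.f_fin_num.
exists (fine \o f); split.
- apply: measurableT_comp => //.
  by apply: measurable_int; exact: Radon_Nikodym_SigmaFinite.f_integrable.
- by move=> x; apply: fine_ge0; exact: Radon_Nikodym_SigmaFinite.f_ge0.
move=> A mA; rewrite (Radon_Nikodym_SigmaFinite.f_integral numu)//.
by apply: eq_integral => x _ /=; rewrite fineK.
Qed.

End density_integration.

Section square_integrability.
Context d (T : measurableType d) (R : realType) (mu : {measure set T -> \bar R}).

(* The mass above height [2 b 2^k] is at most [2 a 4^-k], which makes the
   dyadic decomposition of the square integral summable. *)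
Lemma square_integrable_of_splitting (r : T -> R) (a b : R) :
  0 <= a -> 0 < b -> measurable_fun setT r -> (forall x, 0 <= r x) ->
  (\int[mu]_x (r x)%:E < +oo)%E ->
  (forall k A, measurable A ->
    \int[mu]_(x in A) (r x)%:E <= (a / 4 ^+ k)%:E + (b * 2 ^+ k)%:E * mu A)%E ->
  (\int[mu]_x (r x ^+ 2)%:E < +oo)%E.
Proof.
move=> a0 b0 mr r0 rfin split_r.
pose h k := 2 * (b * 2 ^+ k).
have h0 k : 0 < h k by rewrite !mulr_gt0// exprn_gt0.
pose D k := [set x | h k < r x].
have mD k : measurable (D k).
  rewrite (_ : D k = r @^-1` `]h k, +oo[%classic).
    by rewrite -[X in measurable X]setTI; exact: mr.
  by apply/seteqP; split => x /=; rewrite in_itv/= andbT.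
have r0' A x : A x -> (0 <= (r x)%:E)%E by rewrite lee_fin.
have mrA A : measurable_fun A (fun x => (r x)%:E).
  by apply/measurable_EFinP; exact: measurable_funTS.
pose q k := (\int[mu]_(x in D k) (r x)%:E)%E.
have q0 k : (0 <= q k)%E by apply: integral_ge0; exact: r0'.
have qfin k : q k \is a fin_num.
  rewrite ge0_fin_numE//; apply: le_lt_trans rfin.
  by apply: ge0_subset_integral => //; exact: r0'.
have qle k : (q k <= (2 * a / 4 ^+ k)%:E)%E.
  have h1 : ((h k)%:E * mu (D k) <= q k)%E.
    rewrite -integral_cst//; apply: ge0_le_integral => //.
    - by move=> x _; rewrite lee_fin ltW.
    - by move=> x /= Dx; rewrite lee_fin ltW.
  have h2 := split_r k (D k) (mD k).
  (* [h k] is twice the coefficient of [mu A] in the splitting, so that term is at most half of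
     [q k] and, [q k] being finite, is absorbed on the left. *)
  have : ((2 : R)%:E * q k <= (2 * a / 4 ^+ k)%:E + q k)%E.
    apply: (@le_trans _ _ ((2 : R)%:E * ((a / 4 ^+ k)%:E + (b * 2 ^+ k)%:E * mu (D k)))%E).
      by rewrite lee_pmul2l.
    rewrite ge0_muleDr ?mule_ge0 ?lee_fin ?divr_ge0 ?exprn_ge0 ?mulr_ge0 ?(ltW b0)//.
    by rewrite muleA -!EFinM -mulrA leeD2l.
  by rewrite -(fineK (qfin k)) -EFinM -EFinD !lee_fin; lra.
pose u (k : nat) x : \bar R := ((h k.+1)%:E * (r x * \1_(D k) x)%:E)%E.
have u0 k x : (0 <= u k x)%E.
  apply: mule_ge0; first by rewrite lee_fin ltW.
  by rewrite lee_fin mulr_ge0// indicE.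
have mu_ k : measurable_fun setT (u k).
  apply: emeasurable_funM => //; apply/measurable_EFinP.
  by apply: measurable_funM => //; exact: measurable_indic.
have pointwise x : ((r x ^+ 2)%:E <= (h 0)%:E * (r x)%:E + \sum_(k <oo) u k x)%E.
  have [rh|rh] := leP (r x) (h 0%N).
    rewrite -[leLHS]adde0; apply: leeD; last exact: nneseries_ge0.
    by rewrite -EFinM lee_fin expr2 ler_wpM2r.
  have [k [hk kh]] : exists k, h k < r x /\ r x <= h k.+1.
    have ex : exists k, r x <= h k.
      exists (Num.truncn (r x / b)).+1.
      rewrite /h mulrCA -ler_pdivrMl// mulrC (le_trans (ltW (truncnS_gt _)))//.
      by rewrite -exprS -natrX ler_nat ltnW// (leq_trans (ltn_expl _ (isT : 1 < 2)%N))//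
        leq_exp2l.
    case: (ex_minnP ex) => -[|k] rk kmin; first by move: rk; rewrite leNgt rh.
    exists k; split => //; rewrite ltNge; apply/negP => /kmin.
    by rewrite ltnn.
  apply: (@le_trans _ _ (u k x)).
    by rewrite /u indicE mem_set// mulr1 -EFinM lee_fin expr2 ler_wpM2r.
  rewrite -[leLHS]add0e; apply: leeD.
    by rewrite mule_ge0// lee_fin// ltW.
  apply: (@le_trans _ _ (\sum_(0 <= i < k.+1) u i x)%E).
    by rewrite big_nat_recr//= leeDr// sume_ge0.
  exact: nneseries_lim_ge.
apply: (@le_lt_trans _ _ (\int[mu]_x ((h 0)%:E * (r x)%:E + \sum_(k <oo) u k x))%E).
  apply: ge0_le_integral => //.
  - by move=> x _; rewrite lee_fin sqr_ge0.
  - by apply/measurable_EFinP; exact: (measurable_funX 2 mr).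
  - apply: emeasurable_funD; first by apply: emeasurable_funM => //; exact: mrA.
    exact: ge0_emeasurable_sum.
rewrite ge0_integralD//; last 4 first.
- by move=> x _; rewrite mule_ge0// lee_fin// ltW.
- by apply: emeasurable_funM => //; exact: mrA.
- by move=> x _; exact: nneseries_ge0.
- exact: ge0_emeasurable_sum.
rewrite ge0_integralZl_EFin//; last 2 first.
- by move=> x _; rewrite lee_fin.
- exact: ltW.
rewrite lte_add_pinfty//; first by rewrite lte_mul_pinfty// lee_fin ltW.
rewrite integral_nneseries//.
(* [h (k+1) = 4 b 2^k] times the mass bound [2 a 4^-k] is [8 a b 2^-k]. *)
apply: (@le_lt_trans _ _ (\sum_(k <oo) ((8 * a * b) * (2^-1) ^+ k)%:E)%E); last first.
  by rewrite eseries_geometric ?ltry// ger0_norm; lra.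
apply: lee_nneseries => [k _ _|k _]; first exact: integral_ge0.
rewrite /u ge0_integralZl_EFin//; last 3 first.
- by move=> x _; rewrite lee_fin mulr_ge0// indicE.
- apply/measurable_EFinP; apply: measurable_funM => //; exact: measurable_indic.
- exact: ltW.
have -> : (\int[mu]_x (r x * \1_(D k) x)%:E = q k)%E.
  rewrite /q [RHS]integral_mkcond; apply: eq_integral => x _.
  by rewrite patchE indicE; case: ifP => xD; rewrite ?mulr1 ?mulr0.
apply: (@le_trans _ _ ((h k.+1)%:E * (2 * a / 4 ^+ k)%:E)%E).
  by rewrite lee_pmul2l// lte_fin.
rewrite -EFinM lee_fin /h exprS exprVn (_ : 4 ^+ k = 2 ^+ k * 2 ^+ k :> R).
  rewrite le_eqVlt; apply/orP; left; apply/eqP; field.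
  by rewrite expf_neq0.
by rewrite -exprMn; congr (_ ^+ _); ring.
Qed.

End square_integrability.

Section finite_measure_of.
Context d (T : measurableType d) (R : realType) (mu : {measure set T -> \bar R}).
Hypothesis mufin : fin_num_fun mu.

Let mu' : set T -> \bar R := mu.

HB.instance Definition _ := Measure.on mu'.
HB.instance Definition _ := @Measure_isFinite.Build _ T _ mu' mufin.

Definition finite_measure_of : {finite_measure set T -> \bar R} := mu'.

End finite_measure_of.

Section sigma_finite_measure_of.
Context d (T : measurableType d) (R : realType) (mu : {measure set T -> \bar R}).
Hypothesis musf : sigma_finite setT mu.

Let mu' : set T -> \bar R := mu.

HB.instance Definition _ := Measure.on mu'.
HB.instance Definition _ := @Measure_isSigmaFinite.Build _ T _ mu' musf.

Definition sigma_finite_measure_of : {sigma_finite_measure set T -> \bar R} := mu'.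

End sigma_finite_measure_of.

Section caratheodory_function.
Context {R : realType} d (T : measurableType d).

(** Time is rounded down to the grid of mesh [1/(n+1)]. The rounded function is measurable, its
    preimages being countable unions of products, and it converges pointwise by continuity in
    time. *)
Lemma measurable_caratheodory (X : R -> T -> R) :
  (forall w, continuous (X^~ w)) -> (forall t, measurable_fun setT (X t)) ->
  measurable_fun setT (fun p : measurableTypeR R * T => X p.1 p.2).
Proof.
move=> cX mX.
pose q (n : nat) (t : R) : R := (Num.floor (t * n.+1%:R))%:~R / n.+1%:R.
have qt (t : R) : q^~ t @ \oo --> t.
  apply: (@squeeze_cvgr _ _ _ _ (fun n => t - n.+1%:R^-1) (fun=> t)).
  - apply: nearW => n; rewrite /q.
    have := @floor_itv R (t * n.+1%:R) => /andP[h1 h2].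
    rewrite lerBlDr -[X in _ + X]mul1r -mulrDl ler_pdivlMr// ler_pdivrMr//.
    by rewrite h1 andbT ltW// (lt_le_trans h2)// intrD.
  - rewrite -[X in _ --> X]subr0; apply: cvgB; first exact: cvg_cst.
    exact: cvg_harmonic.
  - exact: cvg_cst.
apply/measurable_EFinP.
apply: (emeasurable_fun_cvg (fun n (p : measurableTypeR R * T) => (X (q n p.1) p.2)%:E));
  last first.
  move=> [t w] _ /=; apply: cvg_EFin; first exact: nearW.
  exact: (cvg_comp _ _ (qt t) (cX w t)).
move=> n; apply/measurable_EFinP => _ Y mY; rewrite setTI.
rewrite (_ : _ @^-1` Y = \bigcup_(k : int)
    ([set t : measurableTypeR R | Num.floor (t * n.+1%:R) = k] `*` (X (k%:~R / n.+1%:R) @^-1`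
      Y))); last first.
  apply/seteqP; split => [[t w] /= Ytw|[t w] [k _ [/= <-]]//].
  by exists (Num.floor (t * n.+1%:R)).
apply: countable_bigcupT_measurable; first exact: countableP.
move=> k; apply: measurableX; last by rewrite -[X in measurable X]setTI; exact: mX.
rewrite (_ : mkset _ = `[k%:~R / n.+1%:R, (k + 1)%:~R / n.+1%:R[%classic);
  first exact: measurable_itv.
apply/seteqP; split => t /=; rewrite in_itv/= ler_pdivrMr// ltr_pdivlMr//.
  by move=> <-; exact: floor_itv.
by move=> h; apply: floor_def.
Qed.

End caratheodory_function.

(** The peak at variance [2 t] is [1 / sqrt (4 pi t)]; reducing time by a factor at most [4^j]
    raises it by at most [2^j]. *)
Lemma normal_peak_scale (R : realType) (beta t : R) j : 0 < beta -> beta / 4 ^+ j <= t ->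
  normal_peak (Num.sqrt (2 * t)) <= normal_peak (Num.sqrt (2 * beta)) * 2 ^+ j.
Proof.
move=> beta0 jt.
have t0 : 0 < t by apply: lt_le_trans jt; rewrite divr_gt0// exprn_gt0.
have pos (u : R) : 0 < u -> 0 < 2 * u * pi *+ 2.
  by move=> u0; rewrite mulrn_wgt0// !mulr_gt0// pi_gt0.
have p0 : 0 < 2 ^+ j :> R by rewrite exprn_gt0.
rewrite /normal_peak !sqr_sqrtr ?mulr_ge0 ?(ltW beta0) ?(ltW t0)//.
rewrite -[2 ^+ j]invrK -invfM lef_pV2 ?posrE ?sqrtr_gt0 ?pos//; last first.
  by rewrite mulr_gt0 ?sqrtr_gt0 ?pos// invr_gt0.
rewrite ler_pdivrMr// -(ger0_norm (ltW p0)) -sqrtr_sqr -sqrtrM ?(ltW (pos _ t0))//.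
apply: ler_wsqrtr; rewrite -exprM mulnC exprM (_ : 2 ^+ 2 = 4); last by ring.
move: jt; rewrite ler_pdivrMr ?exprn_gt0// => /(ler_wpM2l (pi_ge0 R)).
lra.
Qed.

Section brownian_occupation.
Context {R : realType} {d : nat} {disp : measure_display} {Omega : measurableType disp}.
Variables (P : probability Omega R) (m : probability 'rV[R]_d R).
Variable B : R -> Omega -> 'rV[R]_d.
Hypothesis hB : brownian_motion P m B.
Local Notation leb := (lebesgue_rV (R := R) d).
Implicit Types (t beta : R).

Let mB t : 0 <= t -> measurable_fun [set: Omega] (B t).
Proof. by case: hB => h _ _ _; exact: h. Qed.

(* The paths are continuous only on [0, +oo[. *)
Definition bm_path (p : measurableTypeR R * Omega) : 'rV[R]_d := B (Num.max p.1 0) p.2.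

Lemma measurable_bm_path : measurable_fun setT bm_path.
Proof.
apply/measurable_fun_coordP => i.
apply: (@measurable_caratheodory R _ Omega (fun t w => B (Num.max t 0) w ord0 i)).
  by move=> w; exact: (coord_path_continuous hB).
move=> t; apply: (measurableT_comp (measurable_coord i)).
by apply: mB; rewrite le_max lexx orbT.
Qed.

(** Given the starting point, the increment has density at most [peak^d]; translation invariance of
    Lebesgue measure makes the bound independent of that point, so it survives integration over any
    initial law. *)
Lemma law_le t A : 0 < t -> measurable A ->
  (P (B t @^-1` A) <= (normal_peak (Num.sqrt (2 * t)) ^+ d)%:E * leb A)%E.
Proof.
move=> t0 mA; pose sg := Num.sqrt (2 * t).
have sg0 : sg != 0 by rewrite gt_eqF// sqrtr_gt0 mulr_gt0.
have [g [gbox gle]] := product_probability_le (normal_peak_ge0 sg)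
  (fun A => @normal_prob_le R sg A sg0) d.
have mB0 := mB (lexx 0); have mBt := mB (ltW t0).
have mincr : measurable_fun setT (fun w => B t w - B 0 w).
  apply/measurable_fun_coordP => i.
  rewrite (_ : (fun _ => _) = (fun w => B t w ord0 i - B 0 w ord0 i)); last first.
    by apply/funext => w; rewrite !mxE.
  by apply: measurable_funB; apply: (measurableT_comp (measurable_coord i)).
(* Independence of start and increment is given on boxes. It extends to every [D] by
   [rV_measure_unique] with [C] fixed, and then to the joint law by uniqueness of product
   measures. *)
have joint C D : measurable C -> measurable D ->
    P ((fun w => B t w - B 0 w) @^-1` D `&` B 0 @^-1` C) = (m C * g D)%E.
  move=> mC mD.
  have mBC : measurable (B 0 @^-1` C) by rewrite -[X in measurable X]setTI; exact: mB0.
  have mCfin := fin_num_measure m C mC.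
  have fmC0 : 0 <= fine (m C) by exact: fine_ge0.
  pose m1 := image_measure (mrestr P mBC) mincr.
  pose m2 : {measure set 'rV[R]_d -> \bar R} := mscale (NngNum fmC0) g.
  have -> : (m C * g D)%E = m2 D by rewrite /m2/= /mscale/= fineK.
  rewrite -[LHS]/(m1 D); apply: rV_measure_unique => // [A' mA'|k].
    rewrite /m2/= /mscale/= fineK// /m1/= /pushforward /mrestr setIC gbox//.
    case: hB => _ hm /(_ 0 t (B 0 @^-1` C) A' (lexx _) t0 _ mA') h _.
    rewrite -(hm C mC) (_ : (sg = Num.sqrt (2 * (t - 0)))); last by rewrite subr0.
    by rewrite -h//; apply: past_preimage.
  rewrite /m1/= /pushforward /mrestr.
  apply: (@le_lt_trans _ _ 1%E); last by rewrite ltry.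
  by apply: probability_le1; apply: measurableI => //; rewrite -[X in measurable X]setTI;
    exact: (mincr measurableT _ (measurable_cube _ _)).
have mpair : measurable_fun setT (fun w => (B 0 w, B t w - B 0 w)) by exact: measurable_fun_pair.
have jointE := product_measure_unique (m' := image_measure P mpair) (m1 := m) (m2 := g).
pose S := [set p : 'rV[R]_d * 'rV[R]_d | A (p.2 + p.1)].
have mS : measurable S.
  rewrite -[S]setTI; have madd : measurable_fun setT (fun p : 'rV[R]_d * 'rV[R]_d => p.2 + p.1).
    apply/measurable_fun_coordP => i; under eq_fun do rewrite mxE.
    apply: measurable_funD.
      exact: (measurableT_comp (measurable_coord i) measurable_snd).
    exact: (measurableT_comp (measurable_coord i) measurable_fst).
  exact: madd.
have -> : P (B t @^-1` A) = (m \x g)%E S.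
  rewrite jointE//; last first.
    by move=> C D mC mD; rewrite -joint//= /pushforward/=; congr (P _); rewrite setIC.
  rewrite /= /pushforward; congr (P _); apply/seteqP; split => w /=.
    by rewrite /S /= subrK.
  by rewrite /S /= subrK.
have cle0 : (0 <= (normal_peak sg ^+ d)%:E * leb A)%E.
  by rewrite mule_ge0// lee_fin exprn_ge0// normal_peak_ge0.
apply: (@le_trans _ _ (\int[m]_x (cst ((normal_peak sg ^+ d)%:E * leb A) x))%E).
  apply: ge0_le_integral => //.
  - exact: measurable_fun_xsection.
  - move=> x _; apply: (le_trans (gle _ _)); first exact: measurable_xsection.
    rewrite -(lebesgue_rV_translation x mA) (_ : xsection S x = (fun v => v + x) @^-1` A)//.
    by apply/seteqP; split => y; rewrite /xsection/= inE.
by rewrite integral_cst//= probability_setT mule1.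
Qed.

Local Notation prod := (@lebesgue_measure R \x P)%E.

Definition window (u v : R) : set (measurableTypeR R * Omega) := `[u, v]%classic `*` setT.

Lemma measurable_window u v : measurable (window u v).
Proof. by apply: measurableX => //; exact: measurable_itv. Qed.

Lemma strip_measure_le (S : set (measurableTypeR R * Omega)) (I : set (measurableTypeR R)) (M :
  \bar R) :
  measurable S -> measurable I -> (0 <= M)%E ->
  (forall t, I t -> P (xsection S t) <= M)%E ->
  (prod (S `&` (I `*` setT)) <= M * lebesgue_measure I)%E.
Proof.
move=> mS mI M0 SM.
rewrite [X in (X <= _)%E](_ : _ = \int[lebesgue_measure]_(t in I) P (xsection S t))%E; last first.
  rewrite [RHS]integral_mkcond; apply: eq_integral => t _.
  rewrite patchE /=; have [tI|tI] := boolP (t \in I).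
    congr (P _); apply/seteqP; split => w; rewrite /xsection/= !inE; first by case.
    by move=> h; split => //; split => //; rewrite inE in tI.
  rewrite [X in P X](_ : _ = set0) ?measure0//; apply/seteqP; split => w //.
  by rewrite /xsection/= inE => -[_ [/= It _]]; rewrite -inE in It; rewrite It in tI.
rewrite -integral_cst//; apply: ge0_le_integral => //.
by apply: measurable_funTS; exact: measurable_fun_xsection.
Qed.

(* Times before [beta 4^-k] contribute at most their length. During
   [[beta 4^-(j+1), beta 4^-j]] the law of [B t] has density [O(2^(d j))], so for
   [d <= 3] this strip contributes [O(2^j)] times the Lebesgue measure. *)
Lemma occupation_le (beta : R) : 0 < beta -> (d <= 3)%N -> exists2 C : R, 0 < C &
  forall k A, measurable A ->
    (prod (bm_path @^-1` A `&` window 0 beta) <=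
     (beta / 4 ^+ k)%:E + (C * 2 ^+ k)%:E * leb A)%E.
Proof.
(* The added 1 gives [c0 >= 1], so that the exponent [d] may be raised to 3 and the density after
   time [tau j] is at most [c0^3 8^j]. *)
move=> beta0 d3; pose c0 := 1 + normal_peak (Num.sqrt (2 * beta)).
have c1 : 1 <= c0 by rewrite lerDl normal_peak_ge0.
have c00 : 0 < c0 by rewrite (lt_le_trans _ c1).
pose C := 8 * beta * c0 ^+ 3.
have C0 : 0 < C by rewrite !mulr_gt0// exprn_gt0.
exists C => // k A mA.
pose tau j := beta / 4 ^+ j.
have tau0 j : 0 < tau j by rewrite divr_gt0// exprn_gt0.
have tauS j : tau j.+1 <= tau j.
  by rewrite /tau ler_pM2l// lef_pV2 ?posrE ?exprn_gt0// exprS ler_peMl ?exprn_ge0// ler1n.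
have taub j : tau j <= beta.
  by rewrite ler_pdivrMr ?exprn_gt0// ler_peMr ?(ltW beta0)// exprn_ege1// ler1n.
pose S := bm_path @^-1` A.
have mS : measurable S by rewrite -[S]setTI; exact: measurable_bm_path.
have peak_le j t : tau j <= t -> normal_peak (Num.sqrt (2 * t)) ^+ d <= c0 ^+ 3 * 8 ^+ j.
  move=> jt; have t0 : 0 < t by rewrite (lt_le_trans (tau0 j)).
  apply: (@le_trans _ _ ((c0 * 2 ^+ j) ^+ d)).
    rewrite lerXn2r ?nnegrE ?normal_peak_ge0 ?mulr_ge0 ?exprn_ge0 ?(ltW c00)//.
    apply: (le_trans (normal_peak_scale beta0 jt)).
    by rewrite ler_wpM2r ?exprn_ge0// lerDr.
  rewrite (_ : c0 ^+ 3 * 8 ^+ j = (c0 * 2 ^+ j) ^+ 3); last first.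
    by rewrite exprMn -exprM mulnC exprM; congr (_ * _ ^+ _); ring.
  by apply: ler_weXn2l => //; rewrite mulr_ege1// exprn_ege1// ler1n.
have strip j : (prod (S `&` window (tau j) beta) <= (C * 2 ^+ j)%:E * leb A)%E.
  elim: j => [|j ih].
    rewrite /tau expr0 divr1; apply: (@le_trans _ _ (1 * lebesgue_measure [set` `[beta,
      beta]%R])%E).
      apply: strip_measure_le => // t _; apply: probability_le1; exact: measurable_xsection.
    rewrite lebesgue_measure_itv/= ltxx mule0 mule_ge0// lee_fin mulr_ge0 ?ltW//.
  pose M := ((c0 ^+ 3 * 8 ^+ j.+1)%:E * leb A)%E.
  have M0 : (0 <= M)%E by rewrite mule_ge0// lee_fin mulr_ge0 ?exprn_ge0// ltW.
  have split_S : S `&` window (tau j.+1) beta `<=`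
      (S `&` window (tau j) beta) `|` (S `&` window (tau j.+1) (tau j)).
    move=> [t w] [/= Stw [/=]]; rewrite in_itv/= => /andP[t1 t2] _.
    have [jt|tj] := leP (tau j) t; [left|right]; split => //; split => //=; rewrite in_itv/=.
      by rewrite jt.
    by rewrite t1 ltW.
  have ms u v : measurable (S `&` window u v).
    by apply: measurableI => //; exact: measurable_window.
  apply: (@le_trans _ _ (prod (S `&` window (tau j) beta) +
                         prod (S `&` window (tau j.+1) (tau j)))%E).
    apply: le_trans (measureU2 _ _ _) => //.
    by apply: le_measure => //; rewrite inE//; exact: measurableU.
  apply: (@le_trans _ _ ((C * 2 ^+ j)%:E * leb A + M * lebesgue_measure [set` `[tau j.+1, tau
    j]%R])%E).
    apply: leeD => //; apply: strip_measure_le => // t; rewrite /= in_itv/= => /andP[t1 t2].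
    have t0 : 0 < t by rewrite (lt_le_trans (tau0 j.+1)).
    rewrite (_ : xsection S t = B t @^-1` A); last first.
      by apply/seteqP; split => w; rewrite /xsection/= inE /S /bm_path/= max_l// ltW.
    apply: (le_trans (law_le t0 mA)); rewrite /M lee_wpmul2r// lee_fin.
    exact: peak_le.
  (* The new strip costs [c0^3 8^(j+1)] times [beta 4^-j], that is [C 2^j]: as much as the bound for
     all earlier strips together, which explains the value of [C]. *)
  have -> : ((C * 2 ^+ j.+1)%:E = (C * 2 ^+ j)%:E + (C * 2 ^+ j)%:E)%E.
    by rewrite -EFinD exprS; congr EFin; ring.
  have Cj : (0 <= (C * 2 ^+ j)%:E)%E by rewrite lee_fin mulr_ge0 ?exprn_ge0 ?(ltW C0).
  rewrite [leRHS]ge0_muleDl// leeD2l//.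
  apply: (@le_trans _ _ (M * (tau j)%:E)%E).
    rewrite lee_wpmul2l// lebesgue_measure_itv/= lte_fin; case: ifP => _.
      by rewrite -EFinB lee_fin gerBl ltW.
    by rewrite lee_fin ltW.
  rewrite /M muleAC -EFinM lee_wpmul2r// lee_fin /C /tau (exprS 8).
  rewrite (_ : 8 ^+ j = 2 ^+ j * 4 ^+ j); last by rewrite -exprMn; congr (_ ^+ _); ring.
  rewrite le_eqVlt; apply/orP; left; apply/eqP; field.
  by rewrite expf_neq0.
have sub : S `&` window 0 beta `<=`
    (S `&` window 0 (tau k)) `|` (S `&` window (tau k) beta).
  move=> [t w] [/= Stw [/=]]; rewrite in_itv/= => /andP[t1 t2] _.
  have [jt|tj] := leP (tau k) t; [right|left]; split => //; split => //=; rewrite in_itv/=.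
    by rewrite jt.
  by rewrite t1 ltW.
have ms u v : measurable (S `&` window u v).
  by apply: measurableI => //; exact: measurable_window.
apply: (@le_trans _ _ (prod (S `&` window 0 (tau k)) +
                       prod (S `&` window (tau k) beta))%E).
  apply: le_trans (measureU2 _ _ _) => //.
  by apply: le_measure => //; rewrite inE//; exact: measurableU.
apply: leeD => //.
apply: (@le_trans _ _ (1 * lebesgue_measure [set` `[0%R, tau k]%R])%E).
  apply: strip_measure_le => // t _; apply: probability_le1; exact: measurable_xsection.
by rewrite mul1e lebesgue_measure_itv/= lte_fin tau0 sube0.
Qed.

Lemma path_integralE (beta : R) (f : 'rV[R]_d -> R) w :
  (path_integral B beta f w =
   fine (\int[lebesgue_measure]_(t in `[0%R, beta]) (f (bm_path (t, w)))%:E)%E).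
Proof.
rewrite /path_integral /Rintegral; congr fine; apply: eq_integral => t.
by rewrite inE /= in_itv/= => /andP[t0 _]; rewrite /bm_path/= max_l.
Qed.

Section path_integrals.
Variables (beta M : R) (f : 'rV[R]_d -> R) (E : set Omega).
Hypotheses (beta0 : 0 < beta) (mf : measurable_fun setT f) (fM : forall x, `|f x| <= M).
Hypothesis mE : measurable E.

Definition on_window : set (measurableTypeR R * Omega) := `[0, beta]%classic `*` E.

Lemma measurable_on_window : measurable on_window.
Proof. by apply: measurableX => //; exact: measurable_itv. Qed.

Lemma on_window_fin : (prod on_window < +oo)%E.
Proof.
rewrite product_measure1E//= lebesgue_measure_itv/= lte_fin beta0 oppr0 adde0.
by rewrite lte_mul_pinfty// ?lee_fin ?ltW// -ge0_fin_numE// fin_num_measure.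
Qed.

Lemma on_window_integrable :
  prod.-integrable setT (fun z => (f (bm_path z) * \1_on_window z)%:E).
Proof.
have i1 : prod.-integrable setT (fun z => (\1_on_window z)%:E).
  by apply: indic_integrable; [exact: measurable_on_window|exact: on_window_fin].
have := integrableZl measurableT M i1; apply: le_integrable => //.
  apply/measurable_EFinP/measurable_funM.
    exact: (measurableT_comp mf measurable_bm_path).
  by apply: measurable_indic; exact: measurable_on_window.
move=> z _; rewrite /= lee_fin !normrM ler_wpM2r//.
by rewrite (le_trans (fM _))// ler_norm.
Qed.

Lemma slice_integralE w :
  (\int[lebesgue_measure]_t (f (bm_path (t, w)) * \1_on_window (t, w))%:E =
   (path_integral B beta f w * \1_E w)%:E)%E.
Proof.
have mfw : measurable_fun setT (fun t : measurableTypeR R => f (bm_path (t, w))).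
  apply: (measurableT_comp mf); apply: (measurableT_comp measurable_bm_path).
  exact: pair2_measurable.
have ifw : (@lebesgue_measure R).-integrable `[0%R, beta] (fun t => (f (bm_path (t, w)))%:E).
  apply: measurable_bounded_integrable => //.
  - have := ltry beta; rewrite -(_ : lebesgue_measure [set` `[0%R, beta]%R] = beta%:E)//.
    by rewrite lebesgue_measure_itv/= lte_fin beta0 oppr0 adde0.
  - exact: measurable_funTS.
  - exists M; split; first exact: num_real.
    by move=> y My t _ /=; rewrite (le_trans (fM _))// ltW.
rewrite path_integralE EFinM fineK; last exact: integrable_fin_num.
rewrite -integralZr//; rewrite [RHS]integral_mkcond; apply: eq_integral => t _.
rewrite patchE; case: ifPn => tI; rewrite -?EFinM; congr EFin.
  rewrite !indicE (_ : ((t, w) \in on_window) = (w \in E))//.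
  by rewrite inE in tI; apply/idP/idP; rewrite !inE /on_window/=; [case|].
rewrite indicE (_ : ((t, w) \in on_window) = false) ?mulr0//.
by apply/negbTE; apply: contra tI; rewrite !inE => -[].
Qed.

(** Fubini; it identifies the expectation of the path integral on [E] with the pairing of [f] and
    the occupation measure of the paths in [E]. *)
Lemma path_integral_indicE :
  (\int[prod]_z (f (bm_path z) * \1_on_window z)%:E =
   \int[P]_w (path_integral B beta f w * \1_E w)%:E)%E.
Proof.
rewrite -(integral21_prod_meas1 on_window_integrable).
by apply: eq_integral => w _; exact: slice_integralE.
Qed.

Lemma measurable_path_integral_indic :
  measurable_fun setT (fun w => path_integral B beta f w * \1_E w).
Proof.
apply/measurable_EFinP; have := measurable_fubini_G on_window_integrable.
by congr (measurable_fun _); apply/funext => w; exact: slice_integralE.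
Qed.

Lemma path_integral_le w : `|path_integral B beta f w| <= M * beta.
Proof.
rewrite path_integralE.
have mfw : measurable_fun setT (fun t : measurableTypeR R => f (bm_path (t, w))).
  apply: (measurableT_comp mf); apply: (measurableT_comp measurable_bm_path).
  exact: pair2_measurable.
have lb : lebesgue_measure [set` `[0%R, beta]%R] = beta%:E.
  by rewrite lebesgue_measure_itv/= lte_fin beta0 oppr0 adde0.
have ub : (`|\int[lebesgue_measure]_(t in `[0%R, beta]) (f (bm_path (t, w)))%:E| <= (M *
  beta)%:E)%E.
  apply: (le_trans (le_abse_integral _ _ _)) => //.
    by apply/measurable_EFinP; exact: measurable_funTS.
  rewrite EFinM -lb -integral_cst//; apply: ge0_le_integral => //.
  - by apply/measurable_EFinP; apply: measurableT_comp => //; exact: measurable_funTS.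
  - by move=> t _; rewrite /= lee_fin.
move: ub; case: (\int[_]_(_ in _) _)%E => [r| |] //=.
Qed.

End path_integrals.

Lemma measurable_path_integral (beta M : R) (f : 'rV[R]_d -> R) :
  0 < beta -> measurable_fun setT f -> (forall x, `|f x| <= M) ->
  measurable_fun setT (path_integral B beta f).
Proof.
move=> beta0 mf fM.
have := measurable_path_integral_indic beta0 mf fM (@measurableT _ Omega).
by congr (measurable_fun _); apply/funext => w; rewrite indicE mem_set// mulr1.
Qed.

(* Jensen's inequality for the law conditioned on [E], through the tangent
   line of the exponential at the conditional mean. *)
Lemma log_laplace_ge (beta M : R) (f : 'rV[R]_d -> R) (E : set Omega) (p S : R) :
  0 < beta -> measurable_fun setT f -> (forall x, `|f x| <= M) ->
  measurable E -> P E = p%:E -> 0 < p ->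
  (\int[P]_w (path_integral B beta f w * \1_E w)%:E = S%:E)%E ->
  ((S / p + ln p)%:E <= lne 'E_P[fun w => expR (path_integral B beta f w)])%E.
Proof.
move=> beta0 mf fM mE PE p0 SE; pose a := S / p; pose F := path_integral B beta f.
have mF : measurable_fun setT F by exact: measurable_path_integral fM.
have Fb w : `|F w| <= M * beta by exact: path_integral_le.
have mFE : measurable_fun setT (fun w => F w * \1_E w).
  by apply: measurable_funM => //; exact: measurable_indic.
have iE : P.-integrable setT (fun w => (\1_E w)%:E).
  apply: (@bounded_integrable _ _ _ P (fun w => \1_E w) 1); first exact: measurable_indic.
  by move=> w; rewrite indicE ger0_norm// lern1 leq_b1.
have iFE : P.-integrable setT (fun w => (F w * \1_E w)%:E).
  apply: (@bounded_integrable _ _ _ P _ (M * beta)) => // w.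
  by rewrite normrM -[leRHS]mulr1 ler_pM// indicE ger0_norm// lern1 leq_b1.
have iexp : P.-integrable setT (EFin \o (fun w => expR (F w))).
  apply: (@bounded_integrable _ _ _ P (fun w => expR (F w)) (expR (M * beta))).
    exact: measurableT_comp.
  move=> w; rewrite ger0_norm ?expR_ge0// ler_expR.
  exact: (le_trans (ler_norm _)).
(* Over [E] the tangent line [expR a * (1 + F - a)] integrates to [expR a * p], since [F] has mean
   [a] there; outside [E] the exponential is bounded below by 0. *)
have key : ((expR a * p)%:E <= 'E_P[fun w => expR (F w)])%E.
  rewrite unlock /=.
  rewrite (_ : (expR a * p)%:E = \int[P]_w ((expR a * (1 - a))%:E * (\1_E w)%:E + (expR a)%:E *
    (F w * \1_E w)%:E))%E; last first.
    rewrite integralD//; [|exact: integrableZl|exact: integrableZl].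
    have iE1 : (\int[P]_w (\1_E w)%:E = p%:E)%E.
      by rewrite integral_indic// setIT; exact: PE.
    rewrite !integralZl// iE1 SE -!EFinM -EFinD; congr EFin.
    by rewrite /a; field; rewrite gt_eqF.
  apply: le_integral => //; first by apply: integrableD => //; exact: integrableZl.
  move=> w _; rewrite -!EFinM -EFinD lee_fin indicE.
  case: (w \in E); rewrite ?mulr1 ?mulr0 ?addr0 ?expR_ge0//.
  have -> : expR (F w) = expR a * expR (F w - a) by rewrite -expRD addrC subrK.
  by rewrite -mulrDr ler_wpM2l ?expR_ge0//; have := expR_ge1Dx (F w - a); lra.
have ep0 : 0 < expR a * p by rewrite mulr_gt0// expR_gt0.
apply: (@le_trans _ _ (lne (expR a * p)%:E)).
  by rewrite lne_EFin// lnM ?posrE ?expR_gt0// expRK.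
rewrite lee_lne// in_itv/= leey andbT; first by rewrite lee_fin ltW.
by apply: le_trans key; rewrite lee_fin ltW.
Qed.

(** [r] is the occupation density of the paths in [E], normalised by [beta p]. Its pairing with [f]
    is [S / (beta p)], and [log_laplace_ge] bounds the logarithm below by [S / p + ln p]; the [S]
    terms cancel and leave [K = - ln p / beta] for all [f] at once. *)
Theorem finite_rate_density (x0 : 'rV[R]_d) (eps beta : R) :
  0 < eps -> 0 < beta -> (d <= 3)%N -> measure_support m x0 ->
  exists r : 'rV[R]_d -> R, exists K : R,
  [/\ density leb r, (\int[leb]_(x in ~` cube x0 eps) (r x)%:E = 0)%E,
      (\int[leb]_x (r x ^+ 2)%:E < +oo)%E &
      forall f, bounded_continuous f ->
       (\int[leb]_x (f x * r x)%:E -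
        beta^-1%:E * lne 'E_P[fun w => expR (path_integral B beta f w)] <= K%:E)%E].
Proof.
move=> eps0 beta0 d3 mx0.
have [E [mE PE0 EB]] := stay_in_cube hB eps0 beta0 mx0.
have [p PE] : exists p, P E = p%:E by exists (fine (P E)); rewrite fineK// fin_num_measure.
have p0 : 0 < p by rewrite -lte_fin -PE.
pose D := on_window beta E.
have mD : measurable D by exact: measurable_on_window.
have ind0 z : 0 <= \1_D z :> R by rewrite indicE.
have iD : prod.-integrable setT (EFin \o \1_D).
  by apply: indic_integrable => //; exact: on_window_fin.
pose nu0 := density_finite_measure ind0 iD.
have mpre A : measurable A -> measurable (bm_path @^-1` A).
  by move=> mA; rewrite -[X in measurable X]setTI; exact: measurable_bm_path.
have [nu nuE] : exists nu : {finite_measure set 'rV[R]_d -> \bar R},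
    forall A, measurable A -> nu A = prod (bm_path @^-1` A `&` D).
  have fin : fin_num_fun (image_measure nu0 measurable_bm_path).
    by move=> A mA; apply: (fin_num_measure nu0); exact: mpre.
  exists (finite_measure_of fin) => A mA.
  rewrite /finite_measure_of/= /pushforward /nu0/= /density_measure.
  rewrite integral_indic//; last exact: mpre.
  by rewrite setIC.
have [C C0 occ] := occupation_le beta0 d3.
have nu_le k A : measurable A -> (nu A <= (beta / 4 ^+ k)%:E + (C * 2 ^+ k)%:E * leb A)%E.
  move=> mA; rewrite nuE//; apply: le_trans (occ k A mA).
  apply: le_measure; rewrite ?inE.
  - by apply: measurableI => //; exact: mpre.
  - by apply: measurableI; [exact: mpre|exact: measurable_window].
  - by move=> z [Az [Dz _]]; split => //; split.
(* On a Lebesgue null set the splitting leaves [beta 4^-k] for every [k]. *)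
have numu : nu `<< leb.
  apply/null_content_dominatesP => A mA A0.
  apply/eqP; rewrite eq_le measure_ge0 andbT; apply/lee_addgt0Pr => e e0.
  rewrite add0e.
  have [k ke] : exists k : nat, beta / 4 ^+ k <= e.
    exists (Num.truncn (beta / e)).+1; rewrite ler_pdivrMr ?exprn_gt0// mulrC -ler_pdivrMr//.
    rewrite (le_trans (ltW (truncnS_gt _)))// -natrX ler_nat ltnW//.
    by rewrite (leq_trans (ltn_expl _ (isT : 1 < 2)%N))// leq_exp2r.
  by have := nu_le k A mA; rewrite A0 mule0 adde0 => /le_trans; apply; rewrite lee_fin.
have [r0 [mr0 r00 r0E]] := density_exists numu.
have nuT : nu setT = (beta * p)%:E.
  rewrite nuE// preimage_setT setTI product_measure1E//=.
  by rewrite [X in (X * _)%E](_ : _ = beta%:E) ?PE// lebesgue_measure_itv/= lte_fin beta0 oppr0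
    adde0.
have bp0 : 0 < beta * p by rewrite mulr_gt0.
pose c := (beta * p)^-1.
have c0 : 0 <= c by rewrite invr_ge0 ltW.
have r0T : (\int[leb]_x (r0 x)%:E = (beta * p)%:E)%E by rewrite -r0E.
have m_r0 : measurable_fun setT (fun x => (r0 x)%:E) by exact/measurable_EFinP.
exists (fun x => c * r0 x), (- (beta^-1 * ln p)); split.
- split; [exact: measurable_funM|by move=> x; rewrite mulr_ge0|].
  under eq_integral do rewrite EFinM.
  rewrite ge0_integralZl_EFin//; last by move=> x _; rewrite lee_fin.
  by rewrite r0T -EFinM mulVf// gt_eqF.
- under eq_integral do rewrite EFinM.
  have mcube := measurable_cube x0 eps.
  have mC : measurable (~` cube x0 eps) by exact: measurableC.
  rewrite ge0_integralZl_EFin//; last 2 first.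
  + by move=> x _; rewrite lee_fin.
  + exact: measurable_funTS.
  rewrite -r0E// nuE// (_ : _ `&` _ = set0) ?measure0 ?mule0//.
  apply/seteqP; split => -[t w] // -[nAz [/= tI Ew]]; apply: nAz.
  move: tI; rewrite in_itv/= => /andP[t0 tb].
  by rewrite /bm_path/= max_l//; exact: EB.
- under eq_integral do rewrite exprMn EFinM.
  rewrite ge0_integralZl_EFin//; last 3 first.
  + by move=> x _; rewrite lee_fin sqr_ge0.
  + by apply/measurable_EFinP; exact: (measurable_funX 2 mr0).
  + by rewrite sqr_ge0.
  rewrite lte_mul_pinfty ?lee_fin ?sqr_ge0//.
  apply: (square_integrable_of_splitting (ltW beta0) C0 mr0 r00).
    by rewrite r0T ltry.
  by move=> k A mA; rewrite -r0E//; exact: nu_le.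
move=> f [cf [M0 [_ bf]]].
pose M := M0 + 1.
have fM x : `|f x| <= M by apply: bf => //; rewrite /M ltrDl.
have mf : measurable_fun setT f by exact: continuous_measurable_rV.
have ifD := on_window_integrable beta0 mf fM mE.
have if_nu : nu.-integrable setT (EFin \o f) by exact: bounded_integrable fM.
have mf' : measurable_fun setT (EFin \o f) by exact/measurable_EFinP.
have if_nu0 : nu0.-integrable setT ((EFin \o f) \o bm_path).
  apply: (@bounded_integrable _ _ _ nu0 (f \o bm_path) M) => [|z]; last exact: fM.
  exact: (measurableT_comp mf measurable_bm_path).
have nuE' : (\int[nu]_x (f x)%:E = \int[prod]_z (f (bm_path z) * \1_D z)%:E)%E.
  rewrite (eq_measure_integral (image_measure nu0 measurable_bm_path)); last first.
    move=> A mA _; rewrite nuE//= /pushforward /nu0/= /density_measure integral_indic 1?setIC//.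
    exact: mpre.
  rewrite (integral_pushforward measurable_bm_path mf' _ measurableT)//.
  have prod_sf : sigma_finite setT prod.
    have [F UF mF] := sigma_finiteT (@lebesgue_measure R).
    exists (fun k => F k `*` setT) => [|k].
      by rewrite -setXTT UF; apply/seteqP; split=> -[t w] /= => [[[k _ Fk] _]|[k _ [Fk _]]];
        [exists k|split => //; exists k].
    have [mFk Fkoo] := mF k; split; first exact: measurableX.
    rewrite product_measure1E//; apply: lte_mul_pinfty => //.
    + by rewrite ge0_fin_numE.
    + by rewrite -ge0_fin_numE// fin_num_measure.
  have mD1 : measurable_fun setT (\1_D : measurableTypeR R * Omega -> R) by exact:
    measurable_indic.
  rewrite preimage_setT (@integral_density _ _ _ nu0 (sigma_finite_measure_of prod_sf) (\1_D) _
    _ mD1 if_nu0)//.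
have [S SE] : exists S, (\int[P]_w (path_integral B beta f w * \1_E w)%:E = S%:E)%E.
  exists (fine (\int[prod]_z (f (bm_path z) * \1_D z)%:E)%E).
  rewrite -(path_integral_indicE beta0 mf fM mE) fineK//.
  exact: integrable_fin_num ifD.
have frE : (\int[leb]_x (f x * (c * r0 x))%:E = (c * S)%:E)%E.
  under eq_integral do rewrite mulrCA EFinM.
  rewrite integralZl//; last first.
    have ir0 : leb.-integrable setT (EFin \o r0).
      apply/integrableP; split => //.
      under eq_integral do rewrite /= ger0_norm//.
      by rewrite r0T ltry.
    exact: (@pairing_integrable _ _ _ leb unit (fun=> f) (fun=> mf) (fun=> ex_intro _ M fM) tt).
  rewrite EFinM -SE -(path_integral_indicE beta0 mf fM mE) -nuE'; congr (_ * _)%E.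
  rewrite (integral_density r0E mr0 if_nu).
  by apply: eq_integral => x _; rewrite EFinM.
have := log_laplace_ge beta0 mf fM mE PE p0 SE; rewrite frE => h.
apply: (@le_trans _ _ ((c * S)%:E - beta^-1%:E * (S / p + ln p)%:E)%E).
  rewrite leeD2l// leeN2 lee_pmul2l// lte_fin invr_gt0//.
rewrite -EFinM -EFinB lee_fin /c le_eqVlt; apply/orP; left; apply/eqP.
by field; rewrite !gt_eqF.
Qed.

End brownian_occupation.

(** * Existence and stability of the minimiser *)

Section trap.
Context {R : realType} {d : nat}.
Variable W : 'rV[R]_d -> \bar R.
Hypothesis hW : trap_assumption W.
Local Notation leb := (lebesgue_rV (R := R) d).

Lemma trap_ge0 x : (0 <= W x)%E.
Proof. by case: hW. Qed.

(** Continuity of [W] is given within its domain only, but that domain is open in both alternatives,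
    so [W] is continuous in the full space at each of its points. *)
Lemma trap_open_lt (y : \bar R) : open [set x | (W x < y)%E].
Proof.
case: hW => _ cW _ dom.
have odom : open [set x | (W x < +oo)%E].
  by case: dom => [->|[]//]; exact: openT.
rewrite openE => x /= Wxy.
have Wx : (W x < +oo)%E by apply: lt_le_trans Wxy _; exact: leey.
have cx : {for x, continuous W}.
  move: cW; rewrite continuous_open_subspace// => cW.
  by apply: cW; rewrite inE.
by apply: (cx [set z | (z < y)%E]); exact: open_ereal_lt'.
Qed.

Lemma trap_measurable : measurable_fun setT W.
Proof.
apply: (measurability _ (ErealGenInftyO.measurableE R)) => _ [_ [y ->] <-].
rewrite setTI set_itvE; apply: open_measurable_rV; exact: trap_open_lt.
Qed.

Lemma trap_sublevel_finite (t : R) : (leb [set x | W x <= t%:E] < +oo)%E.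
Proof.
case: hW => _ _ /cvgeyPgt/(_ t)[M [Mr hM]] _.
have := hM (M + 1); rewrite ltrDl ltr01 => /(_ isT) tM.
apply: le_lt_trans (lebesgue_rV_cube_fin (0 : 'rV[R]_d) (M + 1)).
apply: le_measure; rewrite ?inE; last first.
- move=> x /= Wt i; rewrite mxE subr0.
  have [xM|Mx] := leP (euclidean_norm x) (M + 1).
    apply: le_trans xM; rewrite -sqrtr_sqr ler_sqrt; last first.
      by apply: sumr_ge0 => j _; exact: sqr_ge0.
    by rewrite (bigD1 i)//= lerDl; apply: sumr_ge0 => j _; exact: sqr_ge0.
  have : (W x < W x)%E.
    apply: le_lt_trans Wt _; apply: lt_le_trans tM _.
    by apply: ereal_inf_lbound; exists x.
  by rewrite ltxx.
- exact: measurable_cube.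
- rewrite (_ : [set _ | _] = setT `&` W @^-1` `]-oo, t%:E]%classic).
    by apply: trap_measurable => //; exact: emeasurable_itv.
  by rewrite setTI; apply/seteqP; split => x /=; rewrite in_itv.
Qed.

Lemma trap_locally_bounded x : (W x < +oo)%E ->
  exists eps M : R, 0 < eps /\ forall y, cube x eps y -> (W y <= M%:E)%E.
Proof.
move=> Wx.
have Wfin : W x \is a fin_num by rewrite ge0_fin_numE// trap_ge0.
have [|e e0 eW] := open_cube (trap_open_lt (y := (fine (W x) + 1)%:E)) (x := x).
  by rewrite /= -[X in (X < _)%E](fineK Wfin) lte_fin ltrDl.
by exists e, (fine (W x) + 1); split => // y /eW /= /ltW.
Qed.

(** Lindelof: with empty support every point would lie in a null cube with rational data, and the
    countably many such cubes would cover the space with total mass 0. *)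
Lemma support_nonempty (m : probability 'rV[R]_d R) : exists x, measure_support m x.
Proof.
apply: contrapT => /forallNP nosupp.
pose Z (p : 'rV[rat]_d * nat) := cube (map_mx ratr p.1 : 'rV[R]_d) (p.2.+1%:R^-1).
pose F (n : nat) : set 'rV[R]_d := if unpickle n is Some p then
  if `[< m (Z p) = 0%E >] then Z p else set0 else set0.
have mF n : measurable (F n).
  by rewrite /F; case: unpickle => // p; case: ifP => // _; exact: measurable_cube.
have F0 n : m (F n) = 0%E.
  by rewrite /F; case: unpickle => [p|]; [case: asboolP => //|]; rewrite measure0.
have FT : setT `<=` \bigcup_n F n.
  move=> x _; have := nosupp x => /existsNP[U /not_implyP[oU /not_implyP[Ux mU]]].
  have mU0 : m U = 0%E.
    by apply/eqP; rewrite eq_le measure_ge0 andbT leNgt; apply/negP.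
  have := Ux; rewrite {1}(open_bigcup_cube oU) => -[p /= pU px].
  exists (pickle p) => //; rewrite /F pickleK; case: asboolP => //; case.
  apply/eqP; rewrite eq_le measure_ge0 andbT -mU0.
  by apply: le_measure => //; rewrite inE; [exact: measurable_cube|exact: open_measurable_rV].
have : (m setT <= \sum_(n <oo) m (F n))%E.
  by apply: measure_sigma_subadditive.
rewrite eseries0 => [|n _ _]; last exact: F0.
by rewrite probability_setT lee_fin ler10.
Qed.

End trap.

(** * Norms as integrals of natural powers *)

Section Lfun_powers.
Context d (T : measurableType d) (R : realType) (mu : {measure set T -> \bar R}).
Implicit Types f : T -> R.

Lemma Lnorm_natpow n f : (0 < n)%N ->
  ('N[mu]_(n%:R)%:E[EFin \o f] `^ n%:R = \int[mu]_x (`|f x| ^+ n)%:E)%E.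
Proof.
move=> n0; rewrite powR_Lnorm ?pnatr_eq0 -?lt0n//.
by apply: eq_integral => x _; rewrite abse_EFin poweR_EFin powR_mulrn.
Qed.

Lemma Lfun_natpowP n f : (0 < n)%N ->
  f \in Lfun mu (n%:R)%:E <->
  measurable_fun setT f /\ (\int[mu]_x (`|f x| ^+ n)%:E < +oo)%E.
Proof.
move=> n0; rewrite -Lnorm_natpow//; split.
  by move=> /andP[]; rewrite !inE /finite_norm/= => mf /(poweR_lty n%:R).
move=> [mf foo]; apply/andP; rewrite !inE/= /finite_norm; split => //.
by apply: lty_poweRy foo; rewrite pnatr_eq0 -lt0n.
Qed.

Lemma Lnorm2_eq1 f : ('N[mu]_2%:E[EFin \o f] = 1 <-> \int[mu]_x (f x ^+ 2)%:E = 1)%E.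
Proof.
have <- : ('N[mu]_2%:E[EFin \o f] `^ 2 = \int[mu]_x (f x ^+ 2)%:E)%E.
  rewrite (@Lnorm_natpow 2)//.
  by apply: eq_integral => x _; rewrite real_normK// num_real.
split=> [->|h]; first by rewrite poweR1r.
have := Lnorm_ge0 mu 2%:E (EFin \o f); move: h; move: ('N[mu]_2%:E[_])%E => t h t0.
have -> : t = ((t `^ 2) `^ 2^-1)%E by rewrite -poweRrM divff// poweRe1.
by rewrite h poweR1r.
Qed.

End Lfun_powers.

(** * From functions [phi] to densities [phi ^ 2] *)

Section energy.
Context {R : realType} {d : nat} {disp : measure_display} {Omega : measurableType disp}.
Variables (P : probability Omega R) (m : probability 'rV[R]_d R) (B : R -> Omega -> 'rV[R]_d).
Variables (W : 'rV[R]_d -> \bar R) (alpha beta : R).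
Local Notation leb := (lebesgue_rV (R := R) d).

Lemma L2_normalisedP (phi : 'rV[R]_d -> R) :
  L2_normalised phi <-> measurable_fun setT phi /\ density leb (fun x => phi x ^+ 2).
Proof.
have abs2 : (\int[leb]_x (`|phi x| ^+ 2)%:E = \int[leb]_x (phi x ^+ 2)%:E)%E.
  by apply: eq_integral => x _; rewrite real_normK// num_real.
split=> [[/(@Lfun_natpowP _ _ _ _ 2)[]// mphi _ /Lnorm2_eq1 phi1]|[mphi [_ _ phi1]]].
  by split => //; split => // [|x]; [exact: measurable_funX|exact: sqr_ge0].
split; last exact/Lnorm2_eq1.
by apply/(@Lfun_natpowP _ _ _ _ 2) => //; split => //; rewrite abs2 phi1 ltry.
Qed.

Lemma density_sqrt (r : 'rV[R]_d -> R) : density leb r ->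
  L2_normalised (fun x => Num.sqrt (r x)) /\ (fun x => Num.sqrt (r x) ^+ 2) = r.
Proof.
move=> [mr r0 r1].
have rK : (fun x => Num.sqrt (r x) ^+ 2) = r by apply/funext => x; rewrite sqr_sqrtr.
split => //; apply/L2_normalisedP; rewrite rK; split => //.
by apply: (measurableT_comp _ mr); apply: continuous_measurable_fun; exact: sqrt_continuous.
Qed.

Definition test_function := {f : 'rV[R]_d -> R | bounded_continuous f}.
Definition test (f : test_function) : 'rV[R]_d -> R := sval f.

Definition log_laplace (f : test_function) : \bar R :=
  (beta^-1%:E * lne 'E_P[fun w => expR (path_integral B beta (test f) w)])%E.

Lemma test_measurable f : measurable_fun setT (test f).
Proof. by have [cf _] := svalP f; exact: continuous_measurable_rV. Qed.

Lemma test_bounded f : exists M : R, forall x, `|test f x| <= M.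
Proof.
have [_ [M [_ fM]]] := svalP f; exists (M + 1) => x.
by apply: fM => //; rewrite ltrDl.
Qed.

Lemma integral_square_measure (phi f : 'rV[R]_d -> R) (M : R) :
  L2_normalised phi -> measurable_fun setT f -> (forall x, `|f x| <= M) ->
  (\int[square_measure phi]_x (f x)%:E = \int[leb]_x (f x * phi x ^+ 2)%:E)%E.
Proof.
move=> /L2_normalisedP[_ dphi] mf fM.
have [mr r0 _] := dphi.
rewrite (integral_density (nu := density_finite_measure r0 (density_integrable dphi)) (mu :=
  leb) (r := fun x => phi x ^+ 2))//.
exact: bounded_integrable fM.
Qed.

Lemma rate_dual (phi : 'rV[R]_d -> R) : L2_normalised phi ->
  rate_J P B beta (square_measure phi) =
  dual_rate leb test log_laplace (fun x => phi x ^+ 2).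
Proof.
move=> Lphi; congr ereal_sup; apply/seteqP; split => y.
- case=> [f bcf <-]; exists (exist _ f bcf) => //.
  have [M fM] := test_bounded (exist _ f bcf).
  by rewrite (integral_square_measure Lphi (test_measurable (exist _ f bcf)) fM).
- case=> [f _ <-]; exists (test f); first by case: f.
  have [M fM] := test_bounded f.
  by rewrite (integral_square_measure Lphi (test_measurable f) fM).
Qed.

Lemma energy_functional (phi : 'rV[R]_d -> R) : L2_normalised phi ->
  energy P B W alpha beta phi =
  functional leb W test log_laplace (4 * pi * alpha) (fun x => phi x ^+ 2).
Proof.
move=> Lphi; rewrite /energy /functional rate_dual//; congr (_ + _ * _)%E.
apply: eq_integral => x _; rewrite -exprM.
by rewrite -normrX ger0_norm// exprn_even_ge0.
Qed.

(** Every density is the square of its normalised square root, so both infima run over the same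
    values. *)
Lemma chi_min_value : chi_tensor P B W alpha beta =
  min_value leb W test log_laplace (4 * pi * alpha).
Proof.
congr ereal_inf; apply/seteqP; split => y.
- move=> [phi Lphi <-]; exists (fun x => phi x ^+ 2); last by rewrite energy_functional.
  by have /L2_normalisedP[] := Lphi.
- move=> [r dr <-]; have [Lr rK] := density_sqrt dr.
  by exists (fun x => Num.sqrt (r x)) => //; rewrite energy_functional// rK.
Qed.

Lemma dual_rate_ge0 r : density leb r -> (0 <= dual_rate leb test log_laplace r)%E.
Proof.
move=> dr; apply: ereal_sup_ubound.
have b0 : bounded_continuous (cst 0 : 'rV[R]_d -> R).
  split; first exact: cst_continuous.
  by exists 0; split => // M M0 x _; rewrite /= normr0 ltW.
exists (exist _ _ b0) => //=.
under eq_integral do rewrite mul0r.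
rewrite integral0 add0e /log_laplace.
have -> : (fun w => expR (path_integral B beta (test (exist _ _ b0)) w)) = cst 1.
  apply/funext => w; rewrite /path_integral/= /Rintegral.
  by rewrite integral0_eq//= expR0.
by rewrite expectation_cst lne1 mule0 oppe0.
Qed.

Hypotheses (hW : trap_assumption W) (hm : measure_support m `<=` [set x | (W x < +oo)%E])
  (hB : brownian_motion P m B) (alpha0 : 0 < alpha) (beta0 : 0 < beta) (d3 : (d <= 3)%N).

Lemma finite_functional : exists2 r : 'rV[R]_d -> R, density leb r &
  (functional leb W test log_laplace (4 * pi * alpha) r < +oo)%E.
Proof.
have [x0 mx0] := support_nonempty m.
have [eps [M [eps0 WM]]] := trap_locally_bounded hW (hm mx0).
have [r [K [dr rout r2 rK]]] := finite_rate_density hB eps0 beta0 d3 mx0.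
have [mr r0 r1] := dr.
have mW := trap_measurable hW.
have mcube := measurable_cube x0 eps.
have mcubeC := measurableC mcube.
have mEr : measurable_fun setT (EFin \o r) by exact/measurable_EFinP.
have mWr : measurable_fun setT (fun x => W x * (r x)%:E)%E by exact: emeasurable_funM.
have Wr0 x : (0 <= W x * (r x)%:E)%E.
  by apply: mule_ge0; [exact: trap_ge0|rewrite lee_fin].
exists r => //; rewrite /functional.
have Jfin : (dual_rate leb test log_laplace r < +oo)%E.
  apply: (@le_lt_trans _ _ K%:E); last exact: ltry.
  by apply: ge_ereal_sup => _ [f _ <-]; apply: rK; case: f.
have Wfin : (\int[leb]_x (W x * (r x)%:E) < +oo)%E.
  rewrite -(setUv (cube x0 eps)) ge0_integral_setU//; last 2 first.
  - by rewrite setUv.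
  - by rewrite disj_set2E setICr.
  rewrite [X in (_ + X)%E](_ : _ = 0%E) ?adde0.
    apply: (@le_lt_trans _ _ (\int[leb]_(x in cube x0 eps) (M%:E * (r x)%:E))%E).
      apply: ge0_le_integral => //.
      - exact: measurable_funTS.
      - by apply: measurable_funTS; apply: emeasurable_funM.
      - by move=> x xc; apply: lee_wpmul2r; [rewrite lee_fin|exact: WM].
    have M0 : 0 <= M by rewrite -lee_fin (le_trans (trap_ge0 hW x0))// WM// => i;
      rewrite subrr normr0 ltW.
    apply: (@le_lt_trans _ _ (\int[leb]_x (M%:E * (r x)%:E))%E).
      by apply: ge0_subset_integral => //; [exact: emeasurable_funM|move=> x _;
        rewrite mule_ge0// lee_fin].
    rewrite ge0_integralZl_EFin// ?r1 ?mule1 ?ltry// => x _.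
    by rewrite lee_fin.
  (* Outside the cube [W] may be infinite; the product with [r] still vanishes almost everywhere, as
     [r] does and [+oo * 0 = 0]. *)
  have : ae_eq leb (~` cube x0 eps) (EFin \o r) (cst 0%E).
    apply/ae_eq_integral_abs => //; first exact: measurable_funTS.
    by rewrite -[RHS]rout; apply: eq_integral => x _; rewrite /= ger0_norm.
  move=> rae; rewrite (ae_eq_integral (cst 0%E)) ?integral0//.
  - exact: measurable_funTS.
  - apply: filterS rae => x /= h xc; have := h xc => -[->].
    by rewrite mule0.
apply: lte_add_pinfty; first exact: lte_add_pinfty.
by rewrite lte_mul_pinfty// lee_fin !mulr_ge0// ?pi_ge0// ltW.
Qed.

Lemma energy_minimiser : exists phi_ : 'rV[R]_d -> R,
  [/\ L2_normalised phi_, forall x, 0 <= phi_ x,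
      energy P B W alpha beta phi_ = chi_tensor P B W alpha beta,
      chi_tensor P B W alpha beta \is a fin_num
    & forall eps : R, 0 < eps -> exists2 del : R, 0 < del &
      forall phi, L2_normalised phi ->
      (energy P B W alpha beta phi <= chi_tensor P B W alpha beta + del%:E)%E ->
      (\int[leb]_x `|phi x ^+ 2 - phi_ x ^+ 2|%:E <= eps%:E)%E /\
      (\int[leb]_x ((phi x ^+ 2 - phi_ x ^+ 2) ^+ 2)%:E <= eps%:E)%E].
Proof.
have k0 : 0 < 4 * pi * alpha by rewrite !mulr_gt0// pi_gt0.
have W0 := trap_ge0 hW.
have [v [dv vmin stable]] := minimiser_exists k0 W0 (trap_measurable hW)
  test_measurable test_bounded dual_rate_ge0 (trap_sublevel_finite hW) finite_functional.
have [Lv vK] := density_sqrt dv.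
exists (fun x => Num.sqrt (v x)); split => //.
- by rewrite energy_functional// vK chi_min_value.
- rewrite chi_min_value; exact: (min_value_fin k0 W0 dual_rate_ge0 finite_functional).
move=> eps eps0; have [del del0 hdel] := stable eps eps0; exists del => // phi Lphi.
rewrite energy_functional// chi_min_value => h.
have /L2_normalisedP[_ dphi] := Lphi.
have [h1 h2] := hdel _ dphi h.
split.
- apply: le_trans h1; rewrite le_eqVlt; apply/orP; left; apply/eqP.
  by apply: eq_integral => x _; rewrite -[in RHS]vK.
- apply: le_trans h2; rewrite le_eqVlt; apply/orP; left; apply/eqP.
  by apply: eq_integral => x _; rewrite -[in RHS]vK.
Qed.

(** The fourth power occurs in the energy with a positive coefficient, next to nonnegative terms
    that cannot cancel it. *)
Lemma finite_energy_L4 phi : L2_normalised phi ->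
  (energy P B W alpha beta phi < +oo)%E -> L2_cap_L4 phi.
Proof.
move=> Lphi Efin; split; first by case: Lphi.
have /L2_normalisedP[mphi dphi] := Lphi.
have k0 : 0 < 4 * pi * alpha by rewrite !mulr_gt0// pi_gt0.
apply/(@Lfun_natpowP _ _ _ _ 4) => //; split => //.
rewrite ltNge leye_eq; apply/negP => /eqP h.
move: Efin; rewrite /energy h gt0_muley// addey ?ltxx//.
rewrite rate_dual//; apply/eqP => /eqP; apply/negP; rewrite -lteNye.
apply: (@lt_le_trans _ _ 0%E) => //; apply: adde_ge0; first exact: dual_rate_ge0.
by apply: integral_ge0 => x _; apply: mule_ge0; [exact: trap_ge0|rewrite lee_fin sqr_ge0].
Qed.

End energy.

(** * Weak neighbourhoods *)

Lemma cvg_initial (S : choiceType) (T : topologicalType) (f : S -> T)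
    (F : set_system S) (s : S) : Filter F ->
  f @ F --> f s -> F --> (s : initial_topology f).
Proof.
move=> FF fF A; rewrite /= nbhsE => -[_ [[C oC <-] Cs] CA].
by apply: filterS CA _; apply: fF; exact: open_nbhs_nbhs.
Qed.

(** The pointwise topology is the supremum of the topologies induced by the evaluations, so
    convergence of each single pairing puts the sequence eventually into [N]. *)
Lemma near_initial_ptws (S : choiceType) (I : Type) (R : realType)
    (f : S -> {ptws I -> R}) (s : S) (u : nat -> S) (N : set S) :
  nbhs (s : initial_topology f) N ->
  (forall i, f (u n) i @[n --> \oo] --> f s i) ->
  \forall n \near \oo, N (u n).
Proof.
move=> sN fu; have : u @ \oo --> (s : initial_topology f); last exact.
apply: cvg_initial; apply/cvg_sup => i; apply: cvg_initial.
exact: fu.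
Qed.

Section hoelder_pairing.
Context d (T : measurableType d) (R : realType) (mu : {measure set T -> \bar R}).
Variable p : nat.
Hypothesis p1 : (1 < p)%N.
Implicit Types f g h : T -> R.

Lemma hoelder_conjugate_nat :
  hoelder_conjugate (p%:R : R)%:E = (p%:R / (p%:R - 1) : R)%:E.
Proof.
have p0 : (p%:R - 1 : R) != 0 by rewrite subr_eq0 gt_eqF// ltr1n.
rewrite /hoelder_conjugate/= eqe pnatr_eq0 gtn_eqF ?(ltn_trans _ p1)//.
by rewrite -EFinB EFinM inver (negbTE p0).
Qed.

Lemma hoelder_pairing f g : f \in Lfun mu (p%:R)%:E ->
  g \in Lfun mu (hoelder_conjugate (p%:R)%:E) ->
  mu.-integrable setT (fun x => (f x * g x)%:E) /\
  (\int[mu]_x `|f x * g x|%:E <=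
   'N[mu]_(p%:R)%:E[EFin \o f] * 'N[mu]_(hoelder_conjugate (p%:R)%:E)[EFin \o g])%E.
Proof.
move=> /andP[]; rewrite !inE /finite_norm/= => mf Nf /andP[];
  rewrite !inE /finite_norm/= => mg Ng.
have p0 : 0 < p%:R - 1 :> R by rewrite subr_gt0 ltr1n.
have pp : 0 < p%:R :> R by rewrite ltr0n (ltn_trans _ p1).
have le : (\int[mu]_x `|f x * g x|%:E <=
   'N[mu]_(p%:R)%:E[EFin \o f] * 'N[mu]_(hoelder_conjugate (p%:R)%:E)[EFin \o g])%E.
  rewrite hoelder_conjugate_nat.
  apply: le_trans (hoelder mu mf mg pp (q := p%:R / (p%:R - 1)) _ _).
  - by rewrite Lnorm1.
  - by rewrite divr_gt0.
  - by rewrite invf_div -[X in X + _]mul1r -mulrDl addrC subrK divff// gt_eqF.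
split => //; apply/integrableP; split.
  by apply/measurable_EFinP; exact: measurable_funM.
by apply: le_lt_trans le _; rewrite lte_mul_pinfty ?Lnorm_ge0// ge0_fin_numE ?Lnorm_ge0.
Qed.

Lemma Lnorm_le_root f (eta : R) : 0 < eta ->
  (\int[mu]_x (`|f x| ^+ p)%:E <= (eta ^+ p)%:E)%E ->
  ('N[mu]_(p%:R)%:E[EFin \o f] <= eta%:E)%E.
Proof.
move=> eta0; have p0 : (0 < p)%N by exact: ltn_trans p1.
rewrite -Lnorm_natpow// -powR_mulrn ?(ltW eta0)// -poweR_EFin => h.
have t0 := Lnorm_ge0 mu (p%:R)%:E (EFin \o f).
move: h t0; move: ('N[mu]_(p%:R)%:E[_])%E => t h t0.
have pK (s : \bar R) : (0 <= s)%E -> s = ((s `^ p%:R) `^ p%:R^-1)%E.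
  by move=> s0; rewrite -poweRrM divff ?poweRe1// pnatr_eq0 -lt0n.
rewrite (pK t)// (pK eta%:E) ?lee_fin ?(ltW eta0)//.
have in0y (s : \bar R) : (s `^ p%:R)%E \in `[0%E, +oo%E] by rewrite in_itv/= poweR_ge0 leey.
by apply: (gt0_ler_poweR _ (in0y t) (in0y eta%:E) h); rewrite invr_ge0.
Qed.

Lemma Lp_weak_cvg (u : nat -> T -> R) f g :
  (forall n, u n \in Lfun mu (p%:R)%:E) -> f \in Lfun mu (p%:R)%:E ->
  g \in Lfun mu (hoelder_conjugate (p%:R)%:E) ->
  (forall eps : R, 0 < eps -> \forall n \near \oo,
     (\int[mu]_x (`|u n x - f x| ^+ p)%:E <= eps%:E)%E) ->
  \int[mu]_x (u n x * g x) @[n --> \oo] --> \int[mu]_x (f x * g x).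
Proof.
move=> Lu Lf Lg uf.
have p1' : (1 <= (p%:R : R)%:E)%E by rewrite lee_fin ler1n ltnW.
pose G := fine ('N[mu]_(hoelder_conjugate (p%:R)%:E)[EFin \o g])%E.
have GE : ('N[mu]_(hoelder_conjugate (p%:R)%:E)[EFin \o g] = G%:E)%E.
  by rewrite fineK// ge0_fin_numE ?Lnorm_ge0//; move/andP : Lg => []; rewrite !inE.
have G0 : 0 <= G by rewrite -lee_fin -GE Lnorm_ge0.
apply/cvgrPdist_le => e e0.
(* The added 1 covers the case where the dual norm [G] of [g] is 0. *)
have eta0 : 0 < e / (G + 1) by rewrite divr_gt0// ltr_wpDl.
apply: filterS (uf _ (exprn_gt0 p eta0)) => n /(Lnorm_le_root eta0) h.
have Lh : (fun x => u n x - f x) \in Lfun mu (p%:R)%:E.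
  have [_ cl] := Lfun_submod_closed mu p1'.
  rewrite (_ : (fun x => _) = (-1) *: f + u n); first exact: cl.
  by apply/funext => x; rewrite /= addrC scaleN1r.
have [ih leh] := hoelder_pairing Lh Lg.
have [iu _] := hoelder_pairing (Lu n) Lg.
have [if_ _] := hoelder_pairing Lf Lg.
rewrite distrC -RintegralB//.
under eq_Rintegral do rewrite -mulrBl.
rewrite -lee_fin; apply: (@le_trans _ _ (\int[mu]_x `|(u n x - f x) * g x|%:E)%E).
  rewrite /Rintegral -[X in (X <= _)%E]/(`|(fine _)%:E|)%E fineK; last exact: integrable_fin_num.
  by apply: le_abse_integral => //; exact: measurable_int ih.
apply: le_trans leh _; rewrite GE.
apply: (@le_trans _ _ ((e / (G + 1))%:E * G%:E)%E).
  by apply: lee_wpmul2r; rewrite ?lee_fin.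
rewrite -EFinM lee_fin mulrAC ler_pdivrMr ?ltr_wpDl// ler_wpM2l// ?ltW//.
by rewrite ltrDl.
Qed.

End hoelder_pairing.

Lemma sqr_dist_le (R : realDomainType) (a b : R) : 0 <= a -> 0 <= b ->
  `|a - b| ^+ 2 <= `|a ^+ 2 - b ^+ 2|.
Proof.
move=> a0 b0; rewrite subr_sqr normrM expr2 ler_wpM2l//.
by rewrite (le_trans (ler_normB _ _))// !ger0_norm// addr_ge0.
Qed.

Section weak_neighbourhoods.
Context {R : realType} {d : nat}.
Local Notation leb := (lebesgue_rV (R := R) d).
Variables (phi_ : 'rV[R]_d -> R) (u : nat -> 'rV[R]_d -> R).
Hypotheses (phi_L2 : L2_normalised phi_) (phi_L24 : L2_cap_L4 phi_)
  (phi_ge0 : forall x, 0 <= phi_ x).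
Hypotheses (u_L2 : forall n, L2_normalised (u n)) (u_L24 : forall n, L2_cap_L4 (u n)).
Hypothesis u_cvg : forall eps : R, 0 < eps -> \forall n \near \oo,
  (\int[leb]_x `|u n x ^+ 2 - phi_ x ^+ 2|%:E <= eps%:E)%E /\
  (\int[leb]_x ((u n x ^+ 2 - phi_ x ^+ 2) ^+ 2)%:E <= eps%:E)%E.

Let abs_L24 n : L2_cap_L4 (fun x => `|u n x|).
Proof.
have absL p : (0 < p)%N -> u n \in Lfun leb (p%:R)%:E ->
    (fun x => `|u n x|) \in Lfun leb (p%:R)%:E.
  move=> p0 /Lfun_natpowP[]// mu foo; apply/Lfun_natpowP => //; split.
    exact: measurableT_comp.
  by under eq_integral do rewrite normr_id.
by have [u2 u4] := u_L24 n; split; [exact: (absL 2%N)|exact: (absL 4%N)].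
Qed.

Let mu_ n : measurable_fun setT (u n).
Proof. by have /L2_normalisedP[] := u_L2 n. Qed.

Let mphi : measurable_fun setT phi_.
Proof. by have /L2_normalisedP[] := phi_L2. Qed.

(** Moduli appear because closeness of the squares controls only [|u n|]: the L^1 distance of the
    squares bounds the squared L^2 distance of [|u n|] from [phi_], and strong convergence implies
    weak. *)
Lemma near_nbhs_weak_L2 N : nbhs_weak_Lp 2%:E phi_ N ->
  \forall n \near \oo, N (fun x => `|u n x|).
Proof.
move=> phiN; have : \forall n \near \oo, L2_cap_L4 (fun x => `|u n x|) -> N (fun x => `|u n x|).
  apply: (near_initial_ptws phiN) => g; apply: (@Lp_weak_cvg _ _ _ _ 2) => //.
  - by move=> n; have [] := abs_L24 n.
  - by have [] := phi_L24.
  - by have := valP g; rewrite inE.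
  - move=> eps eps0; apply: filterS (u_cvg eps0) => n [h _]; apply: le_trans h.
    apply: ge0_le_integral => //.
    + by apply/measurable_EFinP; apply: measurable_funX; apply: measurableT_comp => //;
      apply: measurable_funB => //; exact: measurableT_comp.
    + by apply/measurable_EFinP; apply: measurableT_comp => //; apply: measurable_funB;
      exact: measurable_funX.
    + move=> x _; rewrite lee_fin -(real_normK (num_real (u n x))).
      exact: sqr_dist_le.
by apply: filterS => n; apply; exact: abs_L24.
Qed.

Lemma near_nbhs_weak_L4 N : nbhs_weak_Lp 4%:E phi_ N ->
  \forall n \near \oo, N (fun x => `|u n x|).
Proof.
move=> phiN; have : \forall n \near \oo, L2_cap_L4 (fun x => `|u n x|) -> N (fun x => `|u n x|).
  apply: (near_initial_ptws phiN) => g; apply: (@Lp_weak_cvg _ _ _ _ 4) => //.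
  - by move=> n; have [] := abs_L24 n.
  - by have [] := phi_L24.
  - by have := valP g; rewrite inE.
  - move=> eps eps0; apply: filterS (u_cvg eps0) => n [_ h]; apply: le_trans h.
    apply: ge0_le_integral => //.
    + by apply/measurable_EFinP; apply: measurable_funX; apply: measurableT_comp => //;
      apply: measurable_funB => //; exact: measurableT_comp.
    + by apply/measurable_EFinP; apply: measurable_funX; apply: measurable_funB;
      exact: measurable_funX.
    + move=> x _; rewrite lee_fin -(real_normK (num_real (u n x))).
      (* Squaring [sqr_dist_le] bounds the fourth power by [(u^2 - phi_^2)^2], whose integral is the
         L^2 part of [u_cvg]. *)
      rewrite (_ : 4%N = (2 * 2)%N)// exprM -[leRHS](real_normK (num_real _)).
      by rewrite ler_pXn2r ?nnegrE ?exprn_ge0//; exact: sqr_dist_le.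
by apply: filterS => n; apply; exact: abs_L24.
Qed.

Lemma near_nbhs_weak_measure N : nbhs_weak_measure phi_ N ->
  \forall n \near \oo, N (u n).
Proof.
move=> phiN; have : \forall n \near \oo, L2_cap_L4 (u n) -> N (u n).
  apply: (near_initial_ptws phiN) => f; rewrite /measure_pairing.
  have bcf : bounded_continuous (\val f) by have := valP f; rewrite inE.
  pose f' : test_function := exist _ _ bcf.
  have [M fM] := test_bounded f'; have mf := test_measurable f'.
  have den phi : L2_normalised phi -> leb.-integrable setT (EFin \o (fun x => phi x ^+ 2)).
    by move=> /L2_normalisedP[_ /density_integrable].
  have fin phi : L2_normalised phi -> leb.-integrable setT (fun x => (\val f x * phi x ^+ 2)%:E).
    move=> /den; apply: (@pairing_integrable _ _ _ leb unit (fun=> \val f) (fun=> mf) (fun=>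
      ex_intro _ M fM) tt).
  apply/cvgrPdist_le => e e0.
  have M0 : 0 <= M by rewrite (le_trans _ (fM 0)).
  have eta0 : 0 < e / (M + 1) by rewrite divr_gt0// ltr_wpDl.
  apply: filterS (u_cvg eta0) => n [h _].
  rewrite (integral_square_measure phi_L2 mf fM) (integral_square_measure (u_L2 n) mf fM).
  have le1 := @pairing_lipschitz _ _ _ leb unit (fun=> \val f) (fun=> mf) (fun=> ex_intro _ M
    fM) tt M _ _ fM (den _ (u_L2 n)) (den _ phi_L2).
  have le2 := @pairing_lipschitz _ _ _ leb unit (fun=> \val f) (fun=> mf) (fun=> ex_intro _ M
    fM) tt M _ _ fM (den _ phi_L2) (den _ (u_L2 n)).
  have hM : (M%:E * \int[leb]_x `|u n x ^+ 2 - phi_ x ^+ 2|%:E <= e%:E)%E.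
    apply: (@le_trans _ _ (M%:E * (e / (M + 1))%:E)%E).
      by apply: lee_wpmul2l; rewrite ?lee_fin.
    rewrite -EFinM lee_fin mulrA ler_pdivrMr ?ltr_wpDl// mulrC ler_wpM2l// ?(ltW e0)//.
    by rewrite lerDl.
  have distE : (\int[leb]_x `|phi_ x ^+ 2 - u n x ^+ 2|%:E = \int[leb]_x `|u n x ^+ 2 - phi_ x
    ^+ 2|%:E)%E.
    by apply: eq_integral => x _; rewrite distrC.
  move: le1 le2; rewrite distE.
  have fu := integrable_fin_num measurableT (fin _ (u_L2 n)).
  have fp := integrable_fin_num measurableT (fin _ phi_L2).
  move=> le1 le2; have := le_trans le1 (leeD2l _ hM); have := le_trans le2 (leeD2l _ hM).
  rewrite -(fineK fu) -(fineK fp) -!EFinD !lee_fin /= => h1 h2.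
  rewrite ler_distl; apply/andP; split; lra.
by apply: filterS => n; apply.
Qed.

End weak_neighbourhoods.

(** If the infimum were at most [chi], finiteness of [chi] would place some element of [A] below
    [chi + 1/(n+1)] for each [n]. Sequences thus suffice for part (ii), although the weak topologies
    may fail to be first countable. *)
Lemma ereal_inf_gt_of_sequences (R : realType) (T : Type) (A : set T)
    (E : T -> \bar R) (chi : \bar R) : chi \is a fin_num ->
  (forall u : nat -> T, (forall n, A (u n)) ->
     (forall n, E (u n) <= chi + n.+1%:R^-1%:E)%E -> False) ->
  (chi < ereal_inf [set E x | x in A])%E.
Proof.
move=> chifin noseq; rewrite ltNge; apply/negP => inf_le.
have /choice[u uP] : forall n : nat, exists x, A x /\ (E x <= chi + n.+1%:R^-1%:E)%E.
  move=> n; have : (ereal_inf [set E x | x in A] < chi + n.+1%:R^-1%:E)%E.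
    by apply: le_lt_trans inf_le _; rewrite lteDl// lte_fin invr_gt0.
  by move=> /ereal_inf_lt[_ [x Ax <-] /ltW]; exists x.
by apply: (noseq u) => n; have [] := uP n.
Qed.

Theorem lemma1p2 (R : realType) (d : nat) (hd : d = 2%N \/ d = 3%N)
    (W : 'rV[R]_d -> \bar R) (hW : trap_assumption W)
    (m : probability 'rV[R]_d R)
    (hm : measure_support m `<=` [set x | (W x < +oo)%E])
    (disp : measure_display) (Omega : measurableType disp)
    (P : probability Omega R) (B : R -> Omega -> 'rV[R]_d)
    (hB : brownian_motion P m B)
    (alpha beta : R) (halpha : 0 < alpha) (hbeta : 0 < beta) :
  exists phi_ : 'rV[R]_d -> R,
    [/\ L2_normalised phi_ /\ L2_cap_L4 phi_,
        forall x, 0 <= phi_ x,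
        energy P B W alpha beta phi_ = chi_tensor P B W alpha beta,
        forall psi, L2_normalised psi ->
          energy P B W alpha beta psi = chi_tensor P B W alpha beta ->
          {ae lebesgue_rV d, forall x, `|psi x| = phi_ x}
      & forall N : set ('rV[R]_d -> R), N `<=` L2_cap_L4 ->
          (nbhs_weak_Lp 2%:E phi_ N \/ nbhs_weak_Lp 4%:E phi_ N ->
             (chi_tensor P B W alpha beta <
              ereal_inf [set energy P B W alpha beta phi |
                phi in [set phi | L2_normalised phi /\
                                  ~ N (fun x => `|phi x|%R)]])%E) /\
          (nbhs_weak_measure phi_ N ->
             (chi_tensor P B W alpha beta <
              ereal_inf [set energy P B W alpha beta phi |
                phi in [set phi | L2_normalised phi /\ ~ N phi]])%E)].

Proof.
have d3 : (d <= 3)%N by case: hd => ->.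
have [phi_ [L2phi phi0 phimin chifin stable]] := energy_minimiser hW hm hB halpha hbeta d3.
have L4 := finite_energy_L4 hW halpha.
have L24phi : L2_cap_L4 phi_ by apply: (L4 _ _ P B beta) => //; rewrite phimin ltey_eq chifin.
have near_min (u : nat -> 'rV[R]_d -> R) :
    (forall n, L2_normalised (u n)) ->
    (forall n, energy P B W alpha beta (u n) <= chi_tensor P B W alpha beta + n.+1%:R^-1%:E)%E ->
    (forall n, L2_cap_L4 (u n)) /\ forall eps : R, 0 < eps -> \forall n \near \oo,
      (\int[lebesgue_rV d]_x `|u n x ^+ 2 - phi_ x ^+ 2|%:E <= eps%:E)%E /\
      (\int[lebesgue_rV d]_x ((u n x ^+ 2 - phi_ x ^+ 2) ^+ 2)%:E <= eps%:E)%E.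
  move=> Lu Eu; split=> [n|eps /stable[del del0 hdel]].
    apply: (L4 _ _ P B beta) => //; apply: le_lt_trans (Eu n) _.
    by rewrite lte_add_pinfty ?ltry// ltey_eq chifin.
  apply: filterS (near_infty_natSinv_lt (PosNum del0)) => n /= ndel.
  apply: hdel => //; apply: le_trans (Eu n) _.
  by rewrite leeD2l// lee_fin ltW.
exists phi_; split => //.
- move=> psi L2psi psimin.
  have mpsi : measurable_fun setT psi by have /L2_normalisedP[] := L2psi.
  have mphi : measurable_fun setT phi_ by have /L2_normalisedP[] := L2phi.
  have m2 : measurable_fun setT (fun x => psi x ^+ 2 - phi_ x ^+ 2).
    by apply: measurable_funB; exact: measurable_funX.
  (* A second minimiser is a [del]-almost-minimiser for every [del], so the L^1 distance of the
     squares is below every positive [eps]. *)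
  have int0 : (\int[lebesgue_rV d]_x `|(EFin \o (fun x => psi x ^+ 2 - phi_ x ^+ 2)%R) x|)%E =
    0%E.
    apply/eqP; rewrite eq_le integral_ge0 ?andbT//.
    apply/lee_addgt0Pr => eps eps0; rewrite add0e.
    have [del del0 hdel] := stable _ eps0.
    by have [] := hdel psi L2psi; first by rewrite psimin leeDl// lee_fin ltW.
  have m2' : measurable_fun setT (EFin \o (fun x => psi x ^+ 2 - phi_ x ^+ 2)) by
    exact/measurable_EFinP.
  apply: filterS ((ae_eq_integral_abs _ measurableT m2').1 int0) => x /(_ I)[] /eqP;
    rewrite subr_eq0 -(real_normK (num_real (psi x))).
  by rewrite eqrXn2// => /eqP.
- move=> N NL; split.
  + move=> phiN; apply: ereal_inf_gt_of_sequences => // u uP Eu.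
    have Lu n : L2_normalised (u n) by have [] := uP n.
    have [L24u cu] := near_min u Lu Eu.
    (* The sequence avoids [N] at every index, yet almost-minimality drives its moduli into [N]
       eventually. *)
    have [n _ /(_ n (leqnn n))] : \forall n \near \oo, N (fun x => `|u n x|).
      by case: phiN; [exact: near_nbhs_weak_L2|exact: near_nbhs_weak_L4].
    by have [] := uP n.
  + move=> phiN; apply: ereal_inf_gt_of_sequences => // u uP Eu.
    have Lu n : L2_normalised (u n) by have [] := uP n.
    have [L24u cu] := near_min u Lu Eu.
    have [n _ /(_ n (leqnn n))] : \forall n \near \oo, N (u n).
      exact: (near_nbhs_weak_measure L2phi Lu L24u cu phiN).
    by have [] := uP n.
Qed.
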